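(* Let $p\ge 1$ be an integer, let $a,t\in\mathbb{C}$ with $\operatorname{Re} a>0$ and $|t|<\operatorname{Re} a$. Then $$\sum_{n=1}^{\infty}\frac{\zeta(n+1,a)}{(n+1)(n+2)\cdots(n+p)}\,t^{n+p}=\frac{t^p}{p!}\bigl(\psi(a)+\gamma\bigr)+\frac{1}{(p-1)!}\sum_{k=0}^{p-1}(-1)^{k+1}\binom{p-1}{k}\,g(k,a)\,t^{p-k-1}-\frac{(-1)^p}{(p-1)!}\,g(p-1,a-t).$$
   Context: For $\operatorname{Re} a>0$, $\zeta(s,a)$ is the Hurwitz zeta function: $\zeta(s,a)=\sum_{n=0}^\infty (n+a)^{-s}$ for $\operatorname{Re} s>1$ (principal powers), extended analytically in $s$ to $\mathbb{C}\setminus\{1\}$; $\zeta'(s,a)=\partial_s\zeta(s,a)$. $\psi=\Gamma'/\Gamma$ is the digamma function and $\gamma=-\psi(1)$ is Euler's constant. For integers $n\ge 0$ and $\operatorname{Re} a>0$, $$g(n,a)=\zeta'(-n,a)+\psi(n+1)\,\zeta(-n,a).$$ The convention $t^0=1$ (also for $t=0$) is used. *)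

(* Defs.v *)
From Stdlib Require Import Reals Factorial ClassicalEpsilon.
From Coquelicot Require Import Coquelicot.

Local Open Scope C_scope.

Definition Cexp (z : C) : C := (exp (Re z) * cos (Im z), exp (Re z) * sin (Im z))%R.

(* Principal argument, in (-PI, PI]; meaningful for z <> 0 only. *)
Definition Carg (z : C) : R :=
  if Rle_dec 0 (Im z) then acos (Re z / Cmod z) else (- acos (Re z / Cmod z))%R.

Definition Clog (z : C) : C := (ln (Cmod z), Carg z).

(* Principal power; meaningful for z <> 0 only. *)
Definition Cpower (z w : C) : C := Cexp (w * Clog z).

(* Euler's integral; meaningful for 0 < Re z. *)
Definition Gamma (z : C) : C :=
  RInt_gen (V := C_R_CompleteNormedModule)
    (fun x : R => Cpower (RtoC x) (z - 1) * RtoC (exp (- x)))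
    (at_right 0) (Rbar_locally p_infty).

Definition digamma (z : C) : C := C_derive Gamma z / Gamma z.

Definition Euler_gamma : C := - digamma 1.

Definition analytic_at (f : C -> C) (z0 : C) : Prop :=
  exists (c : nat -> C) (r : R),
    (0 < r)%R /\
    forall z : C, (Cmod (z - z0) < r)%R ->
      is_pseries (K := C_AbsRing) (V := C_NormedModule) c (z - z0) (f z).

Definition is_hurwitz_continuation (a : C) (F : C -> C) : Prop :=
  (forall s : C, (1 < Re s)%R ->
     is_series (K := C_AbsRing) (V := C_NormedModule)
       (fun n : nat => Cpower (RtoC (INR n) + a) (- s)) (F s)) /\
  (forall s : C, s <> 1 -> analytic_at F s).

(* For 0 < Re a the continuation exists and, C minus {1} being connected, is
   unique away from s = 1; its value at s = 1 is unspecified. *)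
Definition hurwitz_zeta (s a : C) : C :=
  epsilon (inhabits (fun _ : C => RtoC 0)) (is_hurwitz_continuation a) s.

Definition hurwitz_zeta' (s a : C) : C := C_derive (fun u : C => hurwitz_zeta u a) s.

Definition g (n : nat) (a : C) : C :=
  hurwitz_zeta' (- RtoC (INR n)) a
  + digamma (RtoC (INR n + 1)) * hurwitz_zeta (- RtoC (INR n)) a.

(* (n + 1) (n + 2) ... (n + p) *)
Fixpoint rising (n p : nat) : nat :=
  match p with
  | O => 1
  | S q => rising n q * (n + S q)
  end.

(* Main.v *)
(** Write [Z(s, a) = (s - 1) zeta(s, a)], an entire function of [s], and [(s)_k] for
    the rising factorial.  The binomial series and Fubini give, for
    [|t| < Re a], the shift formula
      [Z(s, a - t) = sum_k (s - 1)_k / k! * t^k * Z(s + k, a)],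
    first for [Re s > 1] and then everywhere by uniqueness of the continuation.
    The same formula with [t = -1] expresses [Z(s, a)] through the [Z(s + k, a)],
    [k >= 1], which constructs the continuation one vertical strip at a time.
    Dividing by [s - 1] and differentiating termwise at [s = - n], [n = p - 1],
    the terms [k <= n] give the [g(n - k, a)]; for [k > n + 1] the factor
    [(s)_(k-1)] has a simple zero and leaves [zeta(k - n, a)]; the term
    [k = n + 1] involves [Z'(1, a)].

    The identity [Z'(1, a) = - psi(a)] follows by comparing limits: the shift
    formula gives [Z'(1, a) = lim_N (sum_(k<N) 1/(a+k) - ln N)], while
    [Gamma(z+1) = z Gamma(z)] reduces [psi(z) = lim_N (ln N - sum_(k<N) 1/(z+k))]
    to [psi(z + N) - ln N -> 0]; there the integrand is concentrated near [x = N],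
    which is measured by [ln^2 y <= 4 (y - 2 + 1/y)] for [y = x / N]. *)

Require Import Defs.
From Stdlib Require Import Reals Arith Factorial Lra Lia Classical ClassicalEpsilon FunctionalExtensionality.
From Coquelicot Require Import Coquelicot.
Local Open Scope C_scope.

(** The summand [psi(n + 1) zeta(-n, a)] in [g] is what makes the formula close up. Differentiating
    [(s)_k] at [s = -n] produces its logarithmic derivative [sum_(j<k) 1/(j - n)]; adding
    [psi(n + 1)] turns this into [psi(n - k + 1)]. Hence for [k <= n] a term is exactly a multiple
    of [g(n - k, a)], without leftover harmonic numbers, and for [k = n + 1] there remains
    [psi(1) = -gamma].

    The obstacle is the pole: at [s = -n] the term [k = n + 1] evaluates zeta at 1. Passing to [Z]
    removes the exceptional point, so that all terms can be differentiated on the same footing.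

    The digamma function is a quotient, so the limit [psi(z + N) - ln N -> 0] also needs a lower
    bound for [|Gamma(z + N)|], which for complex [z] might be spoilt by cancellation in the
    integral. Comparison with [N^(i Im z) Gamma(Re z + N)] excludes this, and shows at the same time
    that [Gamma] has no zero in the half plane. *)

Local Notation NtoC n := (RtoC (INR n)) (only parsing).
Local Notation Cseries := (@is_series C_AbsRing C_NormedModule).

(** * Partial sums, convergence and interchange of summation *)

Definition Csum (u : nat -> C) (n : nat) : C := @sum_n C_AbelianMonoid u n.
Definition Rsum (u : nat -> R) (n : nat) : R := @sum_n R_AbelianMonoid u n.

Lemma Cseries_eps (u : nat -> C) (l : C) :
  Cseries u l <->
  forall eps : R, (0 < eps)%R ->
    exists N, forall n, (N <= n)%nat -> (Cmod (Csum u n - l) < eps)%R.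
Proof.
  unfold is_series. rewrite (@filterlim_locally_ball_norm C_AbsRing nat C_NormedModule eventually _). split.
  - intros H eps He. destruct (H (mkposreal eps He)) as [N HN].
    exists N. intros n Hn. apply (HN n Hn).
  - intros H eps. destruct (H eps (cond_pos eps)) as [N HN].
    exists N. intros n Hn. apply (HN n Hn).
Qed.

Lemma Csum_Cmod (u : nat -> C) n :
  (Cmod (Csum u n) <= Rsum (fun k => Cmod (u k)) n)%R.
Proof. apply (@norm_sum_n_m C_AbsRing C_NormedModule u 0 n). Qed.

Lemma Csum_O (u : nat -> C) : Csum u 0 = u 0%nat.
Proof. exact (@sum_O C_AbelianMonoid u). Qed.

Lemma Csum_S (u : nat -> C) n : Csum u (S n) = Csum u n + u (S n).
Proof. exact (@sum_Sn C_AbelianMonoid u n). Qed.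

Lemma Rsum_S (u : nat -> R) n : (Rsum u (S n) = Rsum u n + u (S n))%R.
Proof. exact (@sum_Sn R_AbelianMonoid u n). Qed.

Lemma Rsum_O (u : nat -> R) : (Rsum u 0 = u 0%nat)%R.
Proof. exact (@sum_O R_AbelianMonoid u). Qed.

Lemma Csum_mult_l (a : C) u n : Csum (fun k => a * u k) n = a * Csum u n.
Proof. apply (@sum_n_scal_l C_Ring C_ModuleSpace a u n). Qed.

Lemma Rsum_ext u v n : (forall k, u k = v k) -> Rsum u n = Rsum v n.
Proof. apply (@sum_n_ext R_AbelianMonoid). Qed.

Lemma Rsum_plus u v n : (Rsum (fun k => u k + v k) n = Rsum u n + Rsum v n)%R.
Proof. apply (@sum_n_plus R_AbelianMonoid u v n). Qed.

Lemma Rsum_mult_l (a : R) u n : (Rsum (fun k => a * u k) n = a * Rsum u n)%R.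
Proof. apply (@sum_n_scal_l R_Ring R_ModuleSpace a u n). Qed.

Lemma Rsum_le u v n :
  (forall k, (k <= n)%nat -> (u k <= v k)%R) -> (Rsum u n <= Rsum v n)%R.
Proof.
  induction n as [|n IH]; intros H.
  - rewrite !Rsum_O. apply H; lia.
  - rewrite !Rsum_S. apply Rplus_le_compat; [apply IH; intros; apply H; lia | apply H; lia].
Qed.

Lemma Rsum_pos u n : (forall k, (0 <= u k)%R) -> (0 <= Rsum u n)%R.
Proof.
  intros H. induction n as [|n IH].
  - rewrite Rsum_O. apply H.
  - rewrite Rsum_S. specialize (H (S n)). lra.
Qed.

Lemma Rsum_le_index u n m :
  (forall k, (0 <= u k)%R) -> (n <= m)%nat -> (Rsum u n <= Rsum u m)%R.
Proof.
  intros H Hm. induction Hm as [|m _ IH]; [lra|].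
  rewrite Rsum_S. specialize (H (S m)). lra.
Qed.

Lemma term_le_Rsum u n : (forall k, (0 <= u k)%R) -> (u n <= Rsum u n)%R.
Proof.
  intros H. destruct n as [|n]; [rewrite Rsum_O; apply Rle_refl|].
  rewrite Rsum_S. assert (P := Rsum_pos u n H). lra.
Qed.

Lemma Rseries_eps (u : nat -> R) (l : R) :
  is_series u l <->
  forall eps : R, (0 < eps)%R ->
    exists N, forall n, (N <= n)%nat -> (Rabs (Rsum u n - l) < eps)%R.
Proof.
  unfold is_series. rewrite (@filterlim_locally_ball_norm R_AbsRing nat R_NormedModule eventually _). split.
  - intros H eps He. destruct (H (mkposreal eps He)) as [N HN].
    exists N. intros n Hn. apply (HN n Hn).
  - intros H eps. destruct (H eps (cond_pos eps)) as [N HN].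
    exists N. intros n Hn. apply (HN n Hn).
Qed.

Lemma Rsum_le_series (u : nat -> R) l n :
  (forall k, (0 <= u k)%R) -> is_series u l -> (Rsum u n <= l)%R.
Proof.
  intros Hu Hl. rewrite Rseries_eps in Hl. apply Rnot_lt_le. intros H.
  destruct (Hl (Rsum u n - l)%R) as [N HN]; [lra|].
  specialize (HN (max N n) (Nat.le_max_l _ _)).
  assert (H1 := Rsum_le_index u n (max N n) Hu (Nat.le_max_r _ _)).
  rewrite Rabs_pos_eq in HN; lra.
Qed.

Lemma Rseries_le_bound (u : nat -> R) l M :
  (forall n, (Rsum u n <= M)%R) -> is_series u l -> (l <= M)%R.
Proof.
  intros Hu Hl. rewrite Rseries_eps in Hl. apply Rnot_lt_le. intros H.
  destruct (Hl (l - M)%R) as [N HN]; [lra|].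
  specialize (HN N (Nat.le_refl _)). specialize (Hu N).
  apply Rabs_def2 in HN. lra.
Qed.

Lemma ex_series_bounded (u : nat -> R) M :
  (forall k, (0 <= u k)%R) -> (forall n, (Rsum u n <= M)%R) -> ex_series u.
Proof.
  intros Hu HM.
  destruct (ex_finite_lim_seq_incr (Rsum u) M) as [l Hl].
  - intros n. rewrite Rsum_S. specialize (Hu (S n)). lra.
  - exact HM.
  - exists l. exact Hl.
Qed.

Lemma Cseries_abs (u : nat -> C) (b : nat -> R) :
  (forall n, (Cmod (u n) <= b n)%R) -> ex_series b -> exists l : C, Cseries u l.
Proof. intros Hu Hb. apply (@ex_series_le C_AbsRing C_CompleteNormedModule u b Hu Hb). Qed.

Lemma Cseries_unique (u : nat -> C) (l l' : C) : Cseries u l -> Cseries u l' -> l = l'.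
Proof.
  intros H H'. apply (@filterlim_locally_unique _ C_AbsRing C_NormedModule eventually _ (Csum u)); assumption.
Qed.

Lemma Cseries_Cmod_le (u : nat -> C) (l : C) M :
  (forall n, (Rsum (fun k => Cmod (u k)) n <= M)%R) -> Cseries u l -> (Cmod l <= M)%R.
Proof.
  intros Hu Hl. rewrite Cseries_eps in Hl. apply Rnot_lt_le. intros H.
  destruct (Hl (Cmod l - M)%R) as [N HN]; [lra|].
  specialize (HN N (Nat.le_refl _)). specialize (Hu N).
  assert (H1 := Csum_Cmod u N).
  assert (H2 := Cmod_triangle (Csum u N) (- (Csum u N - l))).
  rewrite Cmod_opp in H2.
  replace (Csum u N + - (Csum u N - l)) with l in H2 by ring. lra.
Qed.

Lemma Cseries_mult_l (a : C) (u : nat -> C) (l : C) : Cseries u l -> Cseries (fun n => a * u n) (a * l).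
Proof. apply (@is_series_scal C_AbsRing C_NormedModule a u l). Qed.

Lemma Cseries_mult_r (a : C) (u : nat -> C) (l : C) : Cseries u l -> Cseries (fun n => u n * a) (l * a).
Proof.
  intros H. rewrite Cmult_comm.
  apply is_series_ext with (fun n => a * u n); [intros; apply Cmult_comm|].
  now apply Cseries_mult_l.
Qed.

Lemma Cseries_plus (u v : nat -> C) (l l' : C) :
  Cseries u l -> Cseries v l' -> Cseries (fun n => u n + v n) (l + l').
Proof. apply (@is_series_plus C_AbsRing C_NormedModule u v l l'). Qed.

Lemma Cseries_minus (u v : nat -> C) (l l' : C) :
  Cseries u l -> Cseries v l' -> Cseries (fun n => u n - v n) (l - l').
Proof. apply (@is_series_minus C_AbsRing C_NormedModule u v l l'). Qed.

Lemma Cseries_ext (u v : nat -> C) (l : C) : (forall n, u n = v n) -> Cseries u l -> Cseries v l.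
Proof. apply (@is_series_ext C_AbsRing C_NormedModule u v l). Qed.

Lemma Cseries_S (u : nat -> C) (l : C) : Cseries (fun n => u (S n)) l <-> Cseries u (u 0%nat + l).
Proof.
  split; intros H.
  - apply (@is_series_decr_1 C_AbsRing C_NormedModule u).
    match goal with |- is_series _ ?x => replace x with l end; [exact H|].
    change (l = (u 0%nat + l) + - u 0%nat). ring.
  - apply (@is_series_incr_1 C_AbsRing C_NormedModule u).
    match goal with |- is_series _ ?x => replace x with (u 0%nat + l) end; [exact H|].
    apply Cplus_comm.
Qed.

(** Isolates the second-order remainder of a power series; every quadratic error estimate below
    starts here. *)
Lemma Cseries_SS (u : nat -> C) (l : C) :
  Cseries u l -> Cseries (fun n => u (S (S n))) (l - u 0%nat - u 1%nat).
Proof.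
  intros H. apply (Cseries_S (fun n => u (S n))), Cseries_S.
  now replace (u 0%nat + (u 1%nat + (l - u 0%nat - u 1%nat))) with l by ring.
Qed.

Lemma Csum_minus_Cmod_le (u : nat -> C) (b : nat -> R) n m :
  (forall k, (Cmod (u k) <= b k)%R) -> (n <= m)%nat ->
  (Cmod (Csum u m - Csum u n) <= Rsum b m - Rsum b n)%R.
Proof.
  intros Hu Hm. induction Hm as [|m _ IH].
  - replace (Csum u n - Csum u n) with (RtoC 0) by ring. rewrite Cmod_0. lra.
  - rewrite Rsum_S, Csum_S.
    replace (Csum u m + u (S m) - Csum u n) with ((Csum u m - Csum u n) + u (S m)) by ring.
    eapply Rle_trans; [apply Cmod_triangle|]. specialize (Hu (S m)). lra.
Qed.

Lemma Cseries_tail_le (u : nat -> C) (b : nat -> R) (l : C) B n :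
  (forall k, (Cmod (u k) <= b k)%R) -> is_series b B -> Cseries u l ->
  (Cmod (l - Csum u n) <= B - Rsum b n)%R.
Proof.
  intros Hu Hb Hl. apply Rnot_lt_le. intros H.
  assert (Hb0 : forall k, (0 <= b k)%R)
    by (intros k; eapply Rle_trans; [apply Cmod_ge_0 | apply Hu]).
  rewrite Cseries_eps in Hl.
  destruct (Hl (Cmod (l - Csum u n) - (B - Rsum b n))%R) as [N HN]; [lra|].
  specialize (HN (max N n) (Nat.le_max_l _ _)).
  assert (H1 := Csum_minus_Cmod_le u b n (max N n) Hu (Nat.le_max_r _ _)).
  assert (H2 := Rsum_le_series b B (max N n) Hb0 Hb).
  assert (H3 := Cmod_triangle (Csum u (max N n) - Csum u n) (- (Csum u (max N n) - l))).
  rewrite Cmod_opp in H3.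
  replace (Csum u (max N n) - Csum u n + - (Csum u (max N n) - l)) with (l - Csum u n) in H3 by ring.
  lra.
Qed.

Lemma is_series_finite_sum {K : AbsRing} {V : NormedModule K}
  (u : nat -> nat -> V) (l : nat -> V) N :
  (forall n, (n <= N)%nat -> is_series (u n) (l n)) ->
  is_series (fun m => sum_n (fun n => u n m) N) (sum_n l N).
Proof.
  induction N as [|N IH]; intros H.
  - rewrite sum_O. apply is_series_ext with (u 0%nat); [|apply H; lia].
    intros n. now rewrite sum_O.
  - rewrite sum_Sn. apply is_series_ext with (fun m => plus (sum_n (fun n => u n m) N) (u (S N) m)).
    + intros n. now rewrite sum_Sn.
    + apply is_series_plus; [apply IH; intros; apply H; lia | apply H; lia].
Qed.

(** Discarding the rows beyond [N] changes a sum over the first [m] columns by at most the tail of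
    [A], uniformly in [m]. The finitely many rows that remain may be summed column by column. *)
Lemma Cseries_fubini (u : nat -> nat -> C) (A : nat -> R) (r c : nat -> C) (S : C) :
  (forall n m, (Rsum (fun k => Cmod (u n k)) m <= A n)%R) -> ex_series A ->
  (forall n, Cseries (u n) (r n)) -> (forall m, Cseries (fun n => u n m) (c m)) ->
  Cseries r S -> Cseries c S.
Proof.
  intros HA [B HB] Hr Hc HS. rewrite Cseries_eps. intros eps He.
  assert (HrA : forall n, (Cmod (r n) <= A n)%R).
  { intros n. apply (Cseries_Cmod_le (u n)); auto. }
  destruct (proj1 (Rseries_eps A B) HB (eps / 3)%R) as [N HN]; [lra|].
  assert (HBN : (B - Rsum A N < eps / 3)%R).
  { specialize (HN N (Nat.le_refl _)). apply Rabs_def2 in HN. lra. }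
  assert (Hfin := @is_series_finite_sum C_AbsRing C_NormedModule u r N (fun n _ => Hr n)).
  destruct (proj1 (Cseries_eps _ _) Hfin (eps / 3)%R) as [M HM]; [lra|].
  exists M. intros m Hm. specialize (HM m Hm).
  assert (Hcm : Cseries (fun n => Csum (u n) m) (Csum c m)).
  { apply Cseries_ext with (fun n => Csum (fun k => u n k) m); [reflexivity|].
    apply (@is_series_finite_sum C_AbsRing C_NormedModule (fun k n => u n k) c m). intros; apply Hc. }
  change (Cmod (Csum (fun j => Csum (fun i => u i j) N) m - Csum r N) < eps / 3)%R in HM.
  assert (H1 : (Cmod (Csum c m - Csum (fun j => Csum (fun i => u i j) N) m) <= B - Rsum A N)%R).
  { replace (Csum (fun j => Csum (fun i => u i j) N) m) with (Csum (fun n => Csum (u n) m) N)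
      by exact (@sum_n_switch C_AbelianMonoid u N m).
    apply Cseries_tail_le; auto. intros k.
    eapply Rle_trans; [apply Csum_Cmod | apply HA]. }
  assert (H2 : (Cmod (S - Csum r N) <= B - Rsum A N)%R) by (apply Cseries_tail_le; auto).
  replace (Csum c m - S) with
    ((Csum c m - Csum (fun j => Csum (fun i => u i j) N) m)
     + ((Csum (fun j => Csum (fun i => u i j) N) m - Csum r N) + - (S - Csum r N))) by ring.
  eapply Rle_lt_trans; [apply Cmod_triangle|].
  eapply Rle_lt_trans; [apply Rplus_le_compat_l, Cmod_triangle|].
  rewrite Cmod_opp. lra.
Qed.

(** * Complex derivatives *)

(** An epsilon form in the increment [h], convenient for explicit estimates; [C_derive_eq] carries
    it over to the derivative used in the statement. *)
Definition Cderiv (f : C -> C) (z l : C) : Prop :=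
  forall eps : R, (0 < eps)%R -> exists delta : R, (0 < delta)%R /\
    forall h : C, (Cmod h < delta)%R -> (Cmod (f (z + h)%C - f z - l * h) <= eps * Cmod h)%R.

Lemma C_derive_eq (f : C -> C) (z l : C) : Cderiv f z l -> C_derive f z = l.
Proof.
  intros H. apply is_C_derive_unique. split; [apply is_linear_scal_l|].
  intros x Hx. apply (@is_filter_lim_locally_unique C_AbsRing (AbsRing_NormedModule C_AbsRing)) in Hx.
  subst x.
  intros eps. destruct (H eps (cond_pos eps)) as [d [Hd H']].
  exists (mkposreal d Hd). intros y Hy.
  specialize (H' (y - z) Hy). change C in y. replace (z + (y - z)) with y in H' by ring.
  rewrite Cmult_comm in H'. exact H'.
Qed.

Lemma Cderiv_quadratic (f : C -> C) (z l : C) (r K : R) : (0 < r)%R ->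
  (forall h, (Cmod h <= r)%R -> (Cmod (f (z + h)%C - f z - l * h) <= K * Cmod h ^ 2)%R) ->
  Cderiv f z l.
Proof.
  intros Hr H eps He. assert (HK := Rabs_pos K). assert (HK' := Rle_abs K).
  exists (Rmin r (eps / (Rabs K + 1))).
  split; [apply Rmin_glb_lt; [exact Hr | apply Rdiv_lt_0_compat; lra]|].
  intros h Hh. assert (P := Cmod_ge_0 h).
  assert (Hh1 := Rlt_le_trans _ _ _ Hh (Rmin_l _ _)).
  assert (Hh2 := Rlt_le_trans _ _ _ Hh (Rmin_r _ _)).
  eapply Rle_trans; [apply H; lra|].
  apply (Rmult_lt_compat_l (Rabs K + 1)) in Hh2; [|lra].
  replace ((Rabs K + 1) * (eps / (Rabs K + 1)))%R with eps in Hh2 by (field; lra).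
  replace (K * Cmod h ^ 2)%R with (K * Cmod h * Cmod h)%R by ring.
  apply Rmult_le_compat_r; [exact P | nra].
Qed.

Lemma Cderiv_local_ext (f g : C -> C) z l (r : R) : (0 < r)%R ->
  (forall h, (Cmod h < r)%R -> f (z + h) = g (z + h)) -> Cderiv f z l -> Cderiv g z l.
Proof.
  intros Hr H Hf eps He. destruct (Hf eps He) as [d [Hd H']].
  exists (Rmin d r). split; [now apply Rmin_glb_lt|].
  intros h Hh. rewrite <- H by (eapply Rlt_le_trans; [apply Hh | apply Rmin_r]).
  replace (g z) with (f z).
  - apply H'. eapply Rlt_le_trans; [apply Hh | apply Rmin_l].
  - specialize (H 0). rewrite Cplus_0_r in H. apply H. now rewrite Cmod_0.
Qed.

Lemma Cderiv_const (c z : C) : Cderiv (fun _ => c) z 0.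
Proof.
  intros eps He. exists 1%R. split; [lra|]. intros h _.
  replace (c - c - 0 * h) with (RtoC 0) by ring. rewrite Cmod_0.
  apply Rmult_le_pos; [lra | apply Cmod_ge_0].
Qed.

Lemma Cderiv_id (c z : C) : Cderiv (fun s => s + c) z 1.
Proof.
  intros eps He. exists 1%R. split; [lra|]. intros h _.
  replace (z + h + c - (z + c) - 1 * h) with (RtoC 0) by ring. rewrite Cmod_0.
  apply Rmult_le_pos; [lra | apply Cmod_ge_0].
Qed.

Lemma Cderiv_plus f g z (l m : C) :
  Cderiv f z l -> Cderiv g z m -> Cderiv (fun s => f s + g s) z (l + m).
Proof.
  intros Hf Hg eps He.
  destruct (Hf (eps / 2)%R) as [d1 [Hd1 H1]]; [lra|].
  destruct (Hg (eps / 2)%R) as [d2 [Hd2 H2]]; [lra|].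
  exists (Rmin d1 d2). split; [now apply Rmin_glb_lt|]. intros h Hh.
  specialize (H1 h (Rlt_le_trans _ _ _ Hh (Rmin_l _ _))).
  specialize (H2 h (Rlt_le_trans _ _ _ Hh (Rmin_r _ _))).
  replace (f (z + h) + g (z + h) - (f z + g z) - (l + m) * h) with
    ((f (z + h) - f z - l * h) + (g (z + h) - g z - m * h)) by ring.
  eapply Rle_trans; [apply Cmod_triangle|]. lra.
Qed.

Lemma Cderiv_bounded f z l : Cderiv f z l ->
  exists d, (0 < d)%R /\ forall h, (Cmod h < d)%R ->
    (Cmod (f (z + h)%C - f z) <= (Cmod l + 1) * Cmod h)%R.
Proof.
  intros Hf. destruct (Hf 1%R) as [d [Hd H]]; [lra|].
  exists d. split; [exact Hd|]. intros h Hh. specialize (H h Hh).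
  replace (f (z + h) - f z) with ((f (z + h) - f z - l * h) + l * h) by ring.
  eapply Rle_trans; [apply Cmod_triangle|]. rewrite Cmod_mult. lra.
Qed.

Lemma Cderiv_mult f g z l m :
  Cderiv f z l -> Cderiv g z m -> Cderiv (fun s => f s * g s) z (l * g z + f z * m).
Proof.
  intros Hf Hg eps He.
  assert (P1 := Cmod_ge_0 (f z)). assert (P2 := Cmod_ge_0 (g z)).
  assert (P3 := Cmod_ge_0 l). assert (P4 := Cmod_ge_0 m).
  (* [K] adds up the coefficients of the three error terms. The third, a product of two increments,
     is quadratic in [h] and becomes small through the restriction [Cmod h < eps / K]. *)
  set (K := (1 + Cmod (f z) + Cmod (g z) + (Cmod l + 1) * (Cmod m + 1))%R).
  assert (HK : (1 <= K)%R) by (unfold K; nra).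
  destruct (Hf (eps / K)%R) as [d1 [Hd1 H1]]; [apply Rdiv_lt_0_compat; lra|].
  destruct (Hg (eps / K)%R) as [d2 [Hd2 H2]]; [apply Rdiv_lt_0_compat; lra|].
  destruct (Cderiv_bounded f z l Hf) as [d3 [Hd3 H3]].
  destruct (Cderiv_bounded g z m Hg) as [d4 [Hd4 H4]].
  exists (Rmin (Rmin d1 d2) (Rmin (Rmin d3 d4) (eps / K))). split.
  { repeat apply Rmin_glb_lt; auto. apply Rdiv_lt_0_compat; lra. }
  intros h Hh.
  assert (Hh12 := Rlt_le_trans _ _ _ Hh (Rmin_l _ _)).
  assert (Hh34 := Rlt_le_trans _ _ _ Hh (Rmin_r _ _)).
  assert (Hh5 := Rlt_le_trans _ _ _ Hh34 (Rmin_r _ _)).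
  assert (Hh34' := Rlt_le_trans _ _ _ Hh34 (Rmin_l _ _)).
  specialize (H1 h (Rlt_le_trans _ _ _ Hh12 (Rmin_l _ _))).
  specialize (H2 h (Rlt_le_trans _ _ _ Hh12 (Rmin_r _ _))).
  specialize (H3 h (Rlt_le_trans _ _ _ Hh34' (Rmin_l _ _))).
  specialize (H4 h (Rlt_le_trans _ _ _ Hh34' (Rmin_r _ _))).
  clear Hh Hh12 Hh34 Hh34'.
  replace (f (z + h) * g (z + h) - f z * g z - (l * g z + f z * m) * h) with
    ((f (z + h) - f z - l * h) * g z + f z * (g (z + h) - g z - m * h)
     + (f (z + h) - f z) * (g (z + h) - g z)) by ring.
  eapply Rle_trans; [apply Cmod_triangle|].
  eapply Rle_trans; [apply Rplus_le_compat_r, Cmod_triangle|].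
  rewrite !Cmod_mult.
  assert (P5 := Cmod_ge_0 h). set (e := (eps / K)%R) in *.
  assert (HeK : (eps = e * K)%R) by (unfold e; field; lra).
  assert (He0 : (0 < e)%R) by (apply Rdiv_lt_0_compat; lra).
  assert (Q1 := Rmult_le_compat_r _ _ _ P2 H1).
  assert (Q2 := Rmult_le_compat_l _ _ _ P1 H2).
  assert (Q3 := Rmult_le_compat _ _ _ _ (Cmod_ge_0 _) (Cmod_ge_0 _) H3 H4).
  assert (Q4 : ((Cmod l + 1) * Cmod h * ((Cmod m + 1) * Cmod h)
                <= (Cmod l + 1) * (Cmod m + 1) * Cmod h * e)%R).
  { replace ((Cmod l + 1) * Cmod h * ((Cmod m + 1) * Cmod h))%R
      with ((Cmod l + 1) * (Cmod m + 1) * Cmod h * Cmod h)%R by ring.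
    apply Rmult_le_compat_l; [|lra].
    repeat apply Rmult_le_pos; lra. }
  rewrite HeK. unfold K in *.
  assert (0 <= e * Cmod h)%R by (apply Rmult_le_pos; lra). nra.
Qed.

Lemma Cderiv_unique f z l m : Cderiv f z l -> Cderiv f z m -> l = m.
Proof. intros H1 H2. rewrite <- (C_derive_eq f z l H1). now apply C_derive_eq. Qed.

(** * Majorised power series expansions *)

(** The norm [sum |c_k| r^k] is submultiplicative and complete, so it controls
    infinite sums and their termwise derivatives without Cauchy's formula. *)
Definition expansion (z0 : C) (r M : R) (c : nat -> C) (f : C -> C) : Prop :=
  (forall n, (Rsum (fun k => Cmod (c k) * r ^ k)%R n <= M)%R) /\
  forall h, (Cmod h <= r)%R -> Cseries (fun k => c k * h ^ k) (f (z0 + h)).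

(** Membership in the Wiener algebra of the closed disc (absolutely summable Taylor coefficients),
    with norm at most [M]. *)
Definition wiener (z0 : C) (r M : R) (f : C -> C) : Prop :=
  exists c, expansion z0 r M c f.

Lemma functional_choice {A B : Type} (P : A -> B -> Prop) :
  (forall x, exists y, P x y) -> exists f, forall x, P x (f x).
Proof.
  intros H. exists (fun x => proj1_sig (constructive_indefinite_description _ (H x))).
  intros x. apply (proj2_sig (constructive_indefinite_description _ (H x))).
Qed.

Lemma Csum_0 n : Csum (fun _ => RtoC 0) n = RtoC 0.
Proof. induction n as [|n IH]; [apply Csum_O|]. rewrite Csum_S, IH. ring. Qed.

Lemma Rsum_mult_r (a : R) u n : (Rsum (fun k => u k * a) n = Rsum u n * a)%R.
Proof.
  induction n as [|n IH]; [now rewrite !Rsum_O|]. rewrite !Rsum_S, IH. ring.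
Qed.

Lemma Cseries_O (u : nat -> C) : (forall n, u (S n) = 0) -> Cseries u (u 0%nat).
Proof.
  intros H. replace (u 0%nat) with (u 0%nat + 0) by ring. apply Cseries_S.
  apply Cseries_ext with (fun _ => RtoC 0); [intros n; now rewrite H|].
  apply Cseries_eps. intros eps He. exists 0%nat. intros n _. rewrite Csum_0.
  replace (0 - 0) with (RtoC 0) by ring. now rewrite Cmod_0.
Qed.

Lemma Rsum_shift (u : nat -> R) n : (Rsum u (S n) = u 0%nat + Rsum (fun k => u (S k)) n)%R.
Proof.
  induction n as [|n IH]; [now rewrite Rsum_S, !Rsum_O|].
  rewrite Rsum_S, IH, Rsum_S. ring.
Qed.

Lemma expansion_pos z0 r M c f : (0 <= r)%R -> expansion z0 r M c f -> (0 <= M)%R.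
Proof.
  intros Hr [H _]. eapply Rle_trans; [|apply (H 0%nat)]. apply Rsum_pos.
  intros k. apply Rmult_le_pos; [apply Cmod_ge_0 | now apply pow_le].
Qed.

Lemma expansion_abs r M (c : nat -> C) h :
  (forall n, (Rsum (fun k => Cmod (c k) * r ^ k)%R n <= M)%R) -> (Cmod h <= r)%R ->
  forall n, (Rsum (fun k => Cmod (c k * h ^ k)) n <= M)%R.
Proof.
  intros H Hh n. eapply Rle_trans; [|apply (H n)]. apply Rsum_le. intros k _.
  rewrite Cmod_mult, Cmod_pow. apply Rmult_le_compat_l; [apply Cmod_ge_0|].
  apply pow_incr. split; [apply Cmod_ge_0 | exact Hh].
Qed.

Lemma wiener_ext z0 r M f g :
  (forall h, (Cmod h <= r)%R -> f (z0 + h) = g (z0 + h)) ->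
  wiener z0 r M f -> wiener z0 r M g.
Proof.
  intros H [c [H1 H2]]. exists c. split; [exact H1|].
  intros h Hh. rewrite <- H by exact Hh. now apply H2.
Qed.

Lemma wiener_le z0 r M M' f : (M <= M')%R -> wiener z0 r M f -> wiener z0 r M' f.
Proof.
  intros H [c [H1 H2]]. exists c. split; [|exact H2].
  intros n. eapply Rle_trans; [apply H1 | exact H].
Qed.

Lemma wiener_restrict z0 r r' M f :
  (0 <= r' <= r)%R -> wiener z0 r M f -> wiener z0 r' M f.
Proof.
  intros H [c [H1 H2]]. exists c. split; [|intros h Hh; apply H2; lra].
  intros n. eapply Rle_trans; [|apply (H1 n)]. apply Rsum_le. intros k _.
  apply Rmult_le_compat_l; [apply Cmod_ge_0 | now apply pow_incr].
Qed.

Lemma wiener_shift z0 a r M f :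
  wiener (z0 + a) r M f -> wiener z0 r M (fun s => f (s + a)).
Proof.
  intros [c [H1 H2]]. exists c. split; [exact H1|].
  intros h Hh. replace (z0 + h + a) with (z0 + a + h) by ring. now apply H2.
Qed.

Lemma wiener_const z0 r (a : C) : wiener z0 r (Cmod a) (fun _ => a).
Proof.
  exists (fun k => match k with O => a | S _ => RtoC 0 end). split.
  - intros n. apply Req_le. induction n as [|n IH].
    + rewrite Rsum_O. simpl. ring.
    + rewrite Rsum_S, IH, Cmod_0. ring.
  - intros h _. set (u := fun k => _). replace a with (u 0%nat) by (unfold u; simpl; ring).
    apply Cseries_O. intros n. unfold u. ring.
Qed.

Lemma wiener_plus z0 r M N f g : (0 <= r)%R ->
  wiener z0 r M f -> wiener z0 r N g -> wiener z0 r (M + N) (fun s => f s + g s).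
Proof.
  intros Hr [c [H1 H2]] [d [H3 H4]]. exists (fun k => c k + d k). split.
  - intros n. eapply Rle_trans; [|apply (Rplus_le_compat _ _ _ _ (H1 n) (H3 n))].
    rewrite <- Rsum_plus. apply Rsum_le. intros k _. rewrite <- Rmult_plus_distr_r.
    apply Rmult_le_compat_r; [now apply pow_le | apply Cmod_triangle].
  - intros h Hh. apply Cseries_ext with (fun k => c k * h ^ k + d k * h ^ k).
    + intros k. ring.
    + apply Cseries_plus; auto.
Qed.

Lemma wiener_scal z0 r M (a : C) f :
  wiener z0 r M f -> wiener z0 r (Cmod a * M) (fun s => a * f s).
Proof.
  intros [c [H1 H2]]. exists (fun k => a * c k). split.
  - intros n. eapply Rle_trans; [|apply Rmult_le_compat_l; [apply Cmod_ge_0 | apply (H1 n)]].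
    rewrite <- Rsum_mult_l. apply Req_le, Rsum_ext. intros k. rewrite Cmod_mult. apply Rmult_assoc.
  - intros h Hh. apply Cseries_ext with (fun k => a * (c k * h ^ k)).
    + intros k. ring.
    + apply Cseries_mult_l; auto.
Qed.

(** Write [s + a] as [(s - z0) + (z0 + a)]: the first factor shifts the coefficients by one place
    and costs [r], the second is a constant. *)
Lemma wiener_mult_linear z0 r M (a : C) f : (0 <= r)%R ->
  wiener z0 r M f -> wiener z0 r ((Cmod (z0 + a) + r) * M) (fun s => (s + a) * f s).
Proof.
  intros Hr Hf.
  assert (H : wiener z0 r (r * M) (fun s => (s - z0) * f s)).
  { destruct Hf as [c Hc]. assert (HM := expansion_pos _ _ _ _ _ Hr Hc).
    destruct Hc as [H1 H2].
    exists (fun k => match k with O => RtoC 0 | S k => c k end). split.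
    - intros [|n].
      + rewrite Rsum_O, Cmod_0, Rmult_0_l. now apply Rmult_le_pos.
      + rewrite Rsum_shift, Cmod_0, Rmult_0_l, Rplus_0_l.
        eapply Rle_trans; [|apply Rmult_le_compat_l; [exact Hr | apply (H1 n)]].
        rewrite <- Rsum_mult_l. apply Req_le, Rsum_ext. intros k. simpl.
        ring.
    - intros h Hh. replace ((z0 + h - z0) * f (z0 + h)) with (0 * h ^ 0 + h * f (z0 + h)) by ring.
      apply (proj1 (Cseries_S (fun k => match k with O => RtoC 0 | S k => c k end * h ^ k) _)).
      apply Cseries_ext with (fun k => h * (c k * h ^ k)); [intros k; simpl; ring|].
      apply Cseries_mult_l; auto. }
  apply wiener_ext with (fun s => (s - z0) * f s + (z0 + a) * f s); [intros; ring|].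
  rewrite Rmult_plus_distr_r, Rplus_comm. apply wiener_plus; [exact Hr | exact H|].
  now apply wiener_scal.
Qed.

(** With [A = z0 + a], the coefficients of the quotient solve [A d_0 = c_0] and
    [A d_(k+1) + d_k = c_(k+1)]. Since [2 r <= |A|], the shifted term takes up at most half of the
    norm, whence the factor 2. *)
Lemma wiener_div_linear z0 r M (a : C) f : (0 <= r)%R ->
  z0 + a <> 0 -> (2 * r <= Cmod (z0 + a))%R ->
  wiener z0 r M f -> wiener z0 r (2 * M / Cmod (z0 + a)) (fun s => f s / (s + a)).
Proof.
  intros Hr Ha Hra [c Hc]. assert (HM := expansion_pos _ _ _ _ _ Hr Hc).
  destruct Hc as [H1 H2]. set (A := z0 + a) in *.
  assert (HA : (0 < Cmod A)%R) by now apply Cmod_gt_0.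
  set (d := fix d k := match k with O => c O / A | S k => (c (S k) - d k) / A end).
  assert (Hd : forall n, (Rsum (fun k => Cmod (d k) * r ^ k)%R n <= 2 * M / Cmod A)%R).
  { intros n.
    (* The recurrence, summed with weights [r^k]: the norm of the quotient up to [n + 1] is
       controlled by that of [f] and by [r] times the norm up to [n]. *)
    assert (Hstep : forall n, (Cmod A * Rsum (fun k => Cmod (d k) * r ^ k)%R (S n)
        <= Rsum (fun k => Cmod (c k) * r ^ k)%R (S n)
           + r * Rsum (fun k => Cmod (d k) * r ^ k)%R n)%R).
    { clear n. intros n. rewrite !Rsum_shift, Rmult_plus_distr_l, Rplus_assoc.
      apply Rplus_le_compat.
      - simpl. rewrite Cmod_div by exact Ha. apply Req_le. field. lra.
      - rewrite <- !Rsum_mult_l.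
        eapply Rle_trans; [|apply Req_le; exact (@sum_n_plus R_AbelianMonoid _ _ n)].
        apply Rsum_le. intros k _. change plus with Rplus.
        change (d (S k)) with ((c (S k) - d k) / A). rewrite Cmod_div by exact Ha.
        replace (Cmod A * (Cmod (c (S k) - d k) / Cmod A * r ^ S k))%R
          with (Cmod (c (S k) - d k) * r ^ S k)%R by (field; lra).
        replace (r * (Cmod (d k) * r ^ k))%R with (Cmod (d k) * r ^ S k)%R by (simpl; ring).
        rewrite <- Rmult_plus_distr_r. apply Rmult_le_compat_r; [now apply pow_le|].
        eapply Rle_trans; [apply Cmod_triangle|]. rewrite Cmod_opp. lra. }
    apply Rmult_le_reg_l with (Cmod A); [exact HA|].
    replace (Cmod A * (2 * M / Cmod A))%R with (2 * M)%R by (field; lra).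
    induction n as [|n IH].
    - specialize (H1 0%nat). rewrite Rsum_O in *. simpl. rewrite Cmod_div by exact Ha.
      simpl in H1. replace (Cmod A * (Cmod (c 0%nat) / Cmod A * 1))%R with (Cmod (c 0%nat) * 1)%R
        by (field; lra). lra.
    - eapply Rle_trans; [apply Hstep|]. specialize (H1 (S n)).
      assert (0 <= Rsum (fun k => Cmod (d k) * r ^ k)%R n)%R
        by (apply Rsum_pos; intros k; apply Rmult_le_pos; [apply Cmod_ge_0 | now apply pow_le]).
      nra. }
  exists d. split; [exact Hd|]. intros h Hh.
  assert (HAh : A + h <> 0).
  { intros E. assert (h = - A) by (rewrite <- (Cplus_0_l (- A)), <- E; ring).
    subst h. rewrite Cmod_opp in Hh. lra. }
  replace (z0 + h + a) with (A + h) by (unfold A; ring).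
  destruct (Cseries_abs (fun k => d k * h ^ k) (fun k => Cmod (d k * h ^ k))) as [l Hl].
  { intros n; apply Rle_refl. }
  { apply ex_series_bounded with (2 * M / Cmod A)%R; [intros; apply Cmod_ge_0|].
    now apply (expansion_abs r). }
  replace (f (z0 + h) / (A + h)) with l; [exact Hl|].
  assert (E : (A + h) * l = f (z0 + h)).
  { apply (Cseries_unique (fun k => c k * h ^ k)); [|now apply H2].
    apply Cseries_ext with
      (fun k => A * (d k * h ^ k) + match k with O => RtoC 0 | S k => h * (d k * h ^ k) end).
    - intros [|k]; simpl; field; exact Ha.
    - rewrite Cmult_plus_distr_r. apply Cseries_plus; [now apply Cseries_mult_l|].
      replace (h * l) with (0 + h * l) by ring.
      apply (proj1 (Cseries_S (fun k => match k with O => RtoC 0 | S k => h * (d k * h ^ k) end) _)).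
      now apply Cseries_mult_l. }
  rewrite <- E. field. exact HAh.
Qed.

Lemma expansion_0 z0 r M c f : (0 <= r)%R -> expansion z0 r M c f -> f z0 = c 0%nat.
Proof.
  intros Hr [_ H2]. apply (Cseries_unique (fun k => c k * 0 ^ k)).
  - replace (f z0) with (f (z0 + 0)) by (f_equal; ring). apply H2. rewrite Cmod_0. lra.
  - set (u := fun k => _). replace (c 0%nat) with (u 0%nat) by (unfold u; simpl; ring).
    apply Cseries_O. intros n. unfold u. simpl. ring.
Qed.

(** Each term of index at least 2 carries the factor [(|h| / r)^2], so the remainder after the
    linear term is at most [M (|h| / r)^2]. *)
Lemma expansion_Cderiv z0 r M c f : (0 < r)%R ->
  expansion z0 r M c f -> Cderiv f z0 (c 1%nat).
Proof.
  intros Hr Hc. assert (Hf0 := expansion_0 _ _ _ _ _ (Rlt_le _ _ Hr) Hc).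
  destruct Hc as [H1 H2].
  apply (Cderiv_quadratic _ _ _ r (M / r ^ 2) Hr). intros h Hh.
  specialize (H2 h Hh). apply Cseries_SS in H2.
  replace (f (z0 + h) - f z0 - c 1%nat * h)
    with (f (z0 + h) - c 0%nat * h ^ 0 - c 1%nat * h ^ 1) by (rewrite Hf0; simpl; ring).
  revert H2. apply Cseries_Cmod_le. intros n.
  replace (M / r ^ 2 * Cmod h ^ 2)%R with ((Cmod h / r) ^ 2 * M)%R by (field; lra).
  assert (Hhr : (0 <= Cmod h / r <= 1)%R).
  { assert (P := Cmod_ge_0 h). split.
    - apply Rmult_le_pos; [exact P | left; now apply Rinv_0_lt_compat].
    - apply Rmult_le_reg_r with r; [exact Hr|]. unfold Rdiv. rewrite Rmult_assoc, Rinv_l; lra. }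
  assert (Hpos : forall k, (0 <= Cmod (c k) * r ^ k)%R)
    by (intros k; apply Rmult_le_pos; [apply Cmod_ge_0 | apply pow_le; lra]).
  apply Rle_trans with ((Cmod h / r) ^ 2 * Rsum (fun k => Cmod (c (S (S k))) * r ^ S (S k))%R n)%R.
  - rewrite <- Rsum_mult_l. apply Rsum_le. intros k _. rewrite Cmod_mult, Cmod_pow.
    replace (Cmod h) with (Cmod h / r * r)%R at 1 by (field; lra).
    rewrite Rpow_mult_distr.
    replace ((Cmod h / r) ^ 2 * (Cmod (c (S (S k))) * r ^ S (S k)))%R with
      (Cmod (c (S (S k))) * ((Cmod h / r) ^ 2 * r ^ S (S k)))%R by ring.
    apply Rmult_le_compat_l; [apply Cmod_ge_0|].
    apply Rmult_le_compat_r; [apply pow_le; lra|].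
    replace (S (S k)) with (2 + k)%nat by lia. rewrite pow_add.
    rewrite <- (Rmult_1_r ((Cmod h / r) ^ 2)) at 2.
    apply Rmult_le_compat_l; [apply pow_le; lra|]. rewrite <- (pow1 k). now apply pow_incr.
  - apply Rmult_le_compat_l; [apply pow_le; lra|].
    specialize (H1 (S (S n))). rewrite !Rsum_shift in H1.
    assert (P0 := Hpos 0%nat). assert (P1 := Hpos 1%nat). lra.
Qed.

Lemma wiener_Cderiv z0 r M f : (0 < r)%R -> wiener z0 r M f -> exists d, Cderiv f z0 d.
Proof. intros Hr [c Hc]. exists (c 1%nat). now apply (expansion_Cderiv z0 r M). Qed.

Lemma wiener_analytic_at z0 r M f : (0 < r)%R -> wiener z0 r M f -> analytic_at f z0.
Proof.
  intros Hr [c [H1 H2]]. exists c, r. split; [exact Hr|]. intros z Hz.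
  unfold is_pseries.
  apply Cseries_ext with (fun k => c k * (z - z0) ^ k).
  - intros n. change (c n * (z - z0) ^ n = (pow_n (K := C_Ring) (z - z0) n) * c n).
    apply Cmult_comm.
  - replace (f z) with (f (z0 + (z - z0))) by (f_equal; ring). apply H2. lra.
Qed.

(** The Weierstrass theorem in this norm. The coefficients are summed one index at a time and Fubini
    identifies the result with [F]; as the derivative is the coefficient of index 1, termwise
    differentiation comes with it. *)
Lemma wiener_series z0 r (M : nat -> R) (f : nat -> C -> C) (F : C -> C) : (0 < r)%R ->
  (forall n, wiener z0 r (M n) (f n)) -> ex_series M ->
  (forall h, (Cmod h <= r)%R -> Cseries (fun n => f n (z0 + h)) (F (z0 + h))) ->
  wiener z0 r (Series M) F /\
  forall d, (forall n, Cderiv (f n) z0 (d n)) -> exists D : C, Cseries d D /\ Cderiv F z0 D.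
Proof.
  intros Hr Hf HM HF.
  destruct (functional_choice _ Hf) as [c Hc].
  assert (Hrk : forall k, (0 < r ^ k)%R) by (intros; now apply pow_lt).
  assert (Hpos : forall n k, (0 <= Cmod (c n k) * r ^ k)%R)
    by (intros; apply Rmult_le_pos; [apply Cmod_ge_0 | left; apply Hrk]).
  assert (Hck : forall n k, (Cmod (c n k) * r ^ k <= M n)%R).
  { intros n k. eapply Rle_trans; [|apply (proj1 (Hc n) k)].
    apply (term_le_Rsum (fun k => Cmod (c n k) * r ^ k)%R). intros; apply Hpos. }
  assert (HD : forall k, exists D : C, Cseries (fun n => c n k) D).
  { intros k. apply Cseries_abs with (fun n => / r ^ k * M n)%R.
    - intros n. apply Rmult_le_reg_l with (r ^ k)%R; [apply Hrk|].
      rewrite <- Rmult_assoc, Rinv_r, Rmult_1_l by (apply Rgt_not_eq, Hrk).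
      rewrite Rmult_comm. apply Hck.
    - destruct HM as [B HB]. exists (/ r ^ k * B)%R.
      apply (@is_series_scal R_AbsRing R_NormedModule _ M B HB). }
  destruct (functional_choice _ HD) as [D HDk].
  assert (HE : expansion z0 r (Series M) D F).
  { split.
    - intros m.
      assert (Hv : forall k, ex_series (fun n => Cmod (c n k) * r ^ k)%R).
      { intros k. apply (@ex_series_le R_AbsRing R_CompleteNormedModule _ M); [|exact HM].
        intros n. change (Rabs (Cmod (c n k) * r ^ k) <= M n)%R.
        rewrite Rabs_pos_eq by apply Hpos. apply Hck. }
      (* Each coefficient of the sum is bounded by the series of moduli; exchanging the finite sum
         over [k] with the series over [n] leaves the bound [sum M n]. *)
      apply Rle_trans with (Rsum (fun k => Series (fun n => Cmod (c n k) * r ^ k)%R) m).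
      + apply Rsum_le. intros k _.
        apply Rmult_le_reg_r with (/ r ^ k)%R; [apply Rinv_0_lt_compat, Hrk|].
        rewrite Rmult_assoc, Rinv_r, Rmult_1_r by (apply Rgt_not_eq, Hrk).
        apply (Cseries_Cmod_le (fun n => c n k)); [|apply HDk].
        intros n. apply Rmult_le_reg_r with (r ^ k)%R; [apply Hrk|].
        rewrite Rmult_assoc, Rinv_l, Rmult_1_r, <- Rsum_mult_r by (apply Rgt_not_eq, Hrk).
        apply Rsum_le_series; [intros j; apply Hpos | apply Series_correct, Hv].
      + refine (Rseries_le_bound (fun n => Rsum (fun k => Cmod (c n k) * r ^ k)%R m) _ _ _ _).
        * intros n. eapply Rle_trans; [|apply (Rsum_le_series M _ n)].
          -- apply Rsum_le. intros j _. apply (proj1 (Hc j)).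
          -- intros j. eapply Rle_trans; [apply (Hpos j 0%nat) | apply Hck].
          -- now apply Series_correct.
        * apply (@is_series_finite_sum R_AbsRing R_NormedModule
            (fun k n => Cmod (c n k) * r ^ k)%R).
          intros k _. apply Series_correct, Hv.
    - intros h Hh.
      apply (Cseries_fubini (fun n k => c n k * h ^ k) M (fun n => f n (z0 + h))).
      + intros n m. apply (expansion_abs r); [apply (proj1 (Hc n)) | exact Hh].
      + exact HM.
      + intros n. now apply (proj2 (Hc n)).
      + intros k. now apply Cseries_mult_r.
      + now apply HF. }
  split; [now exists D|].
  intros d Hd. exists (D 1%nat). split.
  - apply Cseries_ext with (fun n => c n 1%nat); [|apply HDk].
    intros n. apply (Cderiv_unique (f n) z0); [|apply Hd].
    now apply (expansion_Cderiv z0 r (M n)).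
  - now apply (expansion_Cderiv z0 r (Series M)).
Qed.

(** * The identity theorem *)

Lemma Cseries_terms_bounded (u : nat -> C) (l : C) :
  Cseries u l -> exists B : R, forall n, (Cmod (u n) <= B)%R.
Proof.
  intros H. destruct (proj1 (Cseries_eps u l) H 1%R) as [N HN]; [lra|].
  assert (Hfin : forall N, exists B : R, forall n, (n <= N)%nat -> (Cmod (u n) <= B)%R).
  { clear. induction N as [|N [B HB]].
    - exists (Cmod (u 0%nat)). intros n Hn. replace n with 0%nat by lia. apply Rle_refl.
    - exists (Rmax B (Cmod (u (S N)))). intros n Hn.
      destruct (Nat.eq_dec n (S N)) as [->|Hn']; [apply Rmax_r|].
      eapply Rle_trans; [apply HB; lia | apply Rmax_l]. }
  destruct (Hfin N) as [B HB]. exists (Rmax B 2). intros n.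
  destruct (Nat.le_gt_cases n N) as [Hn|Hn].
  - eapply Rle_trans; [now apply HB | apply Rmax_l].
  - eapply Rle_trans; [|apply Rmax_r]. destruct n as [|n]; [lia|].
    assert (H1 := HN n ltac:(lia)). assert (H2 := HN (S n) ltac:(lia)).
    rewrite Csum_S in H2.
    replace (u (S n)) with ((Csum u n + u (S n) - l) + - (Csum u n - l)) by ring.
    eapply Rle_trans; [apply Cmod_triangle|]. rewrite Cmod_opp. lra.
Qed.

Lemma Rsum_geom_half n : (Rsum (fun k => (/ 2) ^ k)%R n <= 2)%R.
Proof.
  assert (H : is_series (fun k => (/ 2) ^ k)%R (/ (1 - / 2))%R)
    by (apply is_series_geom; rewrite Rabs_pos_eq; lra).
  replace (/ (1 - / 2))%R with 2%R in H by field.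
  apply (Rsum_le_series _ _ n); [intros; apply pow_le; lra | exact H].
Qed.

Lemma analytic_at_wiener f z0 :
  analytic_at f z0 -> exists r M, (0 < r)%R /\ wiener z0 r M f.
Proof.
  intros [c [r [Hr H]]].
  assert (Hs : forall h, (Cmod h < r)%R -> Cseries (fun k => c k * h ^ k) (f (z0 + h))).
  { intros h Hh. specialize (H (z0 + h)).
    replace (z0 + h - z0) with h in H by ring. specialize (H Hh).
    revert H. unfold is_pseries. apply Cseries_ext. intros n.
    change (pow_n (K := C_Ring) h n * c n = c n * h ^ n). apply Cmult_comm. }
  assert (Hr2 : (Cmod (RtoC (r / 2)) < r)%R) by (rewrite Cmod_R, Rabs_pos_eq; lra).
  destruct (Cseries_terms_bounded _ _ (Hs _ Hr2)) as [B HB].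
  assert (HB0 : (0 <= B)%R) by (eapply Rle_trans; [apply Cmod_ge_0 | apply (HB 0%nat)]).
  (* Convergence at [r / 2] bounds the terms there by [B]; at radius [r / 4] they are then dominated
     by [B / 2^k], with sum at most [2 B]. *)
  exists (r / 4)%R, (B * 2)%R. split; [lra|]. exists c. split.
  - intros n. apply Rle_trans with (Rsum (fun k => B * (/ 2) ^ k)%R n).
    + apply Rsum_le. intros k _. specialize (HB k).
      rewrite Cmod_mult, Cmod_pow, Cmod_R, Rabs_pos_eq in HB by lra.
      replace (r / 4)%R with (r / 2 * / 2)%R by field.
      rewrite Rpow_mult_distr, <- Rmult_assoc. apply Rmult_le_compat_r; [apply pow_le; lra | exact HB].
    + rewrite Rsum_mult_l. apply Rmult_le_compat_l; [exact HB0 | apply Rsum_geom_half].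
  - intros h Hh. apply Hs. lra.
Qed.

Lemma analytic_at_minus f g z0 :
  analytic_at f z0 -> analytic_at g z0 -> analytic_at (fun z => f z - g z) z0.
Proof.
  intros Hf Hg. destruct (analytic_at_wiener f z0 Hf) as [r1 [M1 [Hr1 H1]]].
  destruct (analytic_at_wiener g z0 Hg) as [r2 [M2 [Hr2 H2]]].
  assert (Hr : (0 < Rmin r1 r2)%R) by now apply Rmin_glb_lt.
  apply (wiener_analytic_at z0 (Rmin r1 r2) (M1 + Cmod (- (1)) * M2)); [exact Hr|].
  apply wiener_ext with (fun z => f z + - (1) * g z); [intros; ring|].
  apply wiener_plus; [lra| |apply wiener_scal].
  - apply wiener_restrict with r1; [split; [lra | apply Rmin_l] | exact H1].
  - apply wiener_restrict with r2; [split; [lra | apply Rmin_r] | exact H2].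
Qed.

Definition zero_near (f : C -> C) (z : C) : Prop :=
  exists d : R, (0 < d)%R /\ forall h, (Cmod h < d)%R -> f (z + h) = 0.

(** Induction on the order [m] of the zero at [z0]: division by [z - z0] lowers it by one, and for
    [m = 0] a Lipschitz estimate at [z0] keeps [f] away from zero. *)
Lemma expansion_nonzero_near z0 r m : (0 < r)%R -> forall M c f, expansion z0 r M c f ->
  (forall k, (k < m)%nat -> c k = 0) -> c m <> 0 ->
  exists d : R, (0 < d)%R /\ forall h, (0 < Cmod h < d)%R -> f (z0 + h) <> 0.
Proof.
  intros Hr. induction m as [|m IH]; intros M c f Hc H0 Hm.
  - assert (Hf := expansion_0 _ _ _ _ _ (Rlt_le _ _ Hr) Hc).
    assert (Hpos := proj1 (Cmod_gt_0 _) Hm).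
    destruct (Cderiv_bounded f z0 _ (expansion_Cderiv _ _ _ _ _ Hr Hc)) as [d [Hd H]].
    set (K := (Cmod (c 1%nat) + 1)%R) in *.
    assert (HK : (0 < K)%R) by (unfold K; assert (P := Cmod_ge_0 (c 1%nat)); lra).
    exists (Rmin d (Cmod (c 0%nat) / K)). split.
    { apply Rmin_glb_lt; [exact Hd | now apply Rdiv_lt_0_compat]. }
    intros h [_ Hh] E.
    specialize (H h (Rlt_le_trans _ _ _ Hh (Rmin_l _ _))).
    assert (Hh2 := Rlt_le_trans _ _ _ Hh (Rmin_r _ _)).
    rewrite E, Hf in H. replace (0 - c 0%nat) with (- c 0%nat) in H by ring.
    rewrite Cmod_opp in H. apply (Rmult_lt_compat_l K) in Hh2; [|exact HK].
    replace (K * (Cmod (c 0%nat) / K))%R with (Cmod (c 0%nat)) in Hh2 by (field; lra). lra.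
  (* The value [c 1] at [z0] fills the removable singularity, so that [g] has the shifted expansion
     at the centre too. *)
  - set (g := fun z => if excluded_middle_informative (z = z0) then c 1%nat
                       else f z / (z - z0)).
    assert (Hg : forall h : C, h <> 0 -> g (z0 + h) = f (z0 + h) / h).
    { intros h Hh. unfold g. destruct (excluded_middle_informative _) as [E|_].
      - exfalso. apply Hh. replace h with (z0 + h - z0) by ring. rewrite E. ring.
      - f_equal. ring. }
    destruct (IH (M / r)%R (fun k => c (S k)) g) as [d [Hd H]].
    + destruct Hc as [H1 H2]. split.
      * intros n. specialize (H1 (S n)). rewrite Rsum_shift in H1.
        rewrite H0 in H1 by lia. rewrite Cmod_0, Rmult_0_l, Rplus_0_l in H1.
        apply Rmult_le_reg_l with r; [exact Hr|].
        replace (r * (M / r))%R with M by (field; lra). rewrite <- Rsum_mult_l.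
        eapply Rle_trans; [|apply H1]. apply Req_le, Rsum_ext. intros k. simpl. ring.
      * intros h Hh. destruct (classic (h = 0)) as [->|Hh0].
        -- replace (g (z0 + 0)) with (c 1%nat * 0 ^ 0).
           ++ apply (Cseries_O (fun k => c (S k) * 0 ^ k)). intros n. simpl. ring.
           ++ unfold g. destruct (excluded_middle_informative _) as [_|E]; [simpl; ring|].
              exfalso. apply E. ring.
        -- rewrite Hg by exact Hh0. specialize (H2 h Hh).
           replace (f (z0 + h)) with (c 0%nat * h ^ 0 + f (z0 + h)) in H2
             by (rewrite (H0 0%nat) by lia; ring).
           apply (proj2 (Cseries_S (fun k => c k * h ^ k) _)) in H2.
           apply (Cseries_mult_r (/ h)) in H2. revert H2. apply Cseries_ext.
           intros k. simpl. field. exact Hh0.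
    + intros k Hk. apply H0. lia.
    + exact Hm.
    + exists d. split; [exact Hd|]. intros h Hh E. apply (H h Hh).
      rewrite Hg, E.
      * unfold Cdiv. ring.
      * apply Cmod_gt_0. apply Hh.
Qed.

Lemma analytic_at_zeros f z0 : analytic_at f z0 ->
  zero_near f z0 \/
  exists d : R, (0 < d)%R /\ forall h, (0 < Cmod h < d)%R -> f (z0 + h) <> 0.
Proof.
  intros Hf. destruct (analytic_at_wiener f z0 Hf) as [r [M [Hr [c Hc]]]].
  destruct (classic (exists m, c m <> RtoC 0)) as [Hex|Hnex].
  - right.
    assert (Hmin : exists m, c m <> RtoC 0 /\ forall k, (k < m)%nat -> c k = 0).
    { destruct Hex as [m Hm]. revert Hm.
      induction m as [m IH] using (well_founded_induction Nat.lt_wf_0). intros Hm.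
      destruct (classic (exists k, (k < m)%nat /\ c k <> 0)) as [[k [Hk Hck]]|H].
      - now apply (IH k).
      - exists m. split; [exact Hm|]. intros k Hk. apply NNPP. intros E. apply H. now exists k. }
    destruct Hmin as [m [Hm H0]]. now apply (expansion_nonzero_near z0 r m Hr M c).
  - left. exists r. split; [exact Hr|]. intros h Hh.
    assert (H := proj2 Hc h (Rlt_le _ _ Hh)).
    assert (H0 : forall k, c k = 0) by (intros k; apply NNPP; intros E; apply Hnex; now exists k).
    apply (Cseries_unique _ _ _ H).
    replace (RtoC 0) with (c 0%nat * h ^ 0) by (rewrite H0; ring).
    apply (Cseries_O (fun k => c k * h ^ k)). intros n. rewrite H0. ring.
Qed.

(** A supremum argument. Let [T] bound the parameters up to which [f] vanishes near every point of
    the segment. An isolated zero at [T] contradicts the zeros just before it; a full neighbourhood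
    of zeros pushes the supremum beyond [T], unless the end of the segment has been reached. *)
Lemma identity_on_segment (f : C -> C) (w v : C) :
  (forall x : R, (0 <= x <= 1)%R -> analytic_at f (w + RtoC x * v)) ->
  zero_near f w -> f (w + v) = 0.
Proof.
  intros Hf Hw.
  destruct (classic (v = 0)) as [->|Hv].
  { destruct Hw as [d [Hd H]]. apply H. now rewrite Cmod_0. }
  assert (Hv0 := proj1 (Cmod_gt_0 v) Hv).
  set (E := fun x : R => (0 <= x <= 1)%R /\
              forall y : R, (0 <= y <= x)%R -> zero_near f (w + RtoC y * v)).
  assert (HE0 : E 0%R).
  { split; [lra|]. intros y Hy. replace y with 0%R by lra.
    replace (w + 0 * v) with w by ring. exact Hw. }
  destruct (completeness E) as [T [HT1 HT2]].
  { exists 1%R. intros x [Hx _]. lra. }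
  { now exists 0%R. }
  assert (HT : (0 <= T <= 1)%R).
  { split; [now apply HT1 | apply HT2; intros x [Hx _]; lra]. }
  assert (Hclose : forall e : R, (0 < e)%R -> exists x, E x /\ (T - e < x <= T)%R).
  { intros e He. apply NNPP. intros H. assert (T <= T - e)%R; [|lra].
    apply HT2. intros x Hx. apply Rnot_lt_le. intros Hlt. apply H. exists x.
    split; [exact Hx|]. split; [exact Hlt | now apply HT1]. }
  destruct (analytic_at_zeros f (w + RtoC T * v) (Hf T HT)) as [[d [Hd H]]|[d [Hd H]]].
  - destruct (Hclose (d / Cmod v / 2)%R) as [x [[Hx Hx'] HxT]].
    { assert (0 < d / Cmod v)%R by now apply Rdiv_lt_0_compat. lra. }
    (* A parameter distance of [d / |v| / 2] is a distance [d / 2] in the plane, which leaves a ball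
       of radius [d / 2] inside the ball where [f] vanishes. *)
    assert (HEy : forall y : R, (0 <= y <= 1)%R -> (y < T + d / Cmod v / 2)%R -> E y).
    { intros y Hy HyT. split; [exact Hy|]. intros u Hu.
      destruct (Rle_dec u x) as [Hux|Hux]; [apply Hx'; lra|].
      exists (d / 2)%R. split; [lra|]. intros h Hh.
      replace (w + RtoC u * v + h) with (w + RtoC T * v + (RtoC (u - T) * v + h))
        by (rewrite RtoC_minus; ring).
      apply H. eapply Rle_lt_trans; [apply Cmod_triangle|].
      rewrite Cmod_mult, Cmod_R.
      assert (Hu' : (Rabs (u - T) <= d / Cmod v / 2)%R) by (apply Rabs_le; lra).
      apply (Rmult_le_compat_r (Cmod v)) in Hu'; [|lra].
      replace (d / Cmod v / 2 * Cmod v)%R with (d / 2)%R in Hu' by (field; lra). lra. }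
    assert (Hpos : (0 < d / Cmod v / 2)%R).
    { assert (0 < d / Cmod v)%R by now apply Rdiv_lt_0_compat. lra. }
    assert (HE1 : E 1%R).
    { apply HEy; [lra|]. apply Rnot_le_lt. intros Hle.
      assert (HET : E (T + d / Cmod v / 4)%R) by (apply HEy; lra).
      apply HT1 in HET. lra. }
    destruct HE1 as [_ HE1]. destruct (HE1 1%R) as [d' [Hd' H']]; [lra|].
    specialize (H' 0). rewrite Cmod_0 in H'.
    replace (w + 1 * v + 0) with (w + v) in H' by ring. now apply H'.
  - exfalso.
    destruct (Hclose (d / Cmod v)%R) as [x [[Hx Hx'] HxT]].
    { now apply Rdiv_lt_0_compat. }
    (* If [x = T], the zeros near [T] themselves contradict isolation; if [x < T], the point of
       parameter [x] is a zero different from the centre. *)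
    destruct (Req_dec x T) as [->|HxT'].
    + destruct (Hx' T) as [d' [Hd' H']]; [lra|].
      assert (Hm : (0 < Rmin d d')%R) by now apply Rmin_glb_lt.
      assert (Hmod : Cmod (RtoC (Rmin d d' / 2)) = (Rmin d d' / 2)%R)
        by (rewrite Cmod_R; apply Rabs_pos_eq; lra).
      apply (H (RtoC (Rmin d d' / 2))); [|apply H'].
      * rewrite Hmod. assert (Q := Rmin_l d d'). lra.
      * rewrite Hmod. assert (Q := Rmin_r d d'). lra.
    + destruct (Hx' x) as [d' [Hd' H']]; [lra|].
      apply (H (RtoC (x - T) * v)).
      * rewrite Cmod_mult, Cmod_R, Rabs_left by lra. split.
        -- apply Rmult_lt_0_compat; lra.
        -- assert (Hlt : (T - x < d / Cmod v)%R) by lra.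
           apply (Rmult_lt_compat_r (Cmod v)) in Hlt; [|exact Hv0].
           replace (d / Cmod v * Cmod v)%R with d in Hlt by (field; lra). lra.
      * specialize (H' 0). rewrite Cmod_0 in H'.
        replace (w + RtoC T * v + RtoC (x - T) * v) with (w + RtoC x * v + 0)
          by (rewrite RtoC_minus; ring).
        now apply H'.
Qed.

(** * Exponential, logarithm and the binomial series *)

Lemma Rdiv_unit_interval (x y : R) : (0 <= x < y)%R -> (0 <= x / y < 1)%R.
Proof.
  intros H. assert (I := Rinv_0_lt_compat y ltac:(lra)). split.
  - apply Rmult_le_pos; lra.
  - rewrite <- (Rinv_r y) by lra. apply Rmult_lt_compat_r; lra.
Qed.

Lemma Ceq (z w : C) : Re z = Re w -> Im z = Im w -> z = w.
Proof. destruct z, w. simpl. now intros -> ->. Qed.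

Lemma Cexp_plus z w : Cexp (z + w) = Cexp z * Cexp w.
Proof.
  apply Ceq; simpl; rewrite exp_plus; [rewrite cos_plus | rewrite sin_plus];
    unfold Re, Im; ring.
Qed.

Lemma Cexp_0 : Cexp 0 = 1.
Proof. apply Ceq; simpl; rewrite exp_0; [rewrite cos_0 | rewrite sin_0]; ring. Qed.

Lemma Cexp_R (x : R) : Cexp (RtoC x) = RtoC (exp x).
Proof. apply Ceq; simpl; [rewrite cos_0 | rewrite sin_0]; ring. Qed.

Lemma Cmod_Cexp z : Cmod (Cexp z) = exp (Re z).
Proof.
  unfold Cmod, Cexp. simpl.
  replace (_ + _)%R with (exp (Re z) * exp (Re z) * (Rsqr (sin (Im z)) + Rsqr (cos (Im z))))%R
    by (unfold Rsqr; ring).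
  rewrite sin2_cos2, Rmult_1_r. apply sqrt_square. left. apply exp_pos.
Qed.

Lemma Cexp_neq_0 z : Cexp z <> 0.
Proof. apply Cmod_gt_0. rewrite Cmod_Cexp. apply exp_pos. Qed.

Lemma Cexp_opp z : Cexp (- z) = / Cexp z.
Proof.
  assert (H : Cexp (- z) * Cexp z = 1).
  { rewrite <- Cexp_plus. replace (- z + z) with (RtoC 0) by ring. apply Cexp_0. }
  rewrite <- (Cmult_1_l (/ Cexp z)), <- H. field. apply Cexp_neq_0.
Qed.

Lemma Re_le_Cmod (z : C) : (Re z <= Cmod z)%R.
Proof. eapply Rle_trans; [apply Rle_abs | apply re_le_Cmod]. Qed.

Lemma Cmod_atan z : (0 < Re z)%R ->
  cos (atan (Im z / Re z)) = (Re z / Cmod z)%R /\ sin (atan (Im z / Re z)) = (Im z / Cmod z)%R.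
Proof.
  intros H. assert (Hm := Rlt_le_trans _ _ _ H (Re_le_Cmod z)).
  assert (Hs : sqrt (1 + Rsqr (Im z / Re z)) = (Cmod z / Re z)%R).
  { apply sqrt_lem_1.
    - assert (Q := Rle_0_sqr (Im z / Re z)). lra.
    - left. now apply Rdiv_lt_0_compat.
    - unfold Rsqr. replace (Cmod z / Re z * (Cmod z / Re z))%R with (Cmod z ^ 2 / (Re z) ^ 2)%R
        by (field; lra). rewrite Cmod2_alt. field. lra. }
  split; [rewrite cos_atan | rewrite sin_atan]; rewrite Hs; field; lra.
Qed.

(** On the right half plane the argument defined through [acos] by cases on the sign of [Im z] is a
    single arctangent, which can be differentiated across the real axis. *)
Lemma Clog_half_plane z : (0 < Re z)%R -> Clog z = (ln (Cmod z), atan (Im z / Re z)).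
Proof.
  intros H. unfold Clog. f_equal. unfold Carg.
  destruct (Cmod_atan z H) as [Hc _]. assert (Hb := atan_bound (Im z / Re z)).
  destruct (Rle_dec 0 (Im z)) as [Hi|Hi].
  - rewrite <- Hc. apply acos_cos. split; [|lra].
    assert (Hq : (0 <= Im z / Re z)%R)
      by (apply Rmult_le_pos; [exact Hi | left; now apply Rinv_0_lt_compat]).
    destruct Hq as [Hq|Hq]; [|rewrite <- Hq, atan_0; lra].
    rewrite <- atan_0. left. now apply atan_increasing.
  - rewrite <- Hc, <- cos_neg, acos_cos; [ring|].
    assert (Hq : (Im z / Re z < 0)%R).
    { apply Rmult_lt_reg_r with (Re z); [exact H|]. unfold Rdiv.
      rewrite Rmult_assoc, Rinv_l; lra. }
    apply atan_increasing in Hq. rewrite atan_0 in Hq. lra.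
Qed.

Lemma Cexp_Clog z : (0 < Re z)%R -> Cexp (Clog z) = z.
Proof.
  intros H. assert (Hm := Rlt_le_trans _ _ _ H (Re_le_Cmod z)).
  rewrite Clog_half_plane by exact H. destruct (Cmod_atan z H) as [Hc Hs].
  apply Ceq; simpl; rewrite exp_ln by exact Hm; [rewrite Hc | rewrite Hs]; field; lra.
Qed.

Lemma Clog_R (x : R) : (0 < x)%R -> Clog (RtoC x) = RtoC (ln x).
Proof.
  intros H. rewrite Clog_half_plane by exact H. simpl.
  rewrite Cmod_R, Rabs_pos_eq by lra. unfold RtoC. f_equal.
  unfold Rdiv. rewrite Rmult_0_l. apply atan_0.
Qed.

Lemma Cpower_0 z : Cpower z 0 = 1.
Proof. unfold Cpower. rewrite Cmult_0_l. apply Cexp_0. Qed.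

Lemma Cpower_plus z u v : Cpower z (u + v) = Cpower z u * Cpower z v.
Proof. unfold Cpower. now rewrite Cmult_plus_distr_r, Cexp_plus. Qed.

Lemma half_plane_neq_0 (z : C) : (0 < Re z)%R -> z <> 0.
Proof. intros H ->. simpl in H. lra. Qed.

Lemma Cpower_neg_S z s k : (0 < Re z)%R ->
  Cpower z (- (s + NtoC k)) = Cpower z (- s) * (/ z) ^ k.
Proof.
  intros H. replace (- (s + NtoC k)) with (- s + - NtoC k) by ring.
  rewrite Cpower_plus. f_equal.
  induction k as [|k IH].
  - simpl. rewrite Copp_0. apply Cpower_0.
  - rewrite S_INR, RtoC_plus. replace (- (NtoC k + 1)) with (- NtoC k + - (1)) by ring.
    rewrite Cpower_plus, IH. simpl. rewrite Cmult_comm. f_equal.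
    unfold Cpower. replace (- (1) * Clog z) with (- Clog z) by ring.
    now rewrite Cexp_opp, Cexp_Clog.
Qed.

Lemma Cseries_components (u : nat -> C) (a b : R) :
  is_series (fun n => Re (u n)) a -> is_series (fun n => Im (u n)) b -> Cseries u (a, b).
Proof.
  intros Ha Hb. apply Cseries_eps. intros eps He.
  assert (HS : forall n, Csum u n = (Rsum (fun n => Re (u n)) n, Rsum (fun n => Im (u n)) n)).
  { induction n as [|n IH].
    - rewrite Csum_O, !Rsum_O. now destruct (u 0%nat).
    - rewrite Csum_S, !Rsum_S, IH. now destruct (u (S n)). }
  destruct (proj1 (Rseries_eps _ _) Ha (eps / 2)%R) as [N1 H1]; [lra|].
  destruct (proj1 (Rseries_eps _ _) Hb (eps / 2)%R) as [N2 H2]; [lra|].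
  exists (max N1 N2). intros n Hn. specialize (H1 n ltac:(lia)). specialize (H2 n ltac:(lia)).
  rewrite HS.
  replace ((Rsum (fun n => Re (u n)) n, Rsum (fun n => Im (u n)) n) - (a, b)) with
    (RtoC (Rsum (fun n => Re (u n)) n - a) + Ci * RtoC (Rsum (fun n => Im (u n)) n - b))
    by (apply Ceq; simpl; ring).
  eapply Rle_lt_trans; [apply Cmod_triangle|].
  rewrite Cmod_mult, Cmod_Ci, !Cmod_R. lra.
Qed.

Lemma Re_minus (z w : C) : Re (z - w) = (Re z - Re w)%R.
Proof. reflexivity. Qed.

Lemma Re_plus_ge (z h : C) r : (Cmod h <= r)%R -> (Re z - r <= Re (z + h))%R.
Proof.
  intros H. rewrite re_plus. assert (Q := re_le_Cmod h).
  assert (Q' := Rle_abs (- Re h)). rewrite Rabs_Ropp in Q'. lra.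
Qed.

Lemma Re_add_INR_pos (a : C) N : (0 < Re a)%R -> (0 < Re (a + NtoC N))%R.
Proof. intros H. rewrite re_plus, re_RtoC. assert (P := pos_INR N). lra. Qed.

Lemma Im_Rabs (z : C) : (Rabs (Im z) <= Cmod z)%R.
Proof. eapply Rle_trans; [apply Rmax_r | apply Rmax_Cmod]. Qed.

(** * Complex-valued functions of a real variable *)

Definition path_deriv (f : R -> C) (x : R) (l : C) : Prop :=
  is_derive (fun t => Re (f t)) x (Re l) /\ is_derive (fun t => Im (f t)) x (Im l).

Lemma path_deriv_mult f g x l m :
  path_deriv f x l -> path_deriv g x m ->
  path_deriv (fun t => f t * g t) x (l * g x + f x * m).
Proof.
  intros [F1 F2] [G1 G2].
  assert (Hm : forall u v (x a b : R), is_derive u x a -> is_derive v x b ->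
    is_derive (fun t => (u t * v t)%R) x (a * v x + u x * b)%R).
  { intros u v y a b Hu Hv.
    apply (@is_derive_mult R_AbsRing u v y a b Hu Hv). intros; apply Rmult_comm. }
  split.
  - replace (Re (l * g x + f x * m)) with
      ((Re l * Re (g x) + Re (f x) * Re m) - (Im l * Im (g x) + Im (f x) * Im m))%R
      by (unfold Re, Im; simpl; ring).
    apply (@is_derive_minus R_AbsRing R_NormedModule (fun t => Re (f t) * Re (g t))%R
      (fun t => Im (f t) * Im (g t))%R); now apply (Hm (fun t => _) (fun t => _)).
  - replace (Im (l * g x + f x * m)) with
      ((Re l * Im (g x) + Re (f x) * Im m) + (Im l * Re (g x) + Im (f x) * Re m))%R
      by (unfold Re, Im; simpl; ring).
    apply (@is_derive_plus R_AbsRing R_NormedModule (fun t => Re (f t) * Im (g t))%R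
      (fun t => Im (f t) * Re (g t))%R); now apply (Hm (fun t => _) (fun t => _)).
Qed.

Lemma path_deriv_Cexp f x l :
  path_deriv f x l -> path_deriv (fun t => Cexp (f t)) x (l * Cexp (f x)).
Proof.
  intros [F1 F2].
  assert (He : is_derive (fun t => exp (Re (f t))) x (Re l * exp (Re (f x)))%R).
  { apply (@is_derive_comp R_AbsRing R_NormedModule exp (fun t => Re (f t)));
      [apply is_derive_exp | exact F1]. }
  assert (Hc : is_derive (fun t => cos (Im (f t))) x (Im l * - sin (Im (f x)))%R).
  { apply (@is_derive_comp R_AbsRing R_NormedModule cos (fun t => Im (f t)));
      [apply is_derive_cos | exact F2]. }
  assert (Hs : is_derive (fun t => sin (Im (f t))) x (Im l * cos (Im (f x)))%R).
  { apply (@is_derive_comp R_AbsRing R_NormedModule sin (fun t => Im (f t)));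
      [apply is_derive_sin | exact F2]. }
  split; simpl.
  - match goal with |- is_derive _ _ ?d =>
      replace d with (Re l * exp (Re (f x)) * cos (Im (f x))
        + exp (Re (f x)) * (Im l * - sin (Im (f x))))%R by (unfold Re, Im; simpl; ring) end.
    apply (@is_derive_mult R_AbsRing _ _ x _ _ He Hc). intros; apply Rmult_comm.
  - match goal with |- is_derive _ _ ?d =>
      replace d with (Re l * exp (Re (f x)) * sin (Im (f x))
        + exp (Re (f x)) * (Im l * cos (Im (f x))))%R by (unfold Re, Im; simpl; ring) end.
    apply (@is_derive_mult R_AbsRing _ _ x _ _ He Hs). intros; apply Rmult_comm.
Qed.

Lemma path_deriv_opp f x l : path_deriv f x l -> path_deriv (fun t => - f t) x (- l).
Proof.
  intros [F1 F2]. split; simpl.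
  - apply (@is_derive_opp R_AbsRing R_NormedModule (fun t => Re (f t)) x _ F1).
  - apply (@is_derive_opp R_AbsRing R_NormedModule (fun t => Im (f t)) x _ F2).
Qed.

Lemma path_deriv_const (c : C) x : path_deriv (fun _ => c) x 0.
Proof. split; apply (@is_derive_const R_AbsRing R_NormedModule). Qed.

Lemma path_deriv_linear (a : C) x : path_deriv (fun t => RtoC t * a) x a.
Proof. split; simpl; auto_derive; auto; unfold Re, Im; simpl; ring. Qed.

Lemma path_deriv_0_eq f :
  (forall x, (0 <= x <= 1)%R -> path_deriv f x 0) -> f 0%R = f 1%R.
Proof.
  intros H. apply Ceq.
  - apply (@eq_is_derive R_NormedModule (fun t => Re (f t))); [|lra]. intros t Ht. apply (H t Ht).
  - apply (@eq_is_derive R_NormedModule (fun t => Im (f t))); [|lra]. intros t Ht. apply (H t Ht).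
Qed.

(** The product [f exp(-phi)] has derivative zero. The exponential and binomial series are summed in
    this way: each solves the linear equation of its closed form along the segment from 0 to 1. *)
Lemma path_linear_ode (f phi : R -> C) (dphi : R -> C) :
  (forall x, (0 <= x <= 1)%R -> path_deriv phi x (dphi x)) ->
  (forall x, (0 <= x <= 1)%R -> path_deriv f x (dphi x * f x)) ->
  f 1%R = f 0%R * Cexp (phi 1%R - phi 0%R).
Proof.
  intros Hphi Hf.
  assert (H : f 0%R * Cexp (- phi 0%R) = f 1%R * Cexp (- phi 1%R)).
  { apply (path_deriv_0_eq (fun t => f t * Cexp (- phi t))). intros x Hx.
    replace (RtoC 0) with (dphi x * f x * Cexp (- phi x) + f x * (- dphi x * Cexp (- phi x))) by ring.
    apply path_deriv_mult; [now apply Hf|].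
    apply (path_deriv_Cexp (fun t => - phi t)), path_deriv_opp. now apply Hphi. }
  unfold Cminus. rewrite Cplus_comm, Cexp_plus, Cmult_assoc, H.
  rewrite Cexp_opp. field. apply Cexp_neq_0.
Qed.

Lemma CV_radius_ge (c : nat -> R) (rho M : R) :
  (forall k, (Rabs (c k * rho ^ k) <= M)%R) -> Rbar_le rho (CV_radius c).
Proof. intros H. apply (proj1 (CV_radius_bounded c)). now exists M. Qed.

(** A radius [rho > 1] puts the whole closed interval from 0 to 1 strictly inside the disc of
    convergence, where the two real component series may be differentiated termwise. *)
Lemma path_deriv_power_series (c : nat -> C) (rho M : R) : (1 < rho)%R ->
  (forall k, (Cmod (c k) * rho ^ k <= M)%R) ->
  exists f f' : R -> C, f 0%R = c 0%nat /\ forall x, (0 <= x <= 1)%R ->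
    Cseries (fun k => c k * RtoC x ^ k) (f x) /\
    Cseries (fun k => NtoC (S k) * c (S k) * RtoC x ^ k) (f' x) /\
    path_deriv f x (f' x).
Proof.
  intros Hr HM.
  set (a := fun k => Re (c k)). set (b := fun k => Im (c k)).
  assert (Hpow : forall k, (0 < rho ^ k)%R) by (intros; apply pow_lt; lra).
  assert (Ha : Rbar_le rho (CV_radius a)).
  { apply CV_radius_ge with M. intros k. rewrite Rabs_mult, (Rabs_pos_eq (rho ^ k)) by (left; apply Hpow).
    eapply Rle_trans; [|apply (HM k)]. apply Rmult_le_compat_r; [left; apply Hpow | apply re_le_Cmod]. }
  assert (Hb : Rbar_le rho (CV_radius b)).
  { apply CV_radius_ge with M. intros k. rewrite Rabs_mult, (Rabs_pos_eq (rho ^ k)) by (left; apply Hpow).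
    eapply Rle_trans; [|apply (HM k)]. apply Rmult_le_compat_r; [left; apply Hpow | apply Im_Rabs]. }
  assert (Hx : forall x c, (0 <= x <= 1)%R -> Rbar_le rho (CV_radius c) ->
             Rbar_lt (Rabs x) (CV_radius c)).
  { intros x d Hx Hd. apply Rbar_lt_le_trans with rho; [|exact Hd].
    simpl. rewrite Rabs_pos_eq; lra. }
  exists (fun x => (PSeries a x, PSeries b x)),
         (fun x => (PSeries (PS_derive a) x, PSeries (PS_derive b) x)).
  split; [rewrite !PSeries_0; now apply Ceq|]. intros x H01.
  assert (HS : forall d, Rbar_lt (Rabs x) (CV_radius d) -> is_series (fun k => d k * x ^ k)%R (PSeries d x)).
  { intros d Hd. exact (proj1 (is_pseries_R d x _) (PSeries_correct d x (CV_radius_inside d x Hd))). }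
  split; [|split].
  - apply Cseries_components.
    + eapply is_series_ext; [|apply (HS a); auto]. intros n.
      rewrite <- RtoC_pow, re_scal_r. reflexivity.
    + eapply is_series_ext; [|apply (HS b); auto]. intros n.
      rewrite <- RtoC_pow, im_scal_r. reflexivity.
  - apply Cseries_components.
    + eapply is_series_ext; [|apply (HS (PS_derive a)); rewrite CV_radius_derive; auto]. intros n.
      rewrite <- RtoC_pow, re_scal_r, re_scal_l. reflexivity.
    + eapply is_series_ext; [|apply (HS (PS_derive b)); rewrite CV_radius_derive; auto]. intros n.
      rewrite <- RtoC_pow, im_scal_r, im_scal_l. reflexivity.
  - split; apply is_derive_PSeries; auto.
Qed.

Lemma Rsum_exp_le (x : R) n : (0 <= x)%R -> (Rsum (fun k => x ^ k / INR (fact k))%R n <= exp x)%R.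
Proof.
  intros Hx. apply Rsum_le_series.
  - intros k. apply Rmult_le_pos; [now apply pow_le|].
    left. apply Rinv_0_lt_compat, INR_fact_lt_0.
  - apply is_series_ext with (fun k => / INR (fact k) * x ^ k)%R; [intros; apply Rmult_comm|].
    exact (proj1 (is_pseries_R _ x _) (is_exp_Reals x)).
Qed.

Lemma exp_term_le (x : R) k : (0 <= x)%R -> (x ^ k / INR (fact k) <= exp x)%R.
Proof.
  intros Hx. eapply Rle_trans; [|apply (Rsum_exp_le x k Hx)].
  apply (term_le_Rsum (fun k => x ^ k / INR (fact k))%R). intros j.
  apply Rmult_le_pos; [now apply pow_le|]. left. apply Rinv_0_lt_compat, INR_fact_lt_0.
Qed.

Lemma RtoC_neq_0 (x : R) : x <> 0%R -> RtoC x <> 0.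
Proof. intros H E. apply H. now apply RtoC_inj. Qed.

Lemma Cseries_exp z : Cseries (fun k => z ^ k / NtoC (fact k)) (Cexp z).
Proof.
  set (c := fun k => z ^ k / NtoC (fact k)).
  assert (Hfact : forall k, NtoC (fact k) <> 0) by (intros; apply RtoC_neq_0, INR_fact_neq_0).
  destruct (path_deriv_power_series c 2 (exp (2 * Cmod z))) as [f [f' [Hf0 H]]]; [lra| |].
  { intros k. unfold c. rewrite Cmod_div by apply Hfact.
    rewrite Cmod_pow, Cmod_R, Rabs_pos_eq by apply pos_INR.
    replace (Cmod z ^ k / INR (fact k) * 2 ^ k)%R with ((2 * Cmod z) ^ k / INR (fact k))%R
      by (rewrite Rpow_mult_distr; field; apply INR_fact_neq_0).
    apply exp_term_le. assert (P := Cmod_ge_0 z). lra. }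
  assert (Hf' : forall x, (0 <= x <= 1)%R -> f' x = z * f x).
  { intros x Hx. destruct (H x Hx) as [H1 [H2 _]].
    apply (Cseries_unique _ _ _ H2).
    apply (Cseries_mult_l z) in H1. revert H1. apply Cseries_ext. intros k. unfold c.
    rewrite fact_simpl, mult_INR, RtoC_mult. simpl (z ^ S k). field.
    split; [apply Hfact | apply RtoC_neq_0, not_0_INR; lia]. }
  assert (E := path_linear_ode f (fun t => RtoC t * z) (fun _ => z)
    (fun x _ => path_deriv_linear z x)).
  destruct (H 1%R) as [H1 _]; [lra|].
  assert (Hc0 : c 0%nat = 1) by (unfold c; simpl; field; apply C1_nz).
  rewrite Hf0, Hc0, Cmult_1_l in E. replace (1 * z - 0 * z) with z in E by ring.
  rewrite <- E.
  - revert H1. apply Cseries_ext. intros k. rewrite Cpow_1_l. apply Cmult_1_r.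
  - intros x Hx. rewrite <- Hf' by exact Hx. now apply H.
Qed.

(** * Rising factorials and the binomial series *)

Fixpoint poch (s : C) (k : nat) : C :=
  match k with
  | O => 1
  | S j => poch s j * (s + NtoC j)
  end.

(** The real counterpart, taken at some [x >= |s|], majorises [|poch s k|]. *)
Fixpoint rpoch (x : R) (k : nat) : R :=
  match k with
  | O => 1
  | S j => rpoch x j * (x + INR j)
  end.

Lemma rpoch_pos x k : (0 <= x)%R -> (0 <= rpoch x k)%R.
Proof.
  intros Hx. induction k as [|k IH]; simpl; [lra|].
  apply Rmult_le_pos; [exact IH|]. assert (P := pos_INR k). lra.
Qed.

Lemma Cmod_poch_le s x k : (Cmod s <= x)%R -> (Cmod (poch s k) <= rpoch x k)%R.
Proof.
  intros H. assert (P := Cmod_ge_0 s). induction k as [|k IH]; simpl.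
  - rewrite Cmod_1. lra.
  - rewrite Cmod_mult. apply Rmult_le_compat; try apply Cmod_ge_0; [exact IH|].
    eapply Rle_trans; [apply Cmod_triangle|].
    rewrite Cmod_R, Rabs_pos_eq by apply pos_INR. lra.
Qed.

(** Ratio test; passing to [x + 1] and [b + 1] makes all terms nonzero. *)
Lemma ex_series_rpoch (x b q : R) : (0 <= x)%R -> (0 <= b)%R -> (0 <= q < 1)%R ->
  ex_series (fun k => (rpoch x k / INR (fact k) * (b + INR k) * q ^ k)%R).
Proof.
  intros Hx Hb Hq.
  (* For [q = 0] the ratio test does not apply, but only the term [k = 0] survives. *)
  destruct (Req_dec q 0) as [->|Hq0].
  { exists (rpoch x 0 / INR (fact 0) * (b + INR 0) * 0 ^ 0)%R.
    apply Rseries_eps. intros eps He. exists 0%nat. intros n _.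
    replace (Rsum _ n) with (rpoch x 0 / INR (fact 0) * (b + INR 0) * 0 ^ 0)%R.
    - rewrite Rminus_diag, Rabs_R0. exact He.
    - induction n as [|n IH]; [now rewrite Rsum_O|]. rewrite Rsum_S, <- IH. simpl. ring. }
  set (y := (x + 1)%R). set (d := (b + 1)%R).
  assert (Hpos : forall k, (0 < rpoch y k)%R).
  { induction k as [|k IH]; simpl; [lra|]. apply Rmult_lt_0_compat; [exact IH|].
    assert (P := pos_INR k). unfold y. lra. }
  assert (Hmono : forall k, (rpoch x k <= rpoch y k)%R).
  { induction k as [|k IH]; simpl; [lra|].
    apply Rmult_le_compat; [now apply rpoch_pos| |exact IH|]; assert (P := pos_INR k);
      unfold y; lra. }
  apply (@ex_series_le R_AbsRing R_CompleteNormedModule _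
    (fun k => (rpoch y k / INR (fact k) * (d + INR k) * q ^ k)%R)).
  { intros k. assert (P := pos_INR k). assert (F := INR_fact_lt_0 k).
    assert (Q := rpoch_pos x k Hx).
    assert (I := Rinv_0_lt_compat _ F). assert (qk := pow_le q k (proj1 Hq)).
    change (Rabs (rpoch x k / INR (fact k) * (b + INR k) * q ^ k)
            <= rpoch y k / INR (fact k) * (d + INR k) * q ^ k)%R.
    rewrite Rabs_pos_eq.
    - apply Rmult_le_compat_r; [exact qk|]. apply Rmult_le_compat; [|lra| |unfold d; lra].
      + apply Rmult_le_pos; lra.
      + apply Rmult_le_compat_r; [lra | apply Hmono].
    - apply Rmult_le_pos; [|exact qk]. apply Rmult_le_pos; [|lra]. apply Rmult_le_pos; lra. }
  assert (Hterm : forall k, (0 < rpoch y k / INR (fact k) * (d + INR k) * q ^ k)%R).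
  { intros k. assert (P := pos_INR k). apply Rmult_lt_0_compat; [|apply pow_lt; lra].
    apply Rmult_lt_0_compat; [|unfold d; lra].
    apply Rdiv_lt_0_compat; [apply Hpos | apply INR_fact_lt_0]. }
  apply ex_series_Rabs, ex_series_DAlembert with q; [lra| |].
  - intros k. apply Rgt_not_eq, Hterm.
  - apply is_lim_seq_ext with
      (fun k => q * ((1 + x / (INR k + 1)) * (1 + 1 / (INR k + d))))%R.
    { intros k. assert (P := pos_INR k). rewrite Rabs_pos_eq.
      - rewrite fact_simpl, mult_INR. simpl rpoch. simpl pow. rewrite S_INR.
        unfold y, d. field.
        assert (F := INR_fact_lt_0 k). assert (G := pow_lt q k ltac:(lra)).
        assert (K := Hpos k). unfold y in K. repeat split; try lra.
      - left. apply Rdiv_lt_0_compat; apply Hterm. }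
    assert (Hinv : forall e (c : R), (0 < c)%R -> is_lim_seq (fun k => 1 + e / (INR k + c))%R 1).
    { intros e c Hc. replace (Finite 1) with (Finite (1 + e * 0)) by (f_equal; ring).
      apply is_lim_seq_plus'; [apply is_lim_seq_const|].
      apply is_lim_seq_mult'; [apply is_lim_seq_const|].
      replace (Finite 0) with (Rbar_inv p_infty) by reflexivity.
      apply is_lim_seq_inv; [|discriminate].
      apply is_lim_seq_plus with p_infty c; [apply is_lim_seq_INR | apply is_lim_seq_const|].
      reflexivity. }
    replace (Finite q) with (Finite (q * (1 * 1))) by (f_equal; ring).
    apply is_lim_seq_mult'; [apply is_lim_seq_const|].
    apply is_lim_seq_mult'; apply Hinv; unfold d; lra.
Qed.

Lemma series_terms_le (u : nat -> R) :
  (forall k, (0 <= u k)%R) -> ex_series u -> exists M, forall k, (u k <= M)%R.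
Proof.
  intros Hu [l Hl]. exists l. intros k.
  eapply Rle_trans; [now apply term_le_Rsum | now apply Rsum_le_series].
Qed.

(** The real and imaginary parts are differentiated separately, after replacing them near [x] by
    explicit real formulas: the half plane is open, so the path stays in it for nearby
    parameters. *)
Lemma path_deriv_Clog (w v : C) x : (0 < Re (w - RtoC x * v))%R ->
  path_deriv (fun t => Clog (w - RtoC t * v)) x (- v / (w - RtoC x * v)).
Proof.
  intros H. set (z := w - RtoC x * v) in *.
  assert (Hn : (0 < Re z * Re z + Im z * Im z)%R).
  { assert (0 < Re z * Re z)%R by now apply Rmult_lt_0_compat.
    assert (0 <= Im z * Im z)%R by apply Rle_0_sqr. lra. }
  assert (Ez : Re z = (Re w - x * Re v)%R) by (unfold z; simpl; unfold Re, Im; ring).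
  assert (Hloc : locally x (fun t => (0 < Re w - t * Re v)%R)).
  { assert (Hc : continuous (fun t : R => (Re w - t * Re v)%R) x).
    { apply (@ex_derive_continuous R_AbsRing R_NormedModule). auto_derive. exact I. }
    apply Hc. apply (open_gt 0%R). rewrite <- Ez. exact H. }
  assert (Ei : Im z = (Im w - x * Im v)%R) by (unfold z; simpl; unfold Re, Im; ring).
  clearbody z.
  assert (Ed : - v / z = (- ((Re v * Re z + Im v * Im z) / (Re z * Re z + Im z * Im z)),
                          (Re v * Im z - Im v * Re z) / (Re z * Re z + Im z * Im z))%R).
  { apply Ceq; unfold Cdiv, Cinv; simpl; unfold Re, Im in *; field; simpl; lra. }
  rewrite Ed. split.
  (* Half the logarithm of the squared modulus spares the derivative of a square root. *)
  - apply is_derive_ext_loc with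
      (fun t => / 2 * ln ((Re w - t * Re v) * (Re w - t * Re v) + (Im w - t * Im v) * (Im w - t * Im v)))%R.
    + revert Hloc. apply filter_imp. intros t Ht.
      set (A := ((Re w - t * Re v) * (Re w - t * Re v) + (Im w - t * Im v) * (Im w - t * Im v))%R).
      assert (HA : (0 < A)%R).
      { unfold A. assert (0 <= (Im w - t * Im v) * (Im w - t * Im v))%R by apply Rle_0_sqr.
        assert (0 < (Re w - t * Re v) * (Re w - t * Re v))%R by now apply Rmult_lt_0_compat. lra. }
      assert (E : Re (Clog (w - RtoC t * v)) = ln (sqrt A)).
      { unfold Clog, Cmod, A, Re, Im. simpl. f_equal. f_equal. ring. }
      rewrite E. rewrite <- (sqrt_sqrt A) at 1 by lra.
      rewrite ln_mult by now apply sqrt_lt_R0.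
      change (/ 2 * (ln (sqrt A) + ln (sqrt A)) = ln (sqrt A))%R. field.
    + rewrite Ez, Ei in *. auto_derive; [exact Hn|]. simpl. field. lra.
  - apply is_derive_ext_loc with (fun t => atan ((Im w - t * Im v) / (Re w - t * Re v)))%R.
    + revert Hloc. apply filter_imp. intros t Ht.
      rewrite Clog_half_plane.
      * assert (E1 : Im (w - RtoC t * v) = (Im w - t * Im v)%R) by (unfold Re, Im; simpl; ring).
        assert (E2 : Re (w - RtoC t * v) = (Re w - t * Re v)%R) by (unfold Re, Im; simpl; ring).
        rewrite E1, E2. reflexivity.
      * simpl. unfold Re, Im in *. simpl. lra.
    + rewrite Ez, Ei in *. auto_derive; [lra|]. simpl. unfold Rsqr. field. split; lra.
Qed.

(** With [u = t / w], the sum of [(s)_k / k! (x u)^k] satisfies [(1 - x u) f' = s u f], the equation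
    of [(1 - x u)^(-s)]. The hypothesis keeps the segment from [w] to [w - t] in the right half
    plane, so the principal logarithm is differentiable along it. *)
Lemma binomial_series (w t s : C) : (Cmod t < Re w)%R ->
  Cseries (fun k => poch s k / NtoC (fact k) * t ^ k * Cpower w (- (s + NtoC k)))
          (Cpower (w - t) (- s)).
Proof.
  intros Ht. assert (P := Cmod_ge_0 t). assert (Hw : (0 < Re w)%R) by lra.
  assert (Hw0 := half_plane_neq_0 w Hw). assert (Hwm := Re_le_Cmod w).
  assert (Hfact : forall k, NtoC (fact k) <> 0) by (intros; apply RtoC_neq_0, INR_fact_neq_0).
  set (u := t / w).
  assert (Hu : (Cmod u < 1)%R).
  { unfold u. rewrite Cmod_div by exact Hw0. apply Rdiv_unit_interval. lra. }
  assert (Pu := Cmod_ge_0 u).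
  set (c := fun k => poch s k / NtoC (fact k) * u ^ k).
  (* This choice gives both [rho > 1] and [|u| rho < 1]. *)
  set (rho := (2 / (1 + Cmod u))%R).
  assert (Hrho : (1 < rho)%R).
  { unfold rho. apply Rmult_lt_reg_r with (1 + Cmod u)%R; [lra|].
    unfold Rdiv. rewrite Rmult_assoc, Rinv_l; lra. }
  assert (Hq : (0 <= Cmod u * rho < 1)%R).
  { split; [apply Rmult_le_pos; lra|]. unfold rho.
    apply Rmult_lt_reg_r with (1 + Cmod u)%R; [lra|].
    replace (Cmod u * (2 / (1 + Cmod u)) * (1 + Cmod u))%R with (2 * Cmod u)%R by (field; lra). lra. }
  assert (HM := ex_series_rpoch (Cmod s) 1 (Cmod u * rho) (Cmod_ge_0 s) Rle_0_1 Hq).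
  apply series_terms_le in HM.
  2:{ intros k. assert (Q := pos_INR k). apply Rmult_le_pos; [|apply pow_le; lra].
      apply Rmult_le_pos; [|lra]. apply Rmult_le_pos; [apply rpoch_pos, Cmod_ge_0|].
      left. apply Rinv_0_lt_compat, INR_fact_lt_0. }
  destruct HM as [M HM].
  destruct (path_deriv_power_series c rho M Hrho) as [f [f' [Hf0 H]]].
  { intros k. eapply Rle_trans; [|apply (HM k)]. unfold c.
    rewrite Cmod_mult, Cmod_div, Cmod_pow, Cmod_R, Rabs_pos_eq by (apply Hfact || apply pos_INR).
    rewrite Rmult_assoc, <- Rpow_mult_distr.
    apply Rmult_le_compat_r; [apply pow_le; lra|].
    assert (I := Rinv_0_lt_compat _ (INR_fact_lt_0 k)). assert (Q := pos_INR k).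
    rewrite <- (Rmult_1_r (Cmod (poch s k) / INR (fact k))).
    assert (Hp := Cmod_poch_le s (Cmod s) k (Rle_refl _)).
    apply Rmult_le_compat; [apply Rmult_le_pos; [apply Cmod_ge_0 | lra] | lra | | lra].
    apply Rmult_le_compat_r; lra. }
  assert (Hre : forall x, (0 <= x <= 1)%R -> (0 < Re (w - RtoC x * t))%R).
  { intros x Hx. simpl. assert (Q := re_le_Cmod t).
    assert (Q' := Rle_trans _ _ _ (Rle_abs _) Q). unfold Re in *. nra. }
  assert (Hxu : forall x, (0 <= x <= 1)%R -> 1 - RtoC x * u <> 0).
  { intros x Hx E. apply (half_plane_neq_0 _ (Hre x Hx)).
    replace (w - RtoC x * t) with (w * (1 - RtoC x * u)) by (unfold u; field; exact Hw0).
    rewrite E. ring. }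
  assert (Hf' : forall x, (0 <= x <= 1)%R -> f' x = s * t / (w - RtoC x * t) * f x).
  { intros x Hx. destruct (H x Hx) as [H1 [H2 _]].
    (* Comparison of coefficients: [(k + 1) c_(k+1) = (s + k) u c_k]. *)
    assert (E : f' x - RtoC x * u * f' x = s * u * f x).
    { apply (Cseries_unique (fun k => s * u * (c k * RtoC x ^ k)));
        [|now apply Cseries_mult_l].
      assert (H3 : Cseries (fun k => match k with O => RtoC 0 | S j =>
                 RtoC x * u * (NtoC (S j) * c (S j) * RtoC x ^ j) end)
                 (RtoC x * u * f' x)).
      { replace (RtoC x * u * f' x) with (0 + RtoC x * u * f' x) by ring.
        apply (proj1 (Cseries_S (fun k => match k with O => RtoC 0 | S j =>
                 RtoC x * u * (NtoC (S j) * c (S j) * RtoC x ^ j) end) _)).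
        now apply Cseries_mult_l. }
      generalize (Cseries_minus _ _ _ _ H2 H3). apply Cseries_ext. intros k. unfold c.
      rewrite fact_simpl, mult_INR, RtoC_mult.
      assert (HS : NtoC (S k) <> 0) by (apply RtoC_neq_0, not_0_INR; lia).
      destruct k as [|k].
      - simpl. field.
      - rewrite (S_INR (S k)), RtoC_plus. rewrite (S_INR (S k)), RtoC_plus in HS.
        change (poch s (S (S k))) with (poch s (S k) * (s + NtoC (S k))).
        change (u ^ S (S k)) with (u * (u * u ^ k)). change (u ^ S k) with (u * u ^ k).
        change (RtoC x ^ S k) with (RtoC x * RtoC x ^ k).
        field. split; [apply Hfact | exact HS]. }
    replace (s * t / (w - RtoC x * t) * f x) with (s * u * f x / (1 - RtoC x * u)).
    - rewrite <- E. field. now apply Hxu.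
    - unfold u. field. repeat split; first [exact Hw0 | now apply half_plane_neq_0, Hre]. }
  assert (E := path_linear_ode f (fun x => - s * Clog (w - RtoC x * t))
    (fun x => s * t / (w - RtoC x * t))).
  destruct (H 1%R) as [H1 _]; [lra|].
  assert (Hc0 : c 0%nat = 1) by (unfold c; simpl; field; apply C1_nz).
  replace (Cpower (w - t) (- s)) with (f 1%R * Cpower w (- s)).
  - apply (Cseries_mult_r (Cpower w (- s))) in H1. revert H1. apply Cseries_ext. intros k.
    rewrite Cpow_1_l, Cpower_neg_S by exact Hw. unfold c, u, Cdiv.
    rewrite Cpow_mult_l. ring.
  - rewrite E, Hf0, Hc0, Cmult_1_l.
    + unfold Cpower. rewrite <- Cexp_plus. f_equal.
      replace (w - RtoC 0 * t) with w by ring. replace (w - RtoC 1 * t) with (w - t) by ring. ring.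
    + intros x Hx.
      replace (s * t / (w - RtoC x * t)) with
        (0 * Clog (w - RtoC x * t) + - s * (- t / (w - RtoC x * t)))
        by (field; now apply half_plane_neq_0, Hre).
      apply (path_deriv_mult (fun _ => - s)); [apply path_deriv_const|].
      now apply path_deriv_Clog, Hre.
    + intros x Hx. rewrite <- Hf' by exact Hx. now apply H.
Qed.

(** * The Hurwitz series *)

(** A total sum function; its value is arbitrary when the series diverges. *)
Definition CSeries (u : nat -> C) : C := epsilon (inhabits (RtoC 0)) (fun l : C => Cseries u l).

Lemma CSeries_correct (u : nat -> C) : (exists l : C, Cseries u l) -> Cseries u (CSeries u).
Proof. apply (epsilon_spec (inhabits (RtoC 0)) (fun l : C => Cseries u l)). Qed.

Lemma CSeries_eq (u : nat -> C) (l : C) : Cseries u l -> CSeries u = l.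
Proof. intros H. apply (Cseries_unique u); [apply CSeries_correct; now exists l | exact H]. Qed.

(** The real power [(n + alpha)^(-e)], majorant of the terms of the Hurwitz series. *)
Definition hb (e alpha : R) (n : nat) : R := exp (- e * ln (INR n + alpha)).

Lemma hb_pos e alpha n : (0 < hb e alpha n)%R.
Proof. apply exp_pos. Qed.

Lemma exp_le x y : (x <= y)%R -> (exp x <= exp y)%R.
Proof. intros [H| ->]; [left; now apply exp_increasing | apply Rle_refl]. Qed.

Lemma ln_le_sub_1 x : (0 < x)%R -> (ln x <= x - 1)%R.
Proof. intros H. assert (Q := exp_ineq1_le (ln x)). rewrite exp_ln in Q by exact H. lra. Qed.

(** A discrete form of the integral of [y^(-e)]: it follows from [ln(y + 1) - ln y >= 1 / (y + 1)]
    and [exp x >= 1 + x]. *)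
Lemma hb_telescope e alpha n : (1 < e)%R -> (0 < alpha)%R ->
  ((e - 1) * hb e alpha (S n) <= hb (e - 1) alpha n - hb (e - 1) alpha (S n))%R.
Proof.
  intros He Ha. assert (P := pos_INR n). unfold hb. rewrite S_INR.
  set (y := (INR n + alpha)%R). replace (INR n + 1 + alpha)%R with (y + 1)%R by (unfold y; ring).
  assert (Hy : (0 < y)%R) by (unfold y; lra).
  assert (Hu : (/ (y + 1) <= ln (y + 1) - ln y)%R).
  { assert (Q := ln_le_sub_1 (y / (y + 1)) ltac:(apply Rdiv_lt_0_compat; lra)).
    unfold Rdiv in Q. rewrite ln_mult, ln_Rinv in Q by (try apply Rinv_0_lt_compat; lra).
    replace (y * / (y + 1) - 1)%R with (- / (y + 1))%R in Q by (field; lra). lra. }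
  replace (- (e - 1) * ln y)%R with (- (e - 1) * ln (y + 1) + (e - 1) * (ln (y + 1) - ln y))%R by ring.
  replace (- e * ln (y + 1))%R with (- (e - 1) * ln (y + 1) + - ln (y + 1))%R by ring.
  rewrite !exp_plus, exp_Ropp, exp_ln by lra.
  assert (Q := exp_ineq1_le ((e - 1) * (ln (y + 1) - ln y))).
  assert (E := exp_pos (- (e - 1) * ln (y + 1))).
  set (X := exp (- (e - 1) * ln (y + 1))) in *.
  assert (H1 : ((e - 1) * / (y + 1) <= (e - 1) * (ln (y + 1) - ln y))%R)
    by (apply Rmult_le_compat_l; lra).
  replace ((e - 1) * (X * / (y + 1)))%R with (X * ((e - 1) * / (y + 1)))%R by ring.
  replace (X * exp ((e - 1) * (ln (y + 1) - ln y)) - X)%R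
    with (X * (exp ((e - 1) * (ln (y + 1) - ln y)) - 1))%R by ring.
  apply Rmult_le_compat_l; lra.
Qed.

Lemma ex_series_hb e alpha : (1 < e)%R -> (0 < alpha)%R -> ex_series (hb e alpha).
Proof.
  intros He Ha. apply ex_series_incr_1.
  apply ex_series_bounded with (/ (e - 1) * hb (e - 1) alpha 0)%R.
  { intros k. left. apply hb_pos. }
  intros n. apply Rle_trans with (/ (e - 1) * (hb (e - 1) alpha 0 - hb (e - 1) alpha (S n)))%R.
  - assert (Hs : forall k, (hb e alpha (S k) <= / (e - 1) * (hb (e - 1) alpha k - hb (e - 1) alpha (S k)))%R).
    { intros k. apply Rmult_le_reg_l with (e - 1)%R; [lra|].
      rewrite <- Rmult_assoc, Rinv_r, Rmult_1_l by lra. now apply hb_telescope. }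
    induction n as [|n IH]; [rewrite Rsum_O; apply Hs|].
    rewrite Rsum_S. specialize (Hs (S n)).
    eapply Rle_trans; [apply Rplus_le_compat; [exact IH | exact Hs]|]. apply Req_le. ring.
  - apply Rmult_le_compat_l; [left; apply Rinv_0_lt_compat; lra|].
    assert (Q := hb_pos (e - 1) alpha (S n)). lra.
Qed.

Lemma ln_le_mono x y : (0 < x)%R -> (x <= y)%R -> (ln x <= ln y)%R.
Proof. intros H [H'| ->]; [left; now apply ln_increasing | apply Rle_refl]. Qed.

(** Excess exponent is traded for a power of [alpha], uniformly in [n]. This is the source of all
    geometric decay in [k] below. *)
Lemma hb_factor e e' alpha n : (0 < alpha)%R -> (e' <= e)%R ->
  (hb e alpha n <= exp (- (e - e') * ln alpha) * hb e' alpha n)%R.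
Proof.
  intros Ha He. unfold hb. rewrite <- exp_plus. apply exp_le.
  assert (P := pos_INR n).
  assert (Q := ln_le_mono alpha (INR n + alpha) Ha ltac:(lra)). nra.
Qed.

Lemma Re_INR_plus n (a : C) : Re (NtoC n + a) = (INR n + Re a)%R.
Proof. reflexivity. Qed.

(** The crude bound 2 for [PI / 2] suffices: the argument only ever contributes a factor such as
    [exp(2 |Im s|)], independent of [n]. *)
Lemma Clog_bounds (w : C) : (0 < Re w)%R ->
  Re (Clog w) = ln (Cmod w) /\ (Rabs (Im (Clog w)) <= 2)%R.
Proof.
  intros H. rewrite Clog_half_plane by exact H. split; [reflexivity|]. simpl.
  assert (Q := atan_bound (Im w / Re w)). assert (P := PI_4). apply Rabs_le. lra.
Qed.

Lemma Cmod_le_Rabs (z : C) : (Cmod z <= Rabs (Re z) + Rabs (Im z))%R.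
Proof.
  replace z with (RtoC (Re z) + Ci * RtoC (Im z)) at 1 by (apply Ceq; simpl; ring).
  eapply Rle_trans; [apply Cmod_triangle|]. rewrite Cmod_mult, Cmod_Ci, !Cmod_R. lra.
Qed.

Lemma Cmod_Cpower_le (w s : C) : (0 < Re w)%R ->
  (Cmod (Cpower w (- s)) <= exp (2 * Rabs (Im s)) * exp (- Re s * ln (Cmod w)))%R.
Proof.
  intros H. destruct (Clog_bounds w H) as [H1 H2].
  unfold Cpower. rewrite Cmod_Cexp, <- exp_plus. apply exp_le.
  rewrite re_mult, H1.
  replace (Re (- s)) with (- Re s)%R by reflexivity.
  replace (Im (- s)) with (- Im s)%R by reflexivity.
  assert (Q : (Im s * Im (Clog w) <= Rabs (Im s) * 2)%R).
  { eapply Rle_trans; [apply Rle_abs|]. rewrite Rabs_mult.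
    apply Rmult_le_compat_l; [apply Rabs_pos | exact H2]. }
  lra.
Qed.

Lemma Cmod_hterm_le (a s : C) n : (0 < Re a)%R -> (0 <= Re s)%R ->
  (Cmod (Cpower (NtoC n + a) (- s)) <= exp (2 * Rabs (Im s)) * hb (Re s) (Re a) n)%R.
Proof.
  intros Ha Hs. assert (P := pos_INR n).
  eapply Rle_trans; [apply Cmod_Cpower_le; rewrite Re_INR_plus; lra|].
  apply Rmult_le_compat_l; [left; apply exp_pos|]. apply exp_le.
  assert (Q := Re_le_Cmod (NtoC n + a)). rewrite Re_INR_plus in Q.
  assert (L := ln_le_mono (INR n + Re a) _ ltac:(lra) Q). nra.
Qed.

Lemma expansion_Cexp (z0 L : C) r : (0 <= r)%R ->
  expansion z0 r (exp (Re (z0 * L)) * exp (r * Cmod L))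
    (fun k => Cexp (z0 * L) * (L ^ k / NtoC (fact k))) (fun s => Cexp (s * L)).
Proof.
  intros Hr.
  assert (Hfact : forall k, NtoC (fact k) <> 0) by (intros; apply RtoC_neq_0, INR_fact_neq_0).
  split.
  - intros n. rewrite <- Cmod_Cexp.
    apply Rle_trans with (Cmod (Cexp (z0 * L)) * Rsum (fun k => (r * Cmod L) ^ k / INR (fact k))%R n)%R.
    + rewrite <- Rsum_mult_l. apply Req_le, Rsum_ext. intros k.
      rewrite Cmod_mult, Cmod_div, Cmod_pow, Cmod_R, Rabs_pos_eq by (apply Hfact || apply pos_INR).
      rewrite Rpow_mult_distr. field. apply INR_fact_neq_0.
    + apply Rmult_le_compat_l; [apply Cmod_ge_0|]. apply Rsum_exp_le.
      apply Rmult_le_pos; [exact Hr | apply Cmod_ge_0].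
  - intros h _. rewrite Cmult_plus_distr_r, Cexp_plus.
    apply Cseries_ext with (fun k => Cexp (z0 * L) * ((h * L) ^ k / NtoC (fact k))).
    + intros k. rewrite Cpow_mult_l. unfold Cdiv. ring.
    + apply Cseries_mult_l, Cseries_exp.
Qed.

Lemma wiener_Cexp (z0 L : C) r : (0 <= r)%R ->
  wiener z0 r (exp (Re (z0 * L)) * exp (r * Cmod L)) (fun s => Cexp (s * L)).
Proof. intros Hr. eexists. now apply expansion_Cexp. Qed.

Lemma Cderiv_Cpower_neg (w z : C) : Cderiv (fun s => Cpower w (- s)) z (- Clog w * Cpower w (- z)).
Proof.
  apply (Cderiv_local_ext (fun s => Cexp (s * (- Clog w))) _ _ _ 1 Rlt_0_1).
  { intros h _. unfold Cpower. f_equal. ring. }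
  replace (- Clog w * Cpower w (- z)) with
    (Cexp (z * (- Clog w)) * ((- Clog w) ^ 1 / NtoC (fact 1))).
  - exact (expansion_Cderiv _ _ _ _ _ Rlt_0_1 (expansion_Cexp z (- Clog w) 1 Rle_0_1)).
  - unfold Cpower. replace (z * - Clog w) with (- z * Clog w) by ring. simpl. field.
Qed.

(** For [Re w >= Re a > 0] one has [|Arg w| <= 2] and
    [|ln |w|| <= ln |w| + 2 |ln (Re a)|]. *)
Definition hK (a z0 : C) (r : R) : R := exp (2 * Rabs (Im z0) + r * (2 + 2 * Rabs (ln (Re a)))).

Lemma wiener_Cpower (w z0 : C) r : (0 <= r)%R -> exists M, wiener z0 r M (fun s => Cpower w (- s)).
Proof.
  intros Hr. eexists. apply wiener_ext with (fun s => Cexp (s * (- Clog w))).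
  - intros h _. unfold Cpower. f_equal. ring.
  - now apply wiener_Cexp.
Qed.

(** The norm of [exp(s L)] on the disc is [exp(Re(z0 L) + r |L|)]. With [L = -Clog w] the effective
    exponent of [|w|] drops from [Re z0] to [Re z0 - r], the least real part on the disc. *)
Lemma hterm_wiener a z0 r n : (0 < Re a)%R -> (0 <= r <= Re z0)%R ->
  wiener z0 r (hK a z0 r * hb (Re z0 - r) (Re a) n) (fun s => Cpower (NtoC n + a) (- s)).
Proof.
  intros Ha Hr. assert (P := pos_INR n). set (w := NtoC n + a).
  assert (Hw : (0 < Re w)%R) by (unfold w; rewrite Re_INR_plus; lra).
  destruct (Clog_bounds w Hw) as [H1 H2].
  apply wiener_ext with (fun s => Cexp (s * (- Clog w))).
  { intros h _. unfold Cpower. f_equal. ring. }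
  refine (wiener_le _ _ _ _ _ _ (wiener_Cexp z0 (- Clog w) r (proj1 Hr))).
  unfold hK, hb. rewrite <- !exp_plus. apply exp_le.
  assert (Q := Re_le_Cmod w). assert (L := ln_le_mono _ _ Hw Q).
  assert (La : (ln (Re a) <= ln (Re w))%R)
    by (apply ln_le_mono; [exact Ha | unfold w; rewrite Re_INR_plus; lra]).
  change (ln (Re w)) with (ln (INR n + Re a)) in *.
  rewrite Cmod_opp. assert (B := Cmod_le_Rabs (Clog w)). rewrite H1 in B.
  rewrite re_mult. replace (Re (- Clog w)) with (- Re (Clog w))%R by reflexivity.
  replace (Im (- Clog w)) with (- Im (Clog w))%R by reflexivity. rewrite H1.
  assert (I : (Im z0 * Im (Clog w) <= Rabs (Im z0) * 2)%R).
  { eapply Rle_trans; [apply Rle_abs|]. rewrite Rabs_mult.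
    apply Rmult_le_compat_l; [apply Rabs_pos | exact H2]. }
  assert (J : (Rabs (ln (Cmod w)) <= ln (Cmod w) + 2 * Rabs (ln (Re a)))%R).
  { unfold Rabs. destruct (Rcase_abs (ln (Cmod w))), (Rcase_abs (ln (Re a))); lra. }
  assert (K : (r * Cmod (Clog w) <= r * (ln (Cmod w) + 2 * Rabs (ln (Re a)) + 2))%R)
    by (apply Rmult_le_compat_l; lra).
  assert (K2 : ((Re z0 - r) * ln (INR n + Re a) <= (Re z0 - r) * ln (Cmod w))%R)
    by (apply Rmult_le_compat_l; lra).
  lra.
Qed.

Definition hsum (a s : C) : C := CSeries (fun n => Cpower (NtoC n + a) (- s)).

Lemma hsum_correct a s : (0 < Re a)%R -> (1 < Re s)%R ->
  Cseries (fun n => Cpower (NtoC n + a) (- s)) (hsum a s).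
Proof.
  intros Ha Hs. apply CSeries_correct.
  apply Cseries_abs with (fun n => exp (2 * Rabs (Im s)) * hb (Re s) (Re a) n)%R.
  - intros n. apply Cmod_hterm_le; lra.
  - apply (@ex_series_scal R_AbsRing R_NormedModule). now apply ex_series_hb.
Qed.

(** The exponent [e] is left free: held fixed while [Re z0] grows, it keeps the sum over [n]
    constant and moves the growth into an explicit power of [Re a]. *)
Lemma hsum_wiener a z0 r e : (0 < Re a)%R -> (0 < r)%R -> (1 < e <= Re z0 - r)%R ->
  wiener z0 r (hK a z0 r * exp (- (Re z0 - r - e) * ln (Re a)) * Series (hb e (Re a))) (hsum a).
Proof.
  intros Ha Hr He.
  set (c := (hK a z0 r * exp (- (Re z0 - r - e) * ln (Re a)))%R).
  assert (HcM : (Series (fun n => c * hb e (Re a) n) = c * Series (hb e (Re a)))%R)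
    by apply Series_scal_l.
  rewrite <- HcM.
  apply (wiener_series z0 r _ (fun n s => Cpower (NtoC n + a) (- s)) (hsum a) Hr).
  - intros n. refine (wiener_le _ _ _ _ _ _ (hterm_wiener a z0 r n Ha ltac:(lra))).
    unfold c. rewrite Rmult_assoc. apply Rmult_le_compat_l; [left; apply exp_pos|].
    apply hb_factor; lra.
  - apply (@ex_series_scal R_AbsRing R_NormedModule). apply ex_series_hb; lra.
  - intros h Hh. apply hsum_correct; [exact Ha|].
    assert (Q := Re_plus_ge z0 h r Hh). lra.
Qed.

Lemma rpoch_geom_bound x q : (0 <= x)%R -> (0 <= q < 1)%R ->
  exists B, (0 <= B)%R /\ forall m, (Rsum (fun k => rpoch x k / INR (fact k) * q ^ k)%R m <= B)%R.
Proof.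
  intros Hx Hq. destruct (ex_series_rpoch x 1 q Hx Rle_0_1 Hq) as [B HB].
  assert (Hp : forall k, (0 <= rpoch x k / INR (fact k) * q ^ k)%R).
  { intros k. apply Rmult_le_pos; [|apply pow_le; lra].
    apply Rmult_le_pos; [now apply rpoch_pos|]. left. apply Rinv_0_lt_compat, INR_fact_lt_0. }
  assert (Hle : forall k, (rpoch x k / INR (fact k) * q ^ k
     <= rpoch x k / INR (fact k) * (1 + INR k) * q ^ k)%R).
  { intros k. specialize (Hp k). assert (P := pos_INR k). nra. }
  assert (Hp' : forall k, (0 <= rpoch x k / INR (fact k) * (1 + INR k) * q ^ k)%R)
    by (intros k; eapply Rle_trans; [apply Hp | apply Hle]).
  exists B. split.
  - eapply Rle_trans; [|apply (Rsum_le_series _ _ 0 Hp' HB)]. rewrite Rsum_O. apply Hp'.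
  - intros m. eapply Rle_trans; [|apply (Rsum_le_series _ _ m Hp' HB)].
    apply Rsum_le. intros k _. apply Hle.
Qed.

Lemma exp_mult_INR x k : exp (INR k * x) = (exp x ^ k)%R.
Proof.
  induction k as [|k IH]; [simpl; rewrite Rmult_0_l; apply exp_0|].
  rewrite S_INR, Rmult_plus_distr_r, exp_plus, IH, Rmult_1_l. simpl. ring.
Qed.

Lemma Cmod_div_R (z : C) (x : R) : (0 < x)%R -> Cmod (z / RtoC x) = (Cmod z / x)%R.
Proof.
  intros H. rewrite Cmod_div, Cmod_R, Rabs_pos_eq; [reflexivity | lra |].
  apply RtoC_neq_0. lra.
Qed.

(** Unlike the two Hurwitz series, their difference converges for all
    [Re s > 0]; this gain is what the continuation below iterates. *)
Lemma hsum_shift (a t s : C) : (Cmod t < Re a)%R -> (0 < Re s)%R -> exists D : C,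
  Cseries (fun n => Cpower (NtoC n + a - t) (- s) - Cpower (NtoC n + a) (- s)) D /\
  Cseries (fun k => poch s (S k) / NtoC (fact (S k)) * t ^ S k
                    * hsum a (s + NtoC (S k))) D.
Proof.
  intros Ht Hs. assert (Pt := Cmod_ge_0 t). assert (Ha : (0 < Re a)%R) by lra.
  set (alpha := Re a) in *.
  set (q := (Cmod t / alpha)%R).
  assert (Hq : (0 <= q < 1)%R) by (apply Rdiv_unit_interval; split; [exact Pt | exact Ht]).
  destruct (rpoch_geom_bound (Cmod s) q (Cmod_ge_0 s) Hq) as [B [HB0 HB]].
  set (E := exp (2 * Rabs (Im s))). assert (HE : (0 < E)%R) by apply exp_pos.
  (* Of the exponent [Re s + k + 1], the part [Re s + 1 > 1] is kept for the summation over [n]. The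
     other [k] units give [alpha^(-k)], which with [|t|^(k+1)] makes [alpha q^(k+1)]. *)
  set (A := fun n => (E * alpha * B * hb (Re s + 1) alpha n)%R).
  set (u := fun n k => poch s (S k) / NtoC (fact (S k)) * t ^ S k
                    * Cpower (NtoC n + a) (- (s + NtoC (S k)))).
  assert (Hu : forall n m, (Rsum (fun k => Cmod (u n k)) m <= A n)%R).
  { intros n m.
    assert (Hb := hb_pos (Re s + 1) alpha n).
    apply Rle_trans with (E * alpha * hb (Re s + 1) alpha n *
      Rsum (fun k => rpoch (Cmod s) (S k) / INR (fact (S k)) * q ^ S k)%R m)%R.
    - rewrite <- Rsum_mult_l. apply Rsum_le. intros k _. unfold u.
      rewrite !Cmod_mult, Cmod_div_R, Cmod_pow by apply INR_fact_lt_0.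
      assert (H1 : (Cmod (Cpower (NtoC n + a) (- (s + NtoC (S k))))
        <= E * (/ alpha ^ k * hb (Re s + 1) alpha n))%R).
      { eapply Rle_trans; [apply Cmod_hterm_le; [exact Ha|]|].
        - rewrite re_plus, re_RtoC. assert (P := pos_INR (S k)). lra.
        - rewrite im_plus, im_RtoC, Rplus_0_r. apply Rmult_le_compat_l; [lra|].
          rewrite re_plus, re_RtoC. fold alpha.
          eapply Rle_trans; [apply (hb_factor _ (Re s + 1)); [exact Ha|]|].
          + rewrite S_INR. assert (P := pos_INR k). lra.
          + apply Rmult_le_compat_r; [lra|]. apply Req_le.
            rewrite S_INR. replace (- (Re s + (INR k + 1) - (Re s + 1)) * ln alpha)%R
              with (- (INR k * ln alpha))%R by ring.
            rewrite exp_Ropp, exp_mult_INR, exp_ln by exact Ha. reflexivity. }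
      assert (H2 := Cmod_poch_le s (Cmod s) (S k) (Rle_refl _)).
      assert (Hf := Rinv_0_lt_compat _ (INR_fact_lt_0 (S k))).
      assert (Hk : (0 < alpha ^ k)%R) by now apply pow_lt.
      apply Rle_trans with (rpoch (Cmod s) (S k) / INR (fact (S k)) * Cmod t ^ S k
         * (E * (/ alpha ^ k * hb (Re s + 1) alpha n)))%R.
      + apply Rmult_le_compat; [| apply Cmod_ge_0 | | exact H1].
        * apply Rmult_le_pos; [|now apply pow_le]. apply Rmult_le_pos; [apply Cmod_ge_0 | lra].
        * apply Rmult_le_compat_r; [now apply pow_le|]. apply Rmult_le_compat_r; lra.
      + apply Req_le. unfold q. simpl pow. unfold Rdiv. rewrite !Rpow_mult_distr, pow_inv.
        field. repeat split; first [apply INR_fact_neq_0 | lra].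
    - unfold A.
      replace (E * alpha * B * hb (Re s + 1) alpha n)%R
        with (E * alpha * hb (Re s + 1) alpha n * B)%R by ring.
      apply Rmult_le_compat_l.
      + repeat apply Rmult_le_pos; lra.
      + eapply Rle_trans; [|apply (HB (S m))]. rewrite Rsum_shift.
        assert (0 <= rpoch (Cmod s) 0 / INR (fact 0) * q ^ 0)%R by (simpl; lra). lra. }
  assert (HA : ex_series A).
  { apply (@ex_series_scal R_AbsRing R_NormedModule). apply ex_series_hb; lra. }
  set (r := fun n => Cpower (NtoC n + a - t) (- s) - Cpower (NtoC n + a) (- s)).
  assert (Hr : forall n, Cseries (u n) (r n)).
  { intros n. apply (proj2 (Cseries_S (fun k => poch s k / NtoC (fact k) * t ^ k
                    * Cpower (NtoC n + a) (- (s + NtoC k))) _)).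
    replace (_ + r n) with (Cpower (NtoC n + a - t) (- s)).
    - apply binomial_series. rewrite Re_INR_plus. fold alpha. assert (P := pos_INR n). lra.
    - unfold r. simpl. replace (s + 0) with s by ring. field. }
  destruct (Cseries_abs r A) as [D HD].
  { intros n. now apply (Cseries_Cmod_le (u n)). }
  { exact HA. }
  exists D. split; [exact HD|].
  apply (Cseries_fubini u A r); auto.
  intros k. apply Cseries_mult_l. apply hsum_correct; [exact Ha|].
  rewrite re_plus, re_RtoC, S_INR. assert (P := pos_INR k). lra.
Qed.

(** * The entire function [(s - 1) zeta(s, a)] *)

(** Entireness is encoded as a majorised expansion on every disc, of any radius about any centre:
    this is the input that [wiener_series] requires. *)
Definition hurwitz_entire (a : C) (Z : C -> C) : Prop :=
  (forall s, (1 < Re s)%R -> Z s = (s - 1) * hsum a s) /\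
  (forall z0 r, (0 < r)%R -> exists M, wiener z0 r M Z).

Lemma wiener_poch z0 r M f k : (0 <= r)%R -> wiener z0 r M f ->
  wiener z0 r (rpoch (Cmod (z0 - 1) + r) k * M) (fun s => poch (s - 1) k * f s).
Proof.
  intros Hr Hf. induction k as [|k IH]; simpl.
  - apply wiener_ext with f; [intros; ring|]. rewrite Rmult_1_l. exact Hf.
  - assert (HM : (0 <= rpoch (Cmod (z0 - 1) + r) k * M)%R)
      by (destruct IH as [c Hc]; now apply (expansion_pos _ _ _ _ _ Hr Hc)).
    apply (wiener_mult_linear _ _ _ (- (1) + NtoC k) _ Hr) in IH.
    apply wiener_ext with (fun s => (s + (- (1) + NtoC k)) * (poch (s - 1) k * f s));
      [intros; ring|].
    refine (wiener_le _ _ _ _ _ _ IH).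
    replace (rpoch (Cmod (z0 - 1) + r) k * (Cmod (z0 - 1) + r + INR k) * M)%R
      with ((Cmod (z0 - 1) + r + INR k) * (rpoch (Cmod (z0 - 1) + r) k * M))%R by ring.
    apply Rmult_le_compat_r; [exact HM|].
    replace (z0 + (- (1) + NtoC k)) with ((z0 - 1) + NtoC k) by ring.
    assert (Q := Cmod_triangle (z0 - 1) (NtoC k)).
    rewrite Cmod_R, Rabs_pos_eq in Q by apply pos_INR. lra.
Qed.

(** Once [Re s + k > 1] the terms are governed by the Hurwitz series, whose
    size decays like [(Re a)^-k]. *)
Lemma wiener_poch_sum (a : C) (F : C -> C) (c : nat -> C) (q : R) (z0 : C) (r : R) :
  (0 <= q < Re a)%R -> (0 < r)%R ->
  (forall k, (Cmod (c k) <= q ^ k / INR (fact k))%R) ->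
  (forall s, (1 < Re s)%R -> F s = (s - 1) * hsum a s) ->
  (forall k, exists M, wiener z0 r M (fun s => c k * poch (s - 1) k * F (s + NtoC k))) ->
  exists M : nat -> R, ex_series M /\
    forall k, wiener z0 r (M k) (fun s => c k * poch (s - 1) k * F (s + NtoC k)).
Proof.
  intros Hq Hr Hc HF HM. assert (Ha : (0 < Re a)%R) by lra.
  set (alpha := Re a) in *. set (X := (Cmod (z0 - 1) + r)%R).
  assert (HX : (0 <= X)%R) by (unfold X; assert (P := Cmod_ge_0 (z0 - 1)); lra).
  (* Beyond [N] one has [Re s + k > 2] on the whole disc, so the Hurwitz series is available with
     [e = 2]. The finitely many earlier terms keep the bounds supplied by the hypothesis. *)
  destruct (INR_unbounded (2 + r - Re z0)) as [N HN].
  destruct (functional_choice _ HM) as [M0 HM0].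
  set (K := (hK a z0 r * exp (- (Re z0 - r - 2) * ln alpha) * Series (hb 2 alpha))%R).
  set (B := fun k => (K * (rpoch X k / INR (fact k) * (X + INR k) * (q / alpha) ^ k))%R).
  exists (fun k => if le_lt_dec (S N) k then B k else M0 k). split.
  - apply (@ex_series_incr_n R_AbsRing R_NormedModule _ (S N)).
    apply ex_series_ext with (fun k => B (S N + k)%nat).
    { intros k. destruct (le_lt_dec (S N) (S N + k)); [reflexivity | lia]. }
    apply (@ex_series_incr_n R_AbsRing R_NormedModule B (S N)).
    apply (@ex_series_scal R_AbsRing R_NormedModule), ex_series_rpoch; [exact HX | exact HX|].
    now apply Rdiv_unit_interval.
  - intros k. destruct (le_lt_dec (S N) k) as [Hk|Hk]; [|apply HM0].
    assert (Hk' : (2 < Re z0 + INR k - r)%R) by (apply le_INR in Hk; rewrite S_INR in Hk; lra).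
    apply wiener_ext with (fun s => c k * (poch (s - 1) k
       * ((s + (NtoC k - 1)) * hsum a (s + NtoC k)))).
    { intros h Hh. rewrite (HF (z0 + h + NtoC k)); [ring|].
      assert (Q := Re_plus_ge z0 h r Hh). rewrite (re_plus (z0 + h)), re_RtoC. lra. }
    assert (Hw : wiener (z0 + NtoC k) r
      (hK a z0 r * exp (- (Re z0 + INR k - r - 2) * ln alpha) * Series (hb 2 alpha)) (hsum a)).
    { assert (Hw := hsum_wiener a (z0 + NtoC k) r 2 Ha Hr).
      rewrite re_plus, re_RtoC in Hw. specialize (Hw ltac:(lra)).
      unfold hK in *. rewrite im_plus, im_RtoC, Rplus_0_r in Hw. exact Hw. }
    apply wiener_shift in Hw.
    assert (HwM : (0 <= hK a z0 r * exp (- (Re z0 + INR k - r - 2) * ln alpha) * Series (hb 2 alpha))%R)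
      by (destruct Hw as [d Hd]; refine (expansion_pos _ _ _ _ _ _ Hd); lra).
    apply (wiener_mult_linear _ _ _ (NtoC k - 1) _ (Rlt_le _ _ Hr)) in Hw.
    apply (wiener_poch _ _ _ _ k (Rlt_le _ _ Hr)) in Hw.
    apply (wiener_scal _ _ _ (c k)) in Hw.
    refine (wiener_le _ _ _ _ _ _ Hw).
    fold X. unfold B, K.
    assert (Hexp : exp (- (Re z0 + INR k - r - 2) * ln alpha)
      = (exp (- (Re z0 - r - 2) * ln alpha) * / alpha ^ k)%R).
    { replace (- (Re z0 + INR k - r - 2) * ln alpha)%R
        with (- (Re z0 - r - 2) * ln alpha + - (INR k * ln alpha))%R by ring.
      rewrite exp_plus, exp_Ropp, exp_mult_INR, exp_ln by exact Ha. reflexivity. }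
    rewrite Hexp in *.
    set (S2 := Series (hb 2 alpha)) in *. set (H0 := hK a z0 r) in *.
    set (E := exp (- (Re z0 - r - 2) * ln alpha)) in *.
    assert (Hx : (Cmod (z0 + (NtoC k - 1)) + r <= X + INR k)%R).
    { replace (z0 + (NtoC k - 1)) with ((z0 - 1) + NtoC k) by ring.
      assert (Q := Cmod_triangle (z0 - 1) (NtoC k)).
      rewrite Cmod_R, Rabs_pos_eq in Q by apply pos_INR. unfold X. lra. }
    assert (P := Cmod_ge_0 (z0 + (NtoC k - 1))).
    assert (Pr := rpoch_pos X k HX).
    apply Rle_trans with (q ^ k / INR (fact k) * (rpoch X k * ((X + INR k) * (H0 * (E * / alpha ^ k) * S2))))%R.
    + apply Rmult_le_compat; [apply Cmod_ge_0 | | apply Hc |].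
      * apply Rmult_le_pos; [exact Pr|]. apply Rmult_le_pos; [lra | exact HwM].
      * apply Rmult_le_compat_l; [exact Pr|]. apply Rmult_le_compat_r; [exact HwM | exact Hx].
    + apply Req_le. unfold Rdiv. rewrite Rpow_mult_distr, pow_inv. field.
      split; [apply pow_nonzero; lra | apply INR_fact_neq_0].
Qed.

Lemma wiener_sum_correct z0 r (M : nat -> R) (f : nat -> C -> C) h : (0 <= r)%R ->
  (forall k, wiener z0 r (M k) (f k)) -> ex_series M -> (Cmod h <= r)%R ->
  Cseries (fun k => f k (z0 + h)) (CSeries (fun k => f k (z0 + h))).
Proof.
  intros Hr Hf HM Hh. apply CSeries_correct.
  apply Cseries_abs with M; [|exact HM]. intros k. destruct (Hf k) as [c [H1 H2]].
  apply (Cseries_Cmod_le _ _ _ (expansion_abs r _ c h H1 Hh) (H2 h Hh)).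
Qed.

(** ** Existence *)

(** For [k >= 1] this is [(-1)^(k+1) / (k+1)!]; one factor of the rising factorial has been absorbed
    into [F(s + k)]. The value 0 at [k = 0] removes the term that is solved for, so only [F] at
    [s + 1], [s + 2] and so on is consulted. *)
Definition ext_coef (k : nat) : C :=
  match k with
  | O => 0
  | S j => (-1) ^ j / NtoC (fact (S k))
  end.

(** The shift formula for [zeta(s - 1, a + 1) - zeta(s - 1, a) = - a^(1-s)],
    solved for its leading term [(s - 1) zeta(s, a)]: if [F] is this function on
    [Re s > x], then [extend_strip a F] continues it to [Re s > x - 1]. *)
Definition extend_strip (a : C) (F : C -> C) (s : C) : C :=
  Cpower a (1 - s) + CSeries (fun k => ext_coef k * poch (s - 1) k * F (s + NtoC k)).

(** For [Re a > 1], stage [m] is the continuation on [Re s > 1 - m]; its values further left carry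
    no meaning. *)
Fixpoint strip (a : C) (m : nat) : C -> C :=
  match m with
  | O => fun s => (s - 1) * hsum a s
  | S j => extend_strip a (strip a j)
  end.

Lemma Cmod_m1_pow k : Cmod ((-1) ^ k) = 1%R.
Proof.
  rewrite Cmod_pow. replace (Cmod (-1)) with 1%R; [apply pow1|].
  rewrite Cmod_R, Rabs_left; lra.
Qed.

Lemma Cmod_ext_coef k : (Cmod (ext_coef k) <= 1 ^ k / INR (fact k))%R.
Proof.
  rewrite pow1. destruct k as [|k].
  - simpl. rewrite Cmod_0. lra.
  - unfold ext_coef. rewrite Cmod_div_R, Cmod_m1_pow by apply INR_fact_lt_0.
    apply Rmult_le_compat_l; [lra|]. apply Rinv_le_contravar; [apply INR_fact_lt_0|].
    apply le_INR, fact_le. lia.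
Qed.

Lemma poch_S_l s k : poch s (S k) = s * poch (s + 1) k.
Proof.
  induction k as [|k IH]; [simpl; ring|].
  change (poch s (S (S k))) with (poch s (S k) * (s + NtoC (S k))).
  rewrite IH, S_INR, RtoC_plus. simpl. ring.
Qed.

Lemma is_lim_hterm (a s : C) (eps : R) : (0 < Re a)%R -> (0 < Re s)%R -> (0 < eps)%R ->
  exists N, forall n, (N <= n)%nat -> (Cmod (Cpower (NtoC n + a) (- s)) < eps)%R.
Proof.
  intros Ha Hs He. set (E := exp (2 * Rabs (Im s))). assert (HE : (0 < E)%R) by apply exp_pos.
  destruct (INR_unbounded (exp (- ln (eps / E) / Re s))) as [N HN].
  exists N. intros n Hn. apply le_INR in Hn.
  eapply Rle_lt_trans; [apply Cmod_hterm_le; lra|]. fold E.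
  assert (Q := exp_pos (- ln (eps / E) / Re s)).
  apply Rlt_le_trans with (E * (eps / E))%R; [|apply Req_le; field; lra].
  apply Rmult_lt_compat_l; [exact HE|]. rewrite <- (exp_ln (eps / E)) by now apply Rdiv_lt_0_compat.
  apply exp_increasing.
  assert (L : (- ln (eps / E) / Re s < ln (INR n + Re a))%R).
  { rewrite <- (ln_exp (- ln (eps / E) / Re s)). apply ln_increasing; lra. }
  apply (Rmult_lt_compat_l (Re s)) in L; [|exact Hs].
  replace (Re s * (- ln (eps / E) / Re s))%R with (- ln (eps / E))%R in L by (field; lra). lra.
Qed.

(** Shifting [a] by 1 renumbers the terms, so the differences telescope. This needs only [Re s > 0],
    where the two Hurwitz series may diverge separately. *)
Lemma hterm_telescope (a s : C) : (0 < Re a)%R -> (0 < Re s)%R ->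
  Cseries (fun n => Cpower (NtoC n + a - -1) (- s) - Cpower (NtoC n + a) (- s))
          (- Cpower a (- s)).
Proof.
  intros Ha Hs. apply Cseries_eps. intros eps He.
  destruct (is_lim_hterm a s eps Ha Hs He) as [N HN].
  exists N. intros n Hn. specialize (HN (S n) ltac:(lia)).
  replace (Csum _ n - - Cpower a (- s)) with (Cpower (NtoC (S n) + a) (- s)); [exact HN|].
  assert (E : forall n, NtoC n + a - -1 = NtoC (S n) + a).
  { intros j. rewrite S_INR, RtoC_plus. ring. }
  clear HN Hn. induction n as [|n IH].
  - rewrite Csum_O, E. simpl (INR 0). replace (RtoC 0 + a) with a by ring. ring.
  - rewrite Csum_S, E.
    match goal with |- _ = ?S + ?x - ?y => replace (S + x - y) with ((S - y) + x) by ring end.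
    rewrite <- IH. ring.
Qed.

(** On the half plane of convergence, the shift formula with [t = -1] at [s - 1] returns the series
    itself. The condition [|t| < Re a] forces [Re a > 1] here. *)
Lemma strip_0_fixed (a s : C) : (1 < Re a)%R -> (1 < Re s)%R ->
  extend_strip a (strip a 0) s = strip a 0 s.
Proof.
  intros Ha Hs. destruct (hsum_shift a (-1) (s - 1)) as [D [H1 H2]].
  { rewrite Cmod_R, Rabs_left; lra. }
  { rewrite Re_minus. simpl. lra. }
  assert (HD := Cseries_unique _ _ _ H1 (hterm_telescope a (s - 1) ltac:(lra)
     ltac:(rewrite Re_minus; simpl; lra))).
  subst D. unfold extend_strip.
  replace (- (s - 1)) with (1 - s) in H2 by ring.
  assert (H3 : Cseries (fun k => ext_coef k * poch (s - 1) k * strip a 0 (s + NtoC k))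
     ((s - 1) * hsum a s - Cpower a (1 - s))).
  { replace ((s - 1) * hsum a s - Cpower a (1 - s)) with
      (ext_coef 0 * poch (s - 1) 0 * strip a 0 (s + NtoC 0)
       + ((s - 1) * hsum a s - Cpower a (1 - s))) by (unfold ext_coef; ring).
    apply (proj1 (Cseries_S (fun k => ext_coef k * poch (s - 1) k * strip a 0 (s + NtoC k)) _)).
    replace (- Cpower a (1 - s)) with (- (s - 1) * hsum a s + ((s - 1) * hsum a s - Cpower a (1 - s)))
      in H2 by ring.
    replace (- (s - 1) * hsum a s) with (poch (s - 1) 1 / NtoC (fact 1) * (-1) ^ 1
      * hsum a (s - 1 + NtoC 1)) in H2.
    - apply (proj2 (Cseries_S (fun k => poch (s - 1) (S k) / NtoC (fact (S k)) * (-1) ^ S k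
         * hsum a (s - 1 + NtoC (S k))) _)) in H2.
      revert H2. apply Cseries_ext. intros k.
      change (poch (s - 1) (S (S k))) with (poch (s - 1) (S k) * (s - 1 + NtoC (S k))).
      unfold ext_coef.
      change (strip a 0 (s + NtoC (S k)))
        with ((s + NtoC (S k) - 1) * hsum a (s + NtoC (S k))).
      replace (s - 1 + NtoC (S (S k))) with (s + NtoC (S k))
        by (rewrite (S_INR (S k)), RtoC_plus; ring).
      change ((-1) ^ S (S k)) with (-1 * (-1 * (-1) ^ k)). field.
      apply RtoC_neq_0, INR_fact_neq_0.
    - simpl. replace (s - 1 + 1) with s by ring. field. }
  rewrite (CSeries_eq _ _ H3). simpl. ring.
Qed.

Lemma CSeries_ext (u v : nat -> C) : (forall n, u n = v n) -> CSeries u = CSeries v.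
Proof.
  intros H. f_equal. apply FunctionalExtensionality.functional_extensionality, H.
Qed.

Lemma strip_S a m : (1 < Re a)%R -> forall s, (1 - INR m < Re s)%R -> strip a (S m) s = strip a m s.
Proof.
  intros Ha. induction m as [|m IH]; intros s Hs.
  - apply strip_0_fixed; [exact Ha|]. simpl in Hs. lra.
  - change (extend_strip a (strip a (S m)) s = extend_strip a (strip a m) s).
    unfold extend_strip. f_equal. apply CSeries_ext. intros [|k].
    + unfold ext_coef. ring.
    + f_equal. apply IH. rewrite re_plus, re_RtoC. rewrite S_INR in *.
      assert (P := pos_INR k). lra.
Qed.

Lemma strip_le a m m' s : (1 < Re a)%R -> (m <= m')%nat -> (1 - INR m < Re s)%R ->
  strip a m' s = strip a m s.
Proof.
  intros Ha Hm Hs. induction Hm as [|m' Hm IH]; [reflexivity|].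
  rewrite <- IH. apply strip_S; [exact Ha|]. apply le_INR in Hm. lra.
Qed.

Lemma strip_series a s : (1 < Re a)%R -> (1 < Re s)%R -> forall m, strip a m s = (s - 1) * hsum a s.
Proof. intros Ha Hs m. apply (strip_le a 0 m); [exact Ha | lia | simpl; lra]. Qed.

Lemma strip_wiener a m : (1 < Re a)%R -> forall z0 r, (0 < r)%R -> (1 - INR m < Re z0 - r)%R ->
  exists M, wiener z0 r M (strip a m).
Proof.
  intros Ha. induction m as [|m IH]; intros z0 r Hr Hz.
  - simpl in Hz.
    assert (H := hsum_wiener a z0 r (Re z0 - r) ltac:(lra) Hr ltac:(lra)).
    eexists. apply (wiener_mult_linear _ _ _ (- (1)) _ (Rlt_le _ _ Hr)) in H. exact H.
  - rewrite S_INR in Hz.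
    destruct (wiener_poch_sum a (strip a m) ext_coef 1 z0 r) as [M [HM HW]]; auto; [lra| | | |].
    { apply Cmod_ext_coef. }
    { intros s Hs. now apply strip_series. }
    { intros [|k].
      - exists (Cmod 0). apply wiener_ext with (fun _ => RtoC 0); [intros; unfold ext_coef; ring|].
        apply wiener_const.
      - destruct (IH (z0 + NtoC (S k)) r Hr) as [M HM].
        { rewrite re_plus, re_RtoC, S_INR. assert (P := pos_INR k). lra. }
        apply wiener_shift in HM. apply (wiener_poch _ _ _ _ (S k) (Rlt_le _ _ Hr)) in HM.
        apply (wiener_scal _ _ _ (ext_coef (S k))) in HM. eexists.
        eapply wiener_ext; [|exact HM]. intros h _. simpl. ring. }
    destruct (wiener_Cpower a (z0 - 1) r (Rlt_le _ _ Hr)) as [M1 H1].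
    apply wiener_shift in H1.
    eexists. simpl strip. unfold extend_strip. apply wiener_plus; [lra| |].
    + eapply wiener_ext; [|exact H1]. intros h _. simpl. f_equal. ring.
    + apply (wiener_series z0 r M (fun k s => ext_coef k * poch (s - 1) k * strip a m (s + NtoC k))
        _ Hr HW HM).
      intros h Hh.
      apply (wiener_sum_correct z0 r M (fun k s => ext_coef k * poch (s - 1) k * strip a m (s + NtoC k)));
        auto; lra.
Qed.

Lemma hurwitz_entire_exists_gt1 a : (1 < Re a)%R -> exists Z, hurwitz_entire a Z.
Proof.
  intros Ha.
  destruct (functional_choice _ (fun s => INR_unbounded (1 - Re s))) as [m Hm].
  (* Each [s] uses a stage that already reaches it. Different stages agree on overlaps, so on a
     given disc one sufficiently late stage represents the glued function. *)
  exists (fun s => strip a (m s) s). split.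
  - intros s Hs. now apply strip_series.
  - intros z0 r Hr. destruct (INR_unbounded (1 - Re z0 + r)) as [N HN].
    destruct (strip_wiener a N Ha z0 r Hr ltac:(lra)) as [M HM].
    exists M. apply wiener_ext with (strip a N); [|exact HM].
    intros h Hh. assert (Q := Re_plus_ge z0 h r Hh). specialize (Hm (z0 + h)).
    rewrite <- (strip_le a N (max N (m (z0 + h)))); [|exact Ha | lia | lra].
    apply strip_le; [exact Ha | lia | lra].
Qed.

Lemma hsum_S a s : (0 < Re a)%R -> (1 < Re s)%R -> hsum a s = Cpower a (- s) + hsum (a + 1) s.
Proof.
  intros Ha Hs. apply CSeries_eq.
  replace (Cpower a (- s)) with (Cpower (NtoC 0 + a) (- s)) by (f_equal; simpl; ring).
  apply (proj1 (Cseries_S (fun n => Cpower (NtoC n + a) (- s)) _)).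
  generalize (hsum_correct (a + 1) s ltac:(rewrite re_plus; simpl; lra) Hs).
  apply Cseries_ext. intros n. f_equal. rewrite S_INR, RtoC_plus. ring.
Qed.

Lemma wiener_Cpower_linear (w z0 : C) r : (0 <= r)%R ->
  exists M, wiener z0 r M (fun s => (s - 1) * Cpower w (- s)).
Proof.
  intros Hr. destruct (wiener_Cpower w z0 r Hr) as [M HM]. eexists.
  apply (wiener_mult_linear _ _ _ (- (1)) _ Hr) in HM. exact HM.
Qed.

(** Adding back the term [n = 0] brings the construction from [Re a > 1] to all of [Re a > 0]. *)
Lemma hurwitz_entire_S a Z : (0 < Re a)%R ->
  hurwitz_entire (a + 1) Z -> hurwitz_entire a (fun s => Z s + (s - 1) * Cpower a (- s)).
Proof.
  intros Ha [H1 H2]. split.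
  - intros s Hs. rewrite H1, (hsum_S a s) by assumption. ring.
  - intros z0 r Hr. destruct (H2 z0 r Hr) as [M HM].
    destruct (wiener_Cpower_linear a z0 r (Rlt_le _ _ Hr)) as [M' HM'].
    eexists. apply wiener_plus; [lra | exact HM | exact HM'].
Qed.

Lemma hurwitz_entire_exists a : (0 < Re a)%R -> exists Z, hurwitz_entire a Z.
Proof.
  intros Ha. destruct (hurwitz_entire_exists_gt1 (a + 1)) as [Z HZ].
  { rewrite re_plus. simpl. lra. }
  eexists. apply hurwitz_entire_S; eassumption.
Qed.

Lemma hurwitz_entire_opp a Z : (0 < Re a)%R ->
  hurwitz_entire a Z -> hurwitz_entire (a + 1) (fun s => Z s - (s - 1) * Cpower a (- s)).
Proof.
  intros Ha [H1 H2]. split.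
  - intros s Hs. rewrite H1, (hsum_S a s) by assumption. ring.
  - intros z0 r Hr. destruct (H2 z0 r Hr) as [M HM].
    destruct (wiener_Cpower_linear a z0 r (Rlt_le _ _ Hr)) as [M' HM'].
    apply (wiener_scal _ _ _ (- (1))) in HM'. eexists.
    eapply wiener_ext; [|apply wiener_plus; [apply (Rlt_le _ _ Hr) | exact HM | exact HM']].
    intros h _. simpl. ring.
Qed.

(** ** Uniqueness *)

(** One of the starting points [2] and [2 + i] works. If the segment from [2] meets 1, then [s] is
    real; the segment from [2 + i] then meets the real axis only at [s], which is not 1. *)
Lemma segment_avoids_1 (s : C) : s <> 1 -> exists w : C, (1 < Re w)%R /\
  forall x : R, (0 <= x <= 1)%R -> w + RtoC x * (s - w) <> 1.
Proof.
  intros Hs.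
  assert (Hw : forall b : R, (exists x : R, (0 <= x <= 1)%R /\ (2, b) + RtoC x * (s - (2, b)) = 1) ->
    exists x : R, (0 < x)%R /\ (2 + x * (Re s - 2) = 1)%R /\ (b + x * (Im s - b) = 0)%R).
  { intros b [x [Hx E]]. exists x.
    assert (E1 := f_equal Re E). assert (E2 := f_equal Im E).
    unfold Re, Im in *. simpl in E1, E2.
    assert (E1' : (2 + x * (fst s - 2) = 1)%R) by lra.
    split; [|split; [exact E1' | lra]].
    destruct (Rle_lt_or_eq_dec 0 x (proj1 Hx)) as [H|H]; [exact H|]. subst x. lra. }
  destruct (classic (exists x : R, (0 <= x <= 1)%R /\ (2, 0%R) + RtoC x * (s - (2, 0%R)) = 1)) as [H0|H0].
  2:{ exists (2, 0)%R. split; [simpl; lra|]. intros x Hx E. apply H0. now exists x. }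
  destruct (classic (exists x : R, (0 <= x <= 1)%R /\ (2, 1%R) + RtoC x * (s - (2, 1%R)) = 1)) as [H1|H1].
  2:{ exists (2, 1)%R. split; [simpl; lra|]. intros x Hx E. apply H1. now exists x. }
  exfalso. apply Hw in H0. apply Hw in H1.
  destruct H0 as [x [Hx [Hx1 Hx2]]]. destruct H1 as [y [Hy [Hy1 Hy2]]].
  assert (Him : Im s = 0%R).
  { apply Rmult_eq_reg_l with x; lra. }
  rewrite Him in Hy2. assert (y = 1%R) by lra. subst y.
  apply Hs. apply Ceq; simpl; unfold Re, Im in *; lra.
Qed.

Lemma zero_near_half_plane (f : C -> C) w : (1 < Re w)%R ->
  (forall s, (1 < Re s)%R -> f s = 0) -> zero_near f w.
Proof.
  intros Hw Hf. exists (Re w - 1)%R. split; [lra|]. intros h Hh. apply Hf.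
  assert (Q := Re_plus_ge w h _ (Rle_refl _)). lra.
Qed.

Lemma hurwitz_continuation_unique a F G (s : C) :
  is_hurwitz_continuation a F -> is_hurwitz_continuation a G -> s <> 1 -> F s = G s.
Proof.
  intros [F1 F2] [G1 G2] Hs. destruct (segment_avoids_1 s Hs) as [w [Hw Hseg]].
  apply Ceq_minus. replace s with (w + (s - w)) by ring.
  apply (identity_on_segment (fun z => F z - G z)).
  - intros x Hx. apply analytic_at_minus; [apply F2 | apply G2]; now apply Hseg.
  - apply zero_near_half_plane; [exact Hw|]. intros z Hz.
    rewrite (Cseries_unique _ _ _ (F1 z Hz) (G1 z Hz)). ring.
Qed.

Lemma hurwitz_entire_unique a Z Z' (s : C) : hurwitz_entire a Z -> hurwitz_entire a Z' -> Z s = Z' s.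
Proof.
  intros [H1 H2] [H1' H2']. apply Ceq_minus. replace s with (2 + (s - 2)) by ring.
  apply (identity_on_segment (fun z => Z z - Z' z)).
  - intros x _. destruct (H2 (2 + RtoC x * (s - 2)) 1%R Rlt_0_1) as [M HM].
    destruct (H2' (2 + RtoC x * (s - 2)) 1%R Rlt_0_1) as [M' HM'].
    apply analytic_at_minus; eapply wiener_analytic_at; try apply Rlt_0_1; eassumption.
  - apply zero_near_half_plane; [simpl; lra|]. intros z Hz. rewrite H1, H1' by exact Hz. ring.
Qed.

Lemma hurwitz_entire_continuation a Z : (0 < Re a)%R -> hurwitz_entire a Z ->
  is_hurwitz_continuation a (fun s => Z s / (s - 1)).
Proof.
  intros Ha [H1 H2]. split.
  - intros s Hs. rewrite H1 by exact Hs.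
    replace ((s - 1) * hsum a s / (s - 1)) with (hsum a s).
    + now apply hsum_correct.
    + field. intros E. apply (f_equal Re) in E. rewrite Re_minus in E.
      simpl in E. lra.
  - intros s Hs. assert (Hs1 : s + - (1) <> 0) by (apply Cminus_eq_contra, Hs).
    assert (P := proj1 (Cmod_gt_0 _) Hs1).
    destruct (H2 s (Cmod (s + - (1)) / 2)%R) as [M HM]; [lra|].
    apply (wiener_div_linear _ _ _ (- (1))) in HM; [|lra | exact Hs1 | lra].
    refine (wiener_analytic_at s _ _ _ _ HM). lra.
Qed.

Lemma hurwitz_zeta_entire a Z (s : C) : (0 < Re a)%R -> hurwitz_entire a Z -> s <> 1 ->
  hurwitz_zeta s a = Z s / (s - 1).
Proof.
  intros Ha HZ Hs. assert (HF := hurwitz_entire_continuation a Z Ha HZ).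
  apply (hurwitz_continuation_unique a (fun u => hurwitz_zeta u a) (fun u => Z u / (u - 1)));
    [|exact HF | exact Hs].
  unfold hurwitz_zeta.
  apply (epsilon_spec (inhabits (fun _ : C => RtoC 0)) (is_hurwitz_continuation a)).
  now exists (fun u => Z u / (u - 1)).
Qed.

(** ** Shifting the parameter *)

Definition shift_term (t : C) (Z : C -> C) (k : nat) (s : C) : C :=
  t ^ k / NtoC (fact k) * poch (s - 1) k * Z (s + NtoC k).

Definition shift_sum (t : C) (Z : C -> C) (s : C) : C := CSeries (fun k => shift_term t Z k s).

Lemma shift_wiener a t Z z0 r : (Cmod t < Re a)%R -> hurwitz_entire a Z -> (0 < r)%R ->
  exists M : nat -> R, ex_series M /\ forall k, wiener z0 r (M k) (shift_term t Z k).
Proof.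
  intros Ht [H1 H2] Hr. assert (P := Cmod_ge_0 t).
  apply (wiener_poch_sum a Z (fun k => t ^ k / NtoC (fact k)) (Cmod t)); auto.
  - intros k. rewrite Cmod_div_R, Cmod_pow by apply INR_fact_lt_0. apply Rle_refl.
  - intros k. destruct (H2 (z0 + NtoC k) r Hr) as [M HM].
    apply wiener_shift in HM. apply (wiener_poch _ _ _ _ k (Rlt_le _ _ Hr)) in HM.
    apply (wiener_scal _ _ _ (t ^ k / NtoC (fact k))) in HM. eexists.
    eapply wiener_ext; [|exact HM]. intros h _. simpl. ring.
Qed.

Lemma shift_sum_correct a t Z s : (Cmod t < Re a)%R -> hurwitz_entire a Z ->
  Cseries (fun k => shift_term t Z k s) (shift_sum t Z s).
Proof.
  intros Ht HZ. destruct (shift_wiener a t Z s 1 Ht HZ Rlt_0_1) as [M [HM HW]].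
  assert (H := wiener_sum_correct s 1 M (shift_term t Z) 0 ltac:(lra) HW HM
    ltac:(rewrite Cmod_0; lra)).
  replace (s + 0) with s in H by ring. exact H.
Qed.

Lemma shift_sum_Cderiv a t Z z0 (d : nat -> C) : (Cmod t < Re a)%R -> hurwitz_entire a Z ->
  (forall k, Cderiv (shift_term t Z k) z0 (d k)) ->
  exists D : C, Cseries d D /\ Cderiv (shift_sum t Z) z0 D.
Proof.
  intros Ht HZ Hd. destruct (shift_wiener a t Z z0 1 Ht HZ Rlt_0_1) as [M [HM HW]].
  apply (wiener_series z0 1 M (shift_term t Z) (shift_sum t Z) Rlt_0_1 HW HM); [|exact Hd].
  intros h _. now apply (shift_sum_correct a).
Qed.

(** For [Re s > 1] multiply the difference formula [hsum_shift] by [s - 1]: the product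
    [(s - 1) (s)_(k+1)] equals [(s - 1)_(k+1) (s + k)], and [s + k] is the factor that turns the
    Hurwitz series at [s + k + 1] into [Z]. *)
Lemma hurwitz_entire_shift a t Z : (Cmod t < Re a)%R -> hurwitz_entire a Z ->
  hurwitz_entire (a - t) (shift_sum t Z).
Proof.
  intros Ht HZ. assert (P := Cmod_ge_0 t). split.
  - intros s Hs. apply CSeries_eq. destruct HZ as [HZ _].
    destruct (hsum_shift a t s Ht ltac:(lra)) as [D [H1 H2]].
    assert (Hat : (0 < Re (a - t))%R).
    { rewrite Re_minus. assert (Q := Re_le_Cmod t). lra. }
    assert (HD : D = hsum (a - t) s - hsum a s).
    { apply (Cseries_unique _ _ _ H1).
      generalize (Cseries_minus _ _ _ _ (hsum_correct (a - t) s Hat Hs)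
        (hsum_correct a s ltac:(lra) Hs)).
      apply Cseries_ext. intros n. do 2 f_equal. ring. }
    replace ((s - 1) * hsum (a - t) s) with (shift_term t Z 0 s + (s - 1) * D).
    + apply (proj1 (Cseries_S (fun k => shift_term t Z k s) _)).
      apply (Cseries_mult_l (s - 1)) in H2. revert H2. apply Cseries_ext. intros k.
      unfold shift_term. rewrite HZ.
      * rewrite (poch_S_l (s - 1)). replace (s - 1 + 1) with s by ring.
        change (poch s (S k)) with (poch s k * (s + NtoC k)).
        rewrite S_INR, RtoC_plus. field. apply RtoC_neq_0, INR_fact_neq_0.
      * rewrite re_plus, re_RtoC, S_INR. assert (Q := pos_INR k). lra.
    + rewrite HD. unfold shift_term. simpl (INR 0). rewrite HZ by (rewrite re_plus; simpl; lra).
      simpl. replace (s + 0) with s by ring. field.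
  - intros z0 r Hr. destruct (shift_wiener a t Z z0 r Ht HZ Hr) as [M [HM HW]].
    eexists. apply (wiener_series z0 r M (shift_term t Z) (shift_sum t Z) Hr HW HM).
    intros h _. now apply (shift_sum_correct a).
Qed.

(** * The derivative at [s = 1] *)

Lemma Cderiv_ext (f g : C -> C) z l : (forall s, f s = g s) -> Cderiv f z l -> Cderiv g z l.
Proof. intros H. apply (Cderiv_local_ext f g z l 1 Rlt_0_1). intros; apply H. Qed.

Lemma Cderiv_shift (f : C -> C) (z c l : C) : Cderiv f (z + c) l -> Cderiv (fun s => f (s + c)) z l.
Proof.
  intros H eps He. destruct (H eps He) as [d [Hd H']]. exists d. split; [exact Hd|].
  intros h Hh. replace (z + h + c) with (z + c + h) by ring. now apply H'.
Qed.

Lemma Cderiv_scal (a : C) f z l : Cderiv f z l -> Cderiv (fun s => a * f s) z (a * l).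
Proof.
  intros H. replace (a * l) with (0 * f z + a * l) by ring.
  apply (Cderiv_mult (fun _ => a)); [apply Cderiv_const | exact H].
Qed.

(** At a simple zero the derivative is the value of the cofactor. For [h] mere differentiability is
    enough; the value of [l] drops out. *)
Lemma Cderiv_zero_factor (h : C -> C) (z0 l : C) :
  Cderiv h z0 l -> Cderiv (fun s => (s - z0) * h s) z0 (h z0).
Proof.
  intros H. replace (h z0) with (1 * h z0 + (z0 - z0) * l) by ring.
  apply (Cderiv_mult (fun s => s - z0)); [apply (Cderiv_id (- z0)) | exact H].
Qed.

(** Existence is all that is wanted: these factors occur next to a vanishing one, where
    [Cderiv_zero_factor] applies. *)
Lemma poch_ex_Cderiv (c z : C) k : exists l, Cderiv (fun s => poch (s + c) k) z l.
Proof.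
  induction k as [|k [l IH]].
  - exists 0. simpl. apply Cderiv_const.
  - eexists. apply (Cderiv_ext (fun s => poch (s + c) k * (s + (c + NtoC k)))).
    + intros s. simpl. ring.
    + apply (Cderiv_mult (fun s => poch (s + c) k)); [exact IH | apply Cderiv_id].
Qed.

Lemma poch_add s m j : poch s (m + j) = poch s m * poch (s + NtoC m) j.
Proof.
  induction j as [|j IH].
  - rewrite Nat.add_0_r. simpl. ring.
  - rewrite Nat.add_succ_r. simpl. rewrite IH, plus_INR, RtoC_plus. ring.
Qed.

Lemma poch_1 j : poch 1 j = NtoC (fact j).
Proof.
  induction j as [|j IH]; [reflexivity|].
  rewrite fact_simpl, mult_INR, RtoC_mult, S_INR, RtoC_plus. simpl. rewrite IH. ring.
Qed.

Lemma hurwitz_entire_Cderiv a Z z : hurwitz_entire a Z -> exists d, Cderiv Z z d.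
Proof.
  intros [_ H]. destruct (H z 1%R Rlt_0_1) as [M HM].
  exact (wiener_Cderiv z 1 M Z Rlt_0_1 HM).
Qed.

Lemma shift_term_zero t Z k s : (2 <= k)%nat -> s = 0 -> shift_term t Z k s = 0.
Proof.
  intros Hk ->. destruct k as [|[|j]]; try lia. unfold shift_term.
  rewrite !poch_S_l. replace (0 - 1 + 1) with (RtoC 0) by ring. ring.
Qed.

(** Both sides continue [(s - 1) zeta(s, a + 1)]: one by the shift formula with [t = -1], the other
    by removing the first term of the series. *)
Lemma shift_minus_1 a Z s : (1 < Re a)%R -> hurwitz_entire a Z ->
  shift_sum (-1) Z s = Z s - (s - 1) * Cpower a (- s).
Proof.
  intros Ha HZ. apply (hurwitz_entire_unique (a + 1) (shift_sum (-1) Z) (fun s => Z s - (s - 1) * Cpower a (- s))).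
  - replace (a + 1) with (a - -1) by ring. apply hurwitz_entire_shift; [|exact HZ].
    rewrite Cmod_R, Rabs_left; lra.
  - apply hurwitz_entire_opp; [lra | exact HZ].
Qed.

(** Evaluate [shift_minus_1] at [s = 0]: from [k = 2] on the rising factorial contains the factor
    [s] and vanishes, so the left side is [Z 0 + Z 1], while the right side is [Z 0 + 1]. *)
Lemma hurwitz_entire_1_large a Z : (1 < Re a)%R -> hurwitz_entire a Z -> Z 1 = 1.
Proof.
  intros Ha HZ.
  assert (H : Cseries (fun k => shift_term (-1) Z k 0) (shift_sum (-1) Z 0)).
  { apply (shift_sum_correct a); [rewrite Cmod_R, Rabs_left; lra | exact HZ]. }
  rewrite (shift_minus_1 a Z 0 Ha HZ) in H.
  assert (E : Z 0 - (0 - 1) * Cpower a (- 0) = Z 0 + Z 1).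
  { apply (Cseries_unique _ _ _ H).
    replace (Z 0) with (shift_term (-1) Z 0 0).
    2:{ unfold shift_term. simpl. replace (0 + 0) with (RtoC 0) by ring. field. }
    apply (proj1 (Cseries_S (fun k => shift_term (-1) Z k 0) _)).
    replace (Z 1) with (shift_term (-1) Z 1 0).
    2:{ unfold shift_term. simpl. replace (0 + 1) with (RtoC 1) by ring. field. }
    apply (Cseries_O (fun k => shift_term (-1) Z (S k) 0)).
    intros n. apply shift_term_zero; [lia | reflexivity]. }
  replace (- 0) with (RtoC 0) in E by ring. rewrite Cpower_0 in E.
  replace (Z 1) with ((Z 0 + Z 1) - Z 0) by ring. rewrite <- E. ring.
Qed.

Lemma hurwitz_entire_1 a Z : (0 < Re a)%R -> hurwitz_entire a Z -> Z 1 = 1.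
Proof.
  intros Ha HZ.
  assert (H := hurwitz_entire_1_large (a + 1) _ ltac:(rewrite re_plus; simpl; lra)
     (hurwitz_entire_opp a Z Ha HZ)).
  simpl in H. rewrite <- H at 2. ring.
Qed.

Lemma Rsum_hb_2_le alpha n : (1 <= alpha)%R -> (Rsum (hb 2 alpha) n <= 2 / alpha)%R.
Proof.
  intros Ha.
  assert (H : (Rsum (hb 2 alpha) n <= hb 2 alpha 0 + hb 1 alpha 0 - hb 1 alpha n)%R).
  { induction n as [|n IH]; [rewrite Rsum_O; lra|]. rewrite Rsum_S.
    assert (Q := hb_telescope 2 alpha n ltac:(lra) ltac:(lra)).
    replace (2 - 1)%R with 1%R in Q by ring. lra. }
  assert (Q := hb_pos 1 alpha n).
  assert (E1 : hb 1 alpha 0 = (/ alpha)%R).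
  { unfold hb. simpl. rewrite Rplus_0_l. replace (- (1) * ln alpha)%R with (- ln alpha)%R by ring.
    rewrite exp_Ropp, exp_ln; lra. }
  assert (E2 : hb 2 alpha 0 = (/ alpha * / alpha)%R).
  { rewrite <- E1. unfold hb. rewrite <- exp_plus. f_equal. ring. }
  rewrite E1, E2 in H.
  assert (I : (0 < / alpha <= 1)%R).
  { split; [apply Rinv_0_lt_compat; lra|]. rewrite <- Rinv_1. apply Rinv_le_contravar; lra. }
  unfold Rdiv. nra.
Qed.

(** The exponent 2 is kept for the sum over [n], at most [2 / Re a]; each of the other [k] units
    gains [1 / Re a <= 1 / 2]. *)
Lemma Cmod_hsum_le a k : (2 <= Re a)%R ->
  (Cmod (hsum a (NtoC (k + 2))) <= (/ 2) ^ k * (2 / Re a))%R.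
Proof.
  intros Ha. assert (P := pos_INR k).
  assert (E : Re (NtoC (k + 2)) = (INR k + 2)%R) by (rewrite re_RtoC, plus_INR; reflexivity).
  apply (Cseries_Cmod_le (fun n => Cpower (NtoC n + a) (- NtoC (k + 2))));
    [|apply hsum_correct; lra].
  intros m. apply Rle_trans with (Rsum (fun n => (/ 2) ^ k * hb 2 (Re a) n)%R m).
  - apply Rsum_le. intros n _.
    eapply Rle_trans; [apply Cmod_hterm_le; lra|].
    rewrite im_RtoC, Rabs_R0, Rmult_0_r, exp_0, Rmult_1_l, E.
    eapply Rle_trans; [apply (hb_factor _ 2); lra|].
    apply Rmult_le_compat_r; [left; apply hb_pos|].
    replace (- (INR k + 2 - 2) * ln (Re a))%R with (- (INR k * ln (Re a)))%R by ring.
    rewrite exp_Ropp, exp_mult_INR, exp_ln by lra. rewrite <- pow_inv.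
    apply pow_incr. split; [left; apply Rinv_0_lt_compat; lra|]. apply Rinv_le_contravar; lra.
  - rewrite Rsum_mult_l. apply Rmult_le_compat_l; [apply pow_le; lra|].
    apply Rsum_hb_2_le. lra.
Qed.

Lemma fact_SS_le k : (INR (fact k) * (INR k + 1) <= INR (fact (S (S k))))%R.
Proof.
  rewrite (fact_simpl (S k)), fact_simpl, !mult_INR, !S_INR.
  assert (P := pos_INR k). assert (Q := INR_fact_lt_0 k).
  assert (0 <= INR (fact k) * (INR k + 1))%R by (apply Rmult_le_pos; lra). nra.
Qed.

(** Differentiate [shift_minus_1] at [s = 0]. The derivative of [Z] at 0 cancels, the term [k = 1]
    brings in [d], the right side brings in [Clog a], and the terms [k >= 2] form an error of size
    [2^(-k) / Re a] up to constants. *)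
Lemma hurwitz_deriv_1_asymptotic a Z d : (2 <= Re a)%R -> hurwitz_entire a Z -> Cderiv Z 1 d ->
  (Cmod (d + Clog a) <= 4 / Re a)%R.
Proof.
  intros Ha HZ Hd. assert (Ha1 : (1 < Re a)%R) by lra.
  assert (HZ1 := hurwitz_entire_1_large a Z Ha1 HZ).
  destruct (hurwitz_entire_Cderiv a Z 0 HZ) as [d0 Hd0].
  (* Derivatives of the terms at 0. For [k >= 2] the rising factorial has a simple zero there, so
     only the cofactor is evaluated. *)
  set (e := fun k => match k with
    | O => d0
    | S O => -1 + d
    | S (S j) => - ((-1) ^ j * (NtoC (fact j) / NtoC (fact k) * Z (NtoC k)))
    end).
  assert (He : forall k, Cderiv (shift_term (-1) Z k) 0 (e k)).
  { intros [|[|j]].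
    - apply (Cderiv_ext Z); [|exact Hd0]. intros s. unfold shift_term. simpl.
      replace (s + 0) with s by ring. field.
    - apply (Cderiv_ext (fun s => -1 * ((s + - (1)) * Z (s + 1)))).
      + intros s. unfold shift_term. simpl. field.
      + replace (e 1%nat) with (-1 * (1 * Z (0 + 1) + (0 + - (1)) * d)).
        2:{ unfold e. replace (0 + 1) with (RtoC 1) by ring. rewrite HZ1. ring. }
        apply Cderiv_scal, (Cderiv_mult (fun s => s + - (1)) (fun s => Z (s + 1))); [apply Cderiv_id|].
        apply Cderiv_shift. replace (0 + 1) with (RtoC 1) by ring. exact Hd.
    - set (K := S (S j)).
      set (h := fun s => (-1) ^ K / NtoC (fact K) * ((s + - (1)) * (poch (s + 1) j * Z (s + NtoC K)))).
      apply (Cderiv_ext (fun s => (s - 0) * h s)).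
      + intros s. unfold shift_term, h, K. rewrite !poch_S_l.
        replace (s - 1 + 1) with s by ring. unfold Cminus. ring.
      + replace (e K) with (h 0).
        2:{ unfold h, e, K. replace (0 + 1) with (RtoC 1) by ring. rewrite poch_1.
            replace (0 + NtoC (S (S j))) with (NtoC (S (S j))) by ring.
            simpl Cpow. unfold Cdiv. ring. }
        destruct (poch_ex_Cderiv 1 0 j) as [l1 H1].
        destruct (hurwitz_entire_Cderiv a Z (0 + NtoC K) HZ) as [l2 H2].
        apply Cderiv_shift in H2.
        assert (H3 := Cderiv_mult _ _ _ _ _ H1 H2).
        assert (H4 := Cderiv_mult _ _ _ _ _ (Cderiv_id (- (1)) 0) H3).
        apply (Cderiv_scal ((-1) ^ K / NtoC (fact K))) in H4.
        exact (Cderiv_zero_factor h 0 _ H4). }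
  destruct (shift_sum_Cderiv a (-1) Z 0 e) as [D [HD1 HD2]];
    [rewrite Cmod_R, Rabs_left; lra | exact HZ | exact He |].
  assert (HD : D = d0 - 1 - Clog a).
  { apply (Cderiv_unique (shift_sum (-1) Z) 0); [exact HD2|].
    apply (Cderiv_ext (fun s => Z s + -1 * ((s + - (1)) * Cpower a (- s)))).
    { intros s. rewrite (shift_minus_1 a Z s Ha1 HZ). ring. }
    replace (d0 - 1 - Clog a) with
      (d0 + -1 * (1 * Cpower a (- 0) + (0 + - (1)) * (- Clog a * Cpower a (- 0)))).
    - apply Cderiv_plus; [exact Hd0|].
      apply Cderiv_scal, (Cderiv_mult (fun s => s + - (1)) (fun s => Cpower a (- s)));
        [apply Cderiv_id | apply Cderiv_Cpower_neg].
    - replace (- 0) with (RtoC 0) by ring. rewrite Cpower_0. ring. }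
  rewrite HD in HD1.
  apply Cseries_SS in HD1.
  replace (d0 - 1 - Clog a - e 0%nat - e 1%nat) with (- (d + Clog a)) in HD1 by (unfold e; ring).
  rewrite <- Cmod_opp. revert HD1. apply Cseries_Cmod_le. intros n.
  apply Rle_trans with (Rsum (fun k => 2 / Re a * (/ 2) ^ k)%R n).
  - apply Rsum_le. intros k _. unfold e.
    rewrite Cmod_opp, Cmod_mult, Cmod_m1_pow, Rmult_1_l, Cmod_mult.
    rewrite Cmod_div_R, Cmod_R, Rabs_pos_eq by (apply INR_fact_lt_0 || apply pos_INR).
    destruct HZ as [HZ _]. rewrite HZ by (rewrite re_RtoC, !S_INR; assert (P := pos_INR k); lra).
    rewrite Cmod_mult.
    replace (NtoC (S (S k)) - 1) with (RtoC (INR k + 1))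
      by (rewrite !S_INR, !RtoC_plus; ring).
    rewrite Cmod_R, Rabs_pos_eq by (assert (P := pos_INR k); lra).
    assert (Hb := Cmod_hsum_le a k Ha). replace (k + 2)%nat with (S (S k)) in Hb by lia.
    assert (Hf := fact_SS_le k). assert (F := INR_fact_lt_0 (S (S k))).
    assert (Hq : (INR (fact k) / INR (fact (S (S k))) * (INR k + 1) <= 1)%R).
    { apply Rmult_le_reg_r with (INR (fact (S (S k)))); [exact F|].
      replace (INR (fact k) / INR (fact (S (S k))) * (INR k + 1) * INR (fact (S (S k))))%R
        with (INR (fact k) * (INR k + 1))%R by (field; lra). lra. }
    rewrite <- Rmult_assoc. rewrite (Rmult_comm (2 / Re a)).
    rewrite <- (Rmult_1_l ((/ 2) ^ k * (2 / Re a))).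
    apply Rmult_le_compat; [|apply Cmod_ge_0 | exact Hq | exact Hb].
    apply Rmult_le_pos; [|assert (P := pos_INR k); lra].
    apply Rmult_le_pos; [apply pos_INR | left; now apply Rinv_0_lt_compat].
  - rewrite Rsum_mult_l. replace (4 / Re a)%R with (2 / Re a * 2)%R by (field; lra).
    apply Rmult_le_compat_l; [|apply Rsum_geom_half].
    apply Rmult_le_pos; [lra|]. left. apply Rinv_0_lt_compat. lra.
Qed.

(** The logarithmic derivative of [poch] in its first argument. It serves twice: for the growth of
    [digamma] along integer steps, and at [a = -n] for the derivative of the rising factorial. *)
Fixpoint shifted_harmonic (a : C) (N : nat) : C :=
  match N with
  | O => 0
  | S n => shifted_harmonic a n + / (a + NtoC n)
  end.

(** Removing the first [N] terms subtracts functions [(s - 1) (a + k)^(-s)], whose derivative at 1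
    is [1 / (a + k)]. *)
Lemma hurwitz_deriv_1_shift a Z d N : (0 < Re a)%R -> hurwitz_entire a Z -> Cderiv Z 1 d ->
  exists Z', hurwitz_entire (a + NtoC N) Z' /\ Cderiv Z' 1 (d - shifted_harmonic a N).
Proof.
  intros Ha HZ Hd. induction N as [|N [Z' [H1 H2]]].
  - exists Z. simpl. replace (a + 0) with a by ring. replace (d - 0) with d by ring. now split.
  - set (b := a + NtoC N) in *.
    assert (Hb : (0 < Re b)%R) by now apply Re_add_INR_pos.
    exists (fun s => Z' s - (s - 1) * Cpower b (- s)). split.
    + replace (a + NtoC (S N)) with (b + 1) by (unfold b; rewrite S_INR, RtoC_plus; ring).
      now apply hurwitz_entire_opp.
    + apply (Cderiv_ext (fun s => Z' s + -1 * ((s - 1) * Cpower b (- s)))); [intros; ring|].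
      replace (d - shifted_harmonic a (S N)) with (d - shifted_harmonic a N + -1 * Cpower b (- (1))).
      * apply Cderiv_plus; [exact H2|]. apply Cderiv_scal.
        exact (Cderiv_zero_factor (fun s => Cpower b (- s)) 1 _ (Cderiv_Cpower_neg b 1)).
      * simpl. fold b. unfold Cpower. replace (- (1) * Clog b) with (- Clog b) by ring.
        rewrite Cexp_opp, Cexp_Clog by exact Hb. ring.
Qed.

Lemma Rabs_atan_le x : (Rabs (atan x) <= Rabs x)%R.
Proof.
  assert (H : forall x, (0 <= x)%R -> (atan x <= x)%R).
  { intros y Hy. destruct (MVT_gen atan 0 y (fun t => / (1 + Rsqr t))%R) as [c [_ Hc]].
    - intros; apply is_derive_atan.
    - intros t _. apply derivable_continuous_pt, derivable_pt_atan.
    - rewrite atan_0, !Rminus_0_r in Hc. rewrite Hc.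
      assert (Q := Rle_0_sqr c).
      assert (/ (1 + Rsqr c) <= 1)%R by (rewrite <- Rinv_1; apply Rinv_le_contravar; lra).
      nra. }
  assert (H0 : forall x, (0 <= x)%R -> (0 <= atan x)%R).
  { intros y [Hy| <-]; [|rewrite atan_0; lra]. rewrite <- atan_0. left. now apply atan_increasing. }
  destruct (Rle_dec 0 x) as [Hx|Hx].
  - rewrite !Rabs_pos_eq; auto.
  - rewrite <- (Rabs_Ropp x), <- (Rabs_Ropp (atan x)), <- atan_opp.
    rewrite !Rabs_pos_eq; try lra; [apply H | apply H0]; lra.
Qed.

Lemma Clog_add_INR_le a N : (0 < Re a)%R -> (0 < N)%nat ->
  (Cmod (Clog (a + NtoC N) - RtoC (ln (INR N))) <= 2 * Cmod a / INR N)%R.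
Proof.
  intros Ha HN. apply lt_INR in HN. simpl in HN. set (n := INR N) in *.
  set (b := a + RtoC n). assert (Hb : Re b = (Re a + n)%R) by (unfold b; now rewrite re_plus).
  assert (Ib : Im b = Im a) by (unfold b; rewrite im_plus, im_RtoC; ring).
  assert (Hbm := Re_le_Cmod b). assert (Hbm2 := Cmod_triangle a (RtoC n)).
  rewrite Cmod_R, Rabs_pos_eq in Hbm2 by lra. fold b in Hbm2.
  rewrite Clog_half_plane by lra.
  eapply Rle_trans; [apply Cmod_le_Rabs|].
  assert (E1 : Re ((ln (Cmod b), atan (Im b / Re b)) - RtoC (ln n)) = (ln (Cmod b) - ln n)%R) by reflexivity.
  assert (E2 : Im ((ln (Cmod b), atan (Im b / Re b)) - RtoC (ln n)) = atan (Im b / Re b))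
    by (unfold Im at 1; simpl; ring).
  rewrite E1, E2.
  assert (B1 : (Rabs (ln (Cmod b) - ln n) <= Cmod a / n)%R).
  { rewrite Rabs_pos_eq.
    - replace (ln (Cmod b) - ln n)%R with (ln (Cmod b * / n)).
      + assert (Q := ln_le_sub_1 (Cmod b * / n)).
        eapply Rle_trans; [apply Q; apply Rmult_lt_0_compat; [lra | now apply Rinv_0_lt_compat]|].
        replace (Cmod a / n)%R with ((Cmod a + n) * / n - 1)%R by (field; lra).
        apply Rplus_le_compat_r, Rmult_le_compat_r; [left; now apply Rinv_0_lt_compat | exact Hbm2].
      + rewrite ln_mult, ln_Rinv; [ring | lra | lra | now apply Rinv_0_lt_compat].
    - assert (L := ln_le_mono n (Cmod b) HN ltac:(lra)). lra. }
  assert (B2 : (Rabs (atan (Im b / Re b)) <= Cmod a / n)%R).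
  { eapply Rle_trans; [apply Rabs_atan_le|]. unfold Rdiv. rewrite Rabs_mult, Ib.
    rewrite (Rabs_pos_eq (/ Re b)) by (left; apply Rinv_0_lt_compat; lra).
    apply Rmult_le_compat; [apply Rabs_pos | left; apply Rinv_0_lt_compat; lra | apply Im_Rabs |].
    apply Rinv_le_contravar; lra. }
  replace (2 * Cmod a / n)%R with (Cmod a / n + Cmod a / n)%R by (field; lra). lra.
Qed.

Lemma hurwitz_deriv_1_limit a Z d eps : (0 < Re a)%R -> hurwitz_entire a Z -> Cderiv Z 1 d ->
  (0 < eps)%R -> exists N0, forall N, (N0 <= N)%nat ->
    (Cmod (d - shifted_harmonic a N + RtoC (ln (INR N))) < eps)%R.
Proof.
  intros Ha HZ Hd He. assert (P := Cmod_ge_0 a).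
  (* The error is at most [(4 + 2 |a|) / N]: the 4 comes from [hurwitz_deriv_1_asymptotic], the rest
     from replacing [Clog (a + N)] by [ln N]. The extra 2 ensures [Re (a + N) >= 2]. *)
  destruct (INR_unbounded ((4 + 2 * Cmod a) / eps + 2)) as [N0 HN0].
  exists N0. intros N HN. apply le_INR in HN.
  assert (Hq : (0 <= (4 + 2 * Cmod a) / eps)%R)
    by (apply Rmult_le_pos; [lra | left; now apply Rinv_0_lt_compat]).
  destruct (hurwitz_deriv_1_shift a Z d N Ha HZ Hd) as [Z' [H1 H2]].
  assert (HNpos : (0 < N)%nat) by (apply INR_lt; simpl; lra).
  assert (E : Re (a + NtoC N) = (Re a + INR N)%R) by reflexivity.
  assert (B1 := hurwitz_deriv_1_asymptotic (a + NtoC N) _ _ ltac:(lra) H1 H2). rewrite E in B1.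
  assert (B2 := Clog_add_INR_le a N Ha HNpos).
  replace (d - shifted_harmonic a N + RtoC (ln (INR N))) with
    ((d - shifted_harmonic a N + Clog (a + NtoC N))
     + - (Clog (a + NtoC N) - RtoC (ln (INR N)))) by ring.
  eapply Rle_lt_trans; [apply Cmod_triangle|]. rewrite Cmod_opp.
  apply Rle_lt_trans with ((4 + 2 * Cmod a) / INR N)%R.
  - replace ((4 + 2 * Cmod a) / INR N)%R with (4 / INR N + 2 * Cmod a / INR N)%R by (field; lra).
    apply Rplus_le_compat; [|exact B2]. eapply Rle_trans; [exact B1|].
    apply Rmult_le_compat_l; [lra|]. apply Rinv_le_contravar; lra.
  - apply Rmult_lt_reg_r with (INR N / eps)%R; [apply Rdiv_lt_0_compat; lra|].
    replace ((4 + 2 * Cmod a) / INR N * (INR N / eps))%R with ((4 + 2 * Cmod a) / eps)%R by (field; lra).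
    replace (eps * (INR N / eps))%R with (INR N) by (field; lra). lra.
Qed.

(** * Improper integrals over the half line *)

Local Notation CRInt := (@is_RInt C_R_NormedModule).

Definition gint (f : R -> C) (l : C) : Prop :=
  @is_RInt_gen C_R_NormedModule f (at_right 0) (Rbar_locally p_infty) l.

Lemma norm_C (z : C) : @norm R_AbsRing C_R_NormedModule z = Cmod z.
Proof.
  change (sqrt (Rabs (fst z) ^ 2 + Rabs (snd z) ^ 2) = sqrt (fst z ^ 2 + snd z ^ 2))%R.
  now rewrite !pow2_abs.
Qed.

Lemma half_line_eventually (P : R * R -> Prop) (d B : R) : (0 < d)%R ->
  (forall a b, (0 < a < d)%R -> (B < b)%R -> P (a, b)) ->
  filter_prod (at_right 0) (Rbar_locally p_infty) P.
Proof.
  intros Hd H.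
  apply (Filter_prod _ _ _ (fun a => (0 < a < d)%R) (fun b => (B < b)%R)).
  - exists (mkposreal d Hd). intros y Hy Hy0. split; [exact Hy0|].
    change (Rabs (y - 0) < d)%R in Hy. rewrite Rminus_0_r in Hy. apply Rabs_def2 in Hy. lra.
  - exists B. auto.
  - exact H.
Qed.

Lemma half_line_eventually_inv (P : R * R -> Prop) :
  filter_prod (at_right 0) (Rbar_locally p_infty) P ->
  exists d B : R, (0 < d)%R /\ forall a b, (0 < a < d)%R -> (B < b)%R -> P (a, b).
Proof.
  intros [Q S [d Hd] [B HB] H]. exists d, B. split; [apply cond_pos|].
  intros a b Ha Hb. apply H; [|now apply HB]. apply Hd; [|lra].
  change (Rabs (a - 0) < d)%R. rewrite Rminus_0_r, Rabs_pos_eq; lra.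
Qed.

Lemma gint_eps (f : R -> C) (l : C) :
  gint f l <-> forall eps : R, (0 < eps)%R -> exists d B : R, (0 < d)%R /\
    forall a b, (0 < a < d)%R -> (B < b)%R -> exists y : C, CRInt f a b y /\ (Cmod (y - l) < eps)%R.
Proof.
  split.
  - intros H eps He.
    assert (Hl : locally l (fun y : C => (Cmod (y - l) < eps)%R)).
    { apply (@locally_le_locally_norm R_AbsRing C_R_NormedModule l).
      exists (mkposreal eps He). intros y Hy.
      unfold ball_norm in Hy. rewrite norm_C in Hy. exact Hy. }
    apply H in Hl. apply half_line_eventually_inv in Hl. exact Hl.
  - intros H P HP.
    apply (@locally_norm_le_locally R_AbsRing C_R_NormedModule l) in HP.
    destruct HP as [eps HP]. destruct (H eps (cond_pos eps)) as [d [B [Hd H']]].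
    apply (half_line_eventually _ d B Hd). intros a b Ha Hb.
    destruct (H' a b Ha Hb) as [y [Hy1 Hy2]]. exists y. split; [exact Hy1|].
    apply HP. unfold ball_norm. rewrite norm_C. exact Hy2.
Qed.

Lemma gint_approx (f : R -> C) (l : C) (eps d B : R) : gint f l -> (0 < eps)%R -> (0 < d)%R ->
  exists a b (y : C), (0 < a < d)%R /\ (B < b)%R /\ CRInt f a b y /\ (Cmod (y - l) < eps)%R.
Proof.
  intros H He Hd. destruct (proj1 (gint_eps f l) H eps He) as [d' [B' [Hd' H']]].
  assert (Q := Rmin_glb_lt d d' 0 Hd Hd'). assert (Q1 := Rmin_l d d'). assert (Q2 := Rmin_r d d').
  assert (Q3 := Rmax_l B B'). assert (Q4 := Rmax_r B B').
  destruct (H' (Rmin d d' / 2)%R (Rmax B B' + 1)%R) as [y Hy]; [lra | lra|].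
  exists (Rmin d d' / 2)%R, (Rmax B B' + 1)%R, y. repeat split; try lra; apply Hy.
Qed.

Lemma gint_unique (f : R -> C) l : gint f l ->
  @RInt_gen C_R_CompleteNormedModule f (at_right 0) (Rbar_locally p_infty) = l.
Proof.
  apply (@is_RInt_gen_unique C_R_CompleteNormedModule (at_right 0) (Rbar_locally p_infty) _ _ f l).
Qed.

Lemma gint_ext f g l : (forall x, (0 < x)%R -> f x = g x) -> gint f l -> gint g l.
Proof.
  intros H. apply (@is_RInt_gen_ext C_R_NormedModule (at_right 0) (Rbar_locally p_infty) _ _ f g l).
  apply (half_line_eventually _ 1 1); [lra|]. intros a b Ha Hb x Hx.
  apply H. simpl in Hx. rewrite Rmin_left in Hx; lra.
Qed.

Lemma gint_plus f g l m : gint f l -> gint g m -> gint (fun x => f x + g x) (l + m).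
Proof. apply (@is_RInt_gen_plus C_R_NormedModule (at_right 0) (Rbar_locally p_infty) _ _ f g l m). Qed.

Lemma CRInt_mult_l (c : C) f a b y : CRInt f a b y -> CRInt (fun x => c * f x) a b (c * y).
Proof.
  intros H.
  assert (H1 := @is_RInt_fct_extend_fst R_NormedModule R_NormedModule f a b y H).
  assert (H2 := @is_RInt_fct_extend_snd R_NormedModule R_NormedModule f a b y H).
  apply (@is_RInt_fct_extend_pair R_NormedModule R_NormedModule).
  - apply (@is_RInt_minus R_NormedModule (fun x => fst c * fst (f x))%R (fun x => snd c * snd (f x))%R a b
      (fst c * fst y)%R (snd c * snd y)%R); now apply (@is_RInt_scal R_NormedModule).
  - apply (@is_RInt_plus R_NormedModule (fun x => fst c * snd (f x))%R (fun x => snd c * fst (f x))%R a b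
      (fst c * snd y)%R (snd c * fst y)%R); now apply (@is_RInt_scal R_NormedModule).
Qed.

Lemma gint_mult_l (c : C) f l : gint f l -> gint (fun x => c * f x) (c * l).
Proof.
  intros H. apply gint_eps. intros eps He. assert (P := Cmod_ge_0 c).
  destruct (proj1 (gint_eps f l) H (eps / (Cmod c + 1))%R) as [d [B [Hd H']]].
  { apply Rdiv_lt_0_compat; lra. }
  exists d, B. split; [exact Hd|]. intros a b Ha Hb.
  destruct (H' a b Ha Hb) as [y [Hy1 Hy2]]. exists (c * y). split; [now apply CRInt_mult_l|].
  replace (c * y - c * l) with (c * (y - l)) by ring. rewrite Cmod_mult.
  apply Rle_lt_trans with (Cmod c * (eps / (Cmod c + 1)))%R.
  - apply Rmult_le_compat_l; lra.
  - apply Rmult_lt_reg_r with (Cmod c + 1)%R; [lra|].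
    replace (Cmod c * (eps / (Cmod c + 1)) * (Cmod c + 1))%R with (Cmod c * eps)%R by (field; lra).
    nra.
Qed.

Lemma CRInt_norm_le (f : R -> C) (g : R -> R) a b y z : (a <= b)%R ->
  (forall x, (a <= x <= b)%R -> (Cmod (f x) <= g x)%R) ->
  CRInt f a b y -> is_RInt g a b z -> (Cmod y <= z)%R.
Proof.
  intros Hab H Hf Hg. rewrite <- norm_C.
  apply (@norm_RInt_le C_R_NormedModule f g a b y z Hab); auto.
  intros x Hx. rewrite norm_C. now apply H.
Qed.

Lemma CRInt_Re f a b y : CRInt f a b y -> is_RInt (fun x => Re (f x)) a b (Re y).
Proof. apply (@is_RInt_fct_extend_fst R_NormedModule R_NormedModule f a b y). Qed.

(** The majorant is complex-valued and enters through its real part, so that combinations of Gamma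
    integrals can serve as majorants directly. *)
Lemma gint_le (f g : R -> C) l m : gint f l -> gint g m ->
  (forall x, (0 < x)%R -> (Cmod (f x) <= Re (g x))%R) -> (Cmod l <= Re m)%R.
Proof.
  intros Hf Hg H. apply Rnot_lt_le. intros Hlt.
  set (eps := ((Cmod l - Re m) / 2)%R).
  destruct (proj1 (gint_eps f l) Hf eps) as [d [B [Hd H1]]]; [unfold eps; lra|].
  destruct (gint_approx g m eps (Rmin d 1) (Rmax B 1) Hg) as [a [b [z [Ha [Hb [Hz1 Hz2]]]]]];
    [unfold eps; lra | apply Rmin_glb_lt; lra |].
  assert (Q1 := Rmin_l d 1). assert (Q2 := Rmin_r d 1).
  assert (Q3 := Rmax_l B 1). assert (Q4 := Rmax_r B 1).
  destruct (H1 a b) as [y [Hy1 Hy2]]; [lra | lra|].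
  assert (Hyz : (Cmod y <= Re z)%R).
  { apply (CRInt_norm_le f (fun x => Re (g x)) a b); [lra| |exact Hy1|now apply CRInt_Re].
    intros x Hx. apply H. lra. }
  assert (R1 := Cmod_triangle y (- (y - l))). rewrite Cmod_opp in R1.
  replace (y + - (y - l)) with l in R1 by ring.
  assert (R2 := Re_le_Cmod (z - m)). rewrite Re_minus in R2. unfold eps in *. lra.
Qed.

(** Bounded and increasing, with derivative of order [x^(b-1)] at [0] and
    [x^(-b-1)] at infinity: the derivative serves as integrable majorant. *)
Definition sigmoid (b x : R) : R := / (1 + exp (- b * ln x)).

Lemma sigmoid_derive b x : (0 < x)%R ->
  is_derive (sigmoid b) x (b / (x * (2 + (exp (b * ln x) + exp (- b * ln x)))))%R.
Proof.
  intros Hx. unfold sigmoid. assert (E := exp_pos (- b * ln x)).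
  auto_derive.
  - repeat split; lra.
  - assert (E2 : exp (b * ln x) = (/ exp (- b * ln x))%R).
    { rewrite <- exp_Ropp. f_equal. ring. }
    rewrite E2. set (e := exp (- b * ln x)) in *. simpl. field.
    assert (0 < e * e)%R by nra. repeat split; nra.
Qed.

Lemma sigmoid_01 b x : (0 < sigmoid b x < 1)%R.
Proof.
  unfold sigmoid. assert (E := exp_pos (- b * ln x)). split.
  - apply Rinv_0_lt_compat. lra.
  - rewrite <- Rinv_1. apply Rinv_lt_contravar; lra.
Qed.

Lemma sigmoid_ends b eps : (0 < b)%R -> (0 < eps)%R -> exists d B : R, (0 < d < 1)%R /\ (1 < B)%R /\
  (sigmoid b d <= eps)%R /\ (1 - eps <= sigmoid b B)%R.
Proof.
  (* At [exp(-u)] and [exp u] the exponent in [sigmoid] is [1 / eps] up to sign, and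
     [exp(1 / eps) >= 1 / eps] gives both estimates. *)
  intros Hb He. set (u := (/ (b * eps))%R).
  assert (Hbe : (0 < b * eps)%R) by now apply Rmult_lt_0_compat.
  assert (Hu : (0 < u)%R) by now apply Rinv_0_lt_compat.
  assert (Hbu : (b * u = / eps)%R) by (unfold u; field; lra).
  assert (Hie : (0 < / eps)%R) by now apply Rinv_0_lt_compat.
  exists (exp (- u)), (exp u). repeat split.
  - apply exp_pos.
  - rewrite <- exp_0. apply exp_increasing. lra.
  - rewrite <- exp_0. apply exp_increasing. lra.
  - unfold sigmoid. rewrite ln_exp. replace (- b * - u)%R with (b * u)%R by ring. rewrite Hbu.
    assert (Q := exp_ineq1_le (/ eps)). rewrite <- (Rinv_inv eps) at 2.
    apply Rinv_le_contravar; lra.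
  - unfold sigmoid. rewrite ln_exp. replace (- b * u)%R with (- (/ eps))%R by (rewrite <- Hbu; ring).
    rewrite exp_Ropp.
    assert (Q := exp_ineq1_le (/ eps)). set (E := exp (/ eps)) in *.
    assert (Hs : (/ E <= eps)%R) by (rewrite <- (Rinv_inv eps); apply Rinv_le_contravar; lra).
    assert (HE : (0 < / E)%R) by (apply Rinv_0_lt_compat; lra).
    apply Rmult_le_reg_r with (1 + / E)%R; [lra|]. rewrite Rinv_l by lra. nra.
Qed.

Lemma path_deriv_continuous f x l : path_deriv f x l ->
  continuous (fun t => Re (f t)) x /\ continuous (fun t => Im (f t)) x.
Proof.
  intros [H1 H2]. split; apply (@ex_derive_continuous R_AbsRing R_NormedModule);
    [now exists (Re l) | now exists (Im l)].
Qed.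

Lemma CRInt_ex (f : R -> C) a b : (0 < a)%R -> (a <= b)%R ->
  (forall x, (0 < x)%R -> exists l, path_deriv f x l) -> exists y : C, CRInt f a b y.
Proof.
  intros Ha Hab H.
  apply (@ex_RInt_fct_extend_pair R_NormedModule R_NormedModule f a b);
    apply (@ex_RInt_continuous R_CompleteNormedModule); intros x Hx;
    rewrite Rmin_left in Hx by exact Hab;
    destruct (H x ltac:(lra)) as [l Hl]; apply (path_deriv_continuous f x l Hl).
Qed.

Lemma sigmoid_RInt b M u v : (0 < u)%R -> (u <= v)%R ->
  is_RInt (fun x => M * (b / (x * (2 + (exp (b * ln x) + exp (- b * ln x))))))%R u v
    (M * (sigmoid b v - sigmoid b u))%R.
Proof.
  intros Hu Huv. apply (@is_RInt_scal R_NormedModule).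
  apply (@is_RInt_derive R_CompleteNormedModule (sigmoid b)).
  - intros x Hx. rewrite Rmin_left in Hx by exact Huv. apply sigmoid_derive. lra.
  - intros x Hx. rewrite Rmin_left in Hx by exact Huv.
    apply (@ex_derive_continuous R_AbsRing R_NormedModule). auto_derive.
    assert (E1 := exp_pos (b * ln x)). assert (E2 := exp_pos (- b * ln x)).
    repeat split; try lra. apply Rgt_not_eq, Rmult_lt_0_compat; lra.
Qed.

(** Cauchy criterion: enlarging an interval from [d] to [B] changes the integral by at most [M]
    times the part of the total rise of [sigmoid] that lies outside it. *)
Lemma gint_dominated (f : R -> C) (b M : R) : (0 < b)%R ->
  (forall x, (0 < x)%R -> exists l, path_deriv f x l) ->
  (forall x, (0 < x)%R ->
     (Cmod (f x) <= M * (b / (x * (2 + (exp (b * ln x) + exp (- b * ln x))))))%R) ->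
  exists l : C, gint f l /\ (Cmod l <= M)%R.
Proof.
  intros Hb Hf HM.
  assert (HM0 : (0 <= M)%R).
  { specialize (HM 1%R Rlt_0_1). assert (P := Cmod_ge_0 (f 1%R)).
    rewrite ln_1, !Rmult_0_r, exp_0 in HM.
    replace (b / (1 * (2 + (1 + 1))))%R with (b / 4)%R in HM by field. nra. }
  assert (HI : forall u v y, (0 < u)%R -> (u <= v)%R -> CRInt f u v y ->
     (Cmod y <= M * (sigmoid b v - sigmoid b u))%R).
  { intros u v y Hu Huv Hy.
    apply (CRInt_norm_le f _ u v y _ Huv (fun x Hx => HM x ltac:(lra)) Hy).
    now apply sigmoid_RInt. }
  assert (Hnest : forall u u' v' v y y', (0 < u)%R -> (u <= u')%R -> (u' <= v')%R -> (v' <= v)%R ->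
     CRInt f u v y -> CRInt f u' v' y' ->
     (Cmod (y - y') <= M * (1 - (sigmoid b v' - sigmoid b u')))%R).
  { intros u u' v' v y y' Hu H1 H2 H3 Hy Hy'.
    destruct (CRInt_ex f u u' Hu H1 Hf) as [p Hp].
    destruct (CRInt_ex f v' v ltac:(lra) H3 Hf) as [q Hq].
    assert (Hc := @is_RInt_Chasles C_R_NormedModule f u u' v' p y' Hp Hy').
    assert (Hc' := @is_RInt_Chasles C_R_NormedModule f u v' v _ q Hc Hq).
    assert (E : y = p + y' + q).
    { transitivity (@RInt C_R_CompleteNormedModule f u v); [symmetry|];
      apply (@is_RInt_unique C_R_CompleteNormedModule); [exact Hy | exact Hc']. }
    rewrite E. replace (p + y' + q - y') with (p + q) by ring.
    eapply Rle_trans; [apply Cmod_triangle|].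
    assert (Bp := HI u u' p Hu H1 Hp). assert (Bq := HI v' v q ltac:(lra) H3 Hq).
    assert (S1 := sigmoid_01 b u). assert (S2 := sigmoid_01 b v). nra. }
  set (F := fun ab : R * R => @RInt C_R_CompleteNormedModule f (fst ab) (snd ab)).
  assert (HF : forall u v, (0 < u)%R -> (u <= v)%R -> CRInt f u v (F (u, v))).
  { intros u v Hu Huv. apply (@RInt_correct C_R_CompleteNormedModule).
    destruct (CRInt_ex f u v Hu Huv Hf) as [y Hy]. now exists y. }
  assert (Hlim : exists l : C, filterlim F (filter_prod (at_right 0) (Rbar_locally p_infty))
     (@locally C_R_CompleteNormedModule l)).
  { apply (@filterlim_locally_cauchy (R * R) C_R_CompleteNormedModule
      (filter_prod (at_right 0) (Rbar_locally p_infty)) _).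
    intros eps. assert (He := cond_pos eps).
    (* The two ends together cost at most [eps / 4], and two such intervals are compared. Dividing
       by [M + 1] allows [M = 0]. *)
    destruct (sigmoid_ends b (eps / (8 * (M + 1)))%R Hb) as [d [B [Hd [HB [Sd SB]]]]].
    { apply Rdiv_lt_0_compat; lra. }
    assert (Hmid : forall u v, (0 < u < d)%R -> (B < v)%R -> (Cmod (F (u, v) - F (d, B)) <= eps / 4)%R).
    { intros u v Hu Hv.
      eapply Rle_trans; [apply (Hnest u d B v); try lra; apply HF; lra|].
      apply Rle_trans with (M * (2 * (eps / (8 * (M + 1)))))%R; [apply Rmult_le_compat_l; lra|].
      apply Rmult_le_reg_r with (4 * (M + 1))%R; [lra|].
      replace (M * (2 * (eps / (8 * (M + 1)))) * (4 * (M + 1)))%R with (M * eps)%R by (field; lra).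
      replace (eps / 4 * (4 * (M + 1)))%R with ((M + 1) * eps)%R by field. nra. }
    exists (fun ab => (0 < fst ab < d)%R /\ (B < snd ab)%R). split.
    - apply (half_line_eventually _ d B); [lra|]. intros u v Hu Hv. now split.
    - intros [u v] [u' v'] [H1 H2] [H3 H4]. simpl in *.
      apply (@norm_compat1 R_AbsRing C_R_NormedModule). rewrite norm_C.
      change (Cmod (F (u', v') - F (u, v)) < eps)%R.
      replace (F (u', v') - F (u, v)) with ((F (u', v') - F (d, B)) + - (F (u, v) - F (d, B))) by ring.
      eapply Rle_lt_trans; [apply Cmod_triangle|]. rewrite Cmod_opp.
      assert (K1 := Hmid u v H1 H2). assert (K2 := Hmid u' v' H3 H4). lra. }
  destruct Hlim as [l Hl]. exists l.
  assert (HG : gint f l).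
  { intros P HP. apply Hl in HP. apply half_line_eventually_inv in HP.
    destruct HP as [d [B [Hd HP]]].
    apply (half_line_eventually _ (Rmin d 1) (Rmax B 1)); [apply Rmin_glb_lt; lra|].
    intros u v Hu Hv. assert (Q1 := Rmin_l d 1). assert (Q2 := Rmin_r d 1).
    assert (Q3 := Rmax_l B 1). assert (Q4 := Rmax_r B 1).
    exists (F (u, v)). split; [apply HF; lra | apply (HP u v); lra]. }
  split; [exact HG|]. apply Rnot_lt_le. intros Hlt.
  destruct (gint_approx f l (Cmod l - M) 1 1 HG) as [u [v [y [Hu [Hv [Hy1 Hy2]]]]]]; [lra | lra|].
  assert (Hy := HI u v y ltac:(lra) ltac:(lra) Hy1).
  assert (S1 := sigmoid_01 b u). assert (S2 := sigmoid_01 b v).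
  assert (R1 := Cmod_triangle y (- (y - l))). rewrite Cmod_opp in R1.
  replace (y + - (y - l)) with l in R1 by ring. nra.
Qed.

(** * The Gamma function *)

(** The function [x^z exp(-x)] for [x > 0], with the real logarithm so that it can be differentiated
    in [x]; the integrand of [Gamma z] is [kernel (z - 1)]. *)
Definition kernel (z : C) (x : R) : C := Cexp (z * RtoC (ln x)) * RtoC (exp (- x)).

Lemma path_deriv_plus f g x l m :
  path_deriv f x l -> path_deriv g x m -> path_deriv (fun t => f t + g t) x (l + m).
Proof.
  intros [F1 F2] [G1 G2]. split; [rewrite re_plus | rewrite im_plus].
  - apply (@is_derive_plus R_AbsRing R_NormedModule (fun t => Re (f t)) (fun t => Re (g t))); assumption.
  - apply (@is_derive_plus R_AbsRing R_NormedModule (fun t => Im (f t)) (fun t => Im (g t))); assumption.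
Qed.

Lemma path_deriv_R (f : R -> R) x l : is_derive f x l -> path_deriv (fun t => RtoC (f t)) x (RtoC l).
Proof. intros H. split; simpl; [exact H | apply (@is_derive_const R_AbsRing R_NormedModule)]. Qed.

Lemma path_deriv_ln x : (0 < x)%R -> path_deriv (fun t => RtoC (ln t)) x (RtoC (/ x)).
Proof. intros H. apply path_deriv_R. auto_derive; [exact H | field; lra]. Qed.

Lemma Cexp_mult_ln_minus_1 z x : (0 < x)%R ->
  Cexp ((z - 1) * RtoC (ln x)) = Cexp (z * RtoC (ln x)) * RtoC (/ x).
Proof.
  intros H. replace ((z - 1) * RtoC (ln x)) with (z * RtoC (ln x) + RtoC (- ln x))
    by (rewrite RtoC_opp; ring).
  rewrite Cexp_plus, Cexp_R, exp_Ropp, exp_ln by exact H. reflexivity.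
Qed.

Lemma path_deriv_kernel z x : (0 < x)%R ->
  path_deriv (kernel z) x (z * kernel (z - 1) x + - (1) * kernel z x).
Proof.
  intros H. unfold kernel.
  replace (z * _ + _) with
    (z * RtoC (/ x) * Cexp (z * RtoC (ln x)) * RtoC (exp (- x))
     + Cexp (z * RtoC (ln x)) * RtoC (- exp (- x))).
  2:{ rewrite Cexp_mult_ln_minus_1, RtoC_opp by exact H. ring. }
  apply (path_deriv_mult (fun t => Cexp (z * RtoC (ln t))) (fun t => RtoC (exp (- t)))).
  - apply (path_deriv_Cexp (fun t => z * RtoC (ln t))).
    replace (z * RtoC (/ x)) with (0 * RtoC (ln x) + z * RtoC (/ x)) by ring.
    apply (path_deriv_mult (fun _ => z) (fun t => RtoC (ln t)));
      [apply path_deriv_const | now apply path_deriv_ln].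
  - apply path_deriv_R. auto_derive; [exact I | ring].
Qed.

Lemma Cmod_kernel z x : Cmod (kernel z x) = exp (Re z * ln x - x).
Proof.
  unfold kernel. rewrite Cmod_mult, Cmod_Cexp, re_scal_r, Cmod_R, Rabs_pos_eq
    by (left; apply exp_pos).
  rewrite <- exp_plus. reflexivity.
Qed.

Lemma kernel_R (c x : R) : kernel (RtoC c) x = RtoC (exp (c * ln x - x)).
Proof.
  unfold kernel. rewrite <- RtoC_mult, Cexp_R, <- RtoC_mult, <- exp_plus. reflexivity.
Qed.

Lemma ln_minus_id_le k x : (0 < k)%R -> (0 < x)%R -> (k * ln x - x <= k * ln k - k)%R.
Proof.
  intros Hk Hx. assert (Q := ln_le_sub_1 (x / k) ltac:(now apply Rdiv_lt_0_compat)).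
  unfold Rdiv in Q. rewrite ln_mult, ln_Rinv in Q by (try apply Rinv_0_lt_compat; lra).
  apply (Rmult_le_compat_l k) in Q; [|lra].
  replace (k * (x * / k - 1))%R with (x - k)%R in Q by (field; lra). lra.
Qed.

Lemma exp_sym_ge_2 y : (2 <= exp y + exp (- y))%R.
Proof. assert (Q1 := exp_ineq1_le y). assert (Q2 := exp_ineq1_le (- y)). lra. Qed.

(** The additional powers [x^(sigma/2)] and [x^(-sigma/2)] leave room for logarithms of [x] and for
    small changes of the exponent. As [K] depends on [sigma] only, the bound is linear in [A] and
    can carry a factor such as [|h|^2]. *)
Lemma gint_gamma_bound (sigma : R) : (0 < sigma)%R -> exists K : R, (0 <= K)%R /\
  forall (f : R -> C) (A : R),
    (forall x, (0 < x)%R -> exists l, path_deriv f x l) ->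
    (forall x, (0 < x)%R -> (Cmod (f x) <= A * (exp ((sigma - 1) * ln x - x)
        * (exp (sigma / 2 * ln x) + exp (- (sigma / 2) * ln x))))%R) ->
    exists l : C, gint f l /\ (Cmod l <= A * K)%R.
Proof.
  intros Hs. set (b := (sigma / 2)%R). assert (Hb : (0 < b)%R) by (unfold b; lra).
  (* The maximum of [x^(2 sigma) exp(-x)], attained at [x = 2 sigma]. *)
  set (C1 := exp (2 * sigma * ln (2 * sigma) - 2 * sigma)).
  assert (HC1 : (0 < C1)%R) by apply exp_pos.
  set (K := (4 * (C1 + 1) / b)%R).
  assert (HK : (0 <= K)%R) by (unfold K; left; apply Rdiv_lt_0_compat; lra).
  exists K. split; [exact HK|].
  intros f A Hd Hf.
  assert (HA : (0 <= A)%R).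
  { specialize (Hf 1%R Rlt_0_1). assert (P := Cmod_ge_0 (f 1%R)).
    assert (0 < exp ((sigma - 1) * ln 1 - 1) * (exp (b * ln 1) + exp (- b * ln 1)))%R.
    { apply Rmult_lt_0_compat; [apply exp_pos|].
      assert (Q1 := exp_pos (b * ln 1)). assert (Q2 := exp_pos (- b * ln 1)). lra. }
    nra. }
  apply (gint_dominated f b (A * K)%R Hb Hd). intros x Hx.
  eapply Rle_trans; [now apply Hf|]. rewrite Rmult_assoc.
  apply Rmult_le_compat_l; [exact HA|].
  set (u := ln x). set (p := exp (b * u)). set (q := exp (- b * u)).
  assert (Hp : (0 < p)%R) by apply exp_pos. assert (Hq : (0 < q)%R) by apply exp_pos.
  assert (Hpq : (p * q = 1)%R)
    by (unfold p, q; rewrite <- exp_plus; replace (b * u + - b * u)%R with 0%R by ring; apply exp_0).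
  assert (HP : (2 <= p + q)%R).
  { unfold p, q. replace (- b * u)%R with (- (b * u))%R by ring. apply exp_sym_ge_2. }
  assert (Ex : x = exp u) by (unfold u; now rewrite exp_ln).
  set (e := exp (- x)). assert (He : (0 < e <= 1)%R).
  { split; [apply exp_pos|]. unfold e. rewrite <- exp_0. apply exp_le. lra. }
  assert (H1 : (exp ((sigma - 1) * u - x) * x = p * p * e)%R).
  { unfold p, e. rewrite Ex at 2. rewrite <- !exp_plus. f_equal. unfold b. field. }
  assert (H2 : (p * p * (p * p) * e <= C1)%R).
  { unfold p, e, C1. rewrite <- !exp_plus. apply exp_le.
    assert (Q := ln_minus_id_le (2 * sigma) x ltac:(lra) Hx). fold u in Q. unfold b. lra. }
  apply Rmult_le_reg_r with (x * (2 + (p + q)))%R; [apply Rmult_lt_0_compat; lra|].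
  replace (K * (b / (x * (2 + (p + q)))) * (x * (2 + (p + q))))%R with (4 * (C1 + 1))%R
    by (unfold K; field; repeat split; lra).
  replace (exp ((sigma - 1) * u - x) * (p + q) * (x * (2 + (p + q))))%R
    with (exp ((sigma - 1) * u - x) * x * ((p + q) * (2 + (p + q))))%R by ring.
  rewrite H1.
  apply Rle_trans with (p * p * e * (2 * ((p + q) * (p + q))))%R.
  { apply Rmult_le_compat_l; [repeat apply Rmult_le_pos; lra | nra]. }
  (* Because [p q = 1], this is [2 e (p^2 + 1)^2], hence at most [4 e (p^4 + 1)], where
     [p^4 e <= C1]. *)
  replace (p * p * e * (2 * ((p + q) * (p + q))))%R
    with (2 * e * ((p * p + p * q) * (p * p + p * q)))%R by ring. rewrite Hpq.
  assert (0 <= (p * p - 1) * (p * p - 1))%R by apply Rle_0_sqr.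
  nra.
Qed.

Lemma kernel_ex_deriv z x : (0 < x)%R -> exists l, path_deriv (kernel z) x l.
Proof. intros H. eexists. now apply path_deriv_kernel. Qed.

Lemma gint_kernel_ex z : (0 < Re z)%R -> exists l : C, gint (kernel (z - 1)) l.
Proof.
  intros Hz. destruct (gint_gamma_bound (Re z) Hz) as [K [_ HK]].
  destruct (HK (kernel (z - 1)) 1%R) as [l [Hl _]].
  - intros; now apply kernel_ex_deriv.
  - intros x Hx. rewrite Rmult_1_l, Cmod_kernel, Re_minus, re_RtoC.
    set (E := exp ((Re z - 1) * ln x - x)).
    assert (HE : (0 < E)%R) by apply exp_pos.
    assert (Q := exp_sym_ge_2 (Re z / 2 * ln x)).
    replace (- (Re z / 2) * ln x)%R with (- (Re z / 2 * ln x))%R by ring. nra.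
  - now exists l.
Qed.

Lemma gint_Gamma z : (0 < Re z)%R -> gint (kernel (z - 1)) (Gamma z).
Proof.
  intros Hz. destruct (gint_kernel_ex z Hz) as [l Hl].
  replace (Gamma z) with l; [exact Hl|]. symmetry.
  apply (gint_unique (fun x => Cpower (RtoC x) (z - 1) * RtoC (exp (- x)))).
  refine (gint_ext (kernel (z - 1)) _ l _ Hl). intros x Hx. unfold kernel, Cpower. now rewrite Clog_R.
Qed.

Lemma Cexp_minus_linear_le y : (Cmod (Cexp y - 1 - y) <= Cmod y ^ 2 * exp (Cmod y))%R.
Proof.
  assert (H := Cseries_exp y).
  apply Cseries_SS in H.
  replace (Cexp y - y ^ 0 / NtoC (fact 0) - y ^ 1 / NtoC (fact 1)) with (Cexp y - 1 - y)
    in H by (simpl; field).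
  revert H. apply Cseries_Cmod_le. intros n. assert (P := Cmod_ge_0 y).
  apply Rle_trans with (Cmod y ^ 2 * Rsum (fun k => Cmod y ^ k / INR (fact k))%R n)%R.
  - rewrite <- Rsum_mult_l. apply Rsum_le. intros k _.
    rewrite Cmod_div_R, Cmod_pow by apply INR_fact_lt_0.
    replace (S (S k)) with (2 + k)%nat by lia. rewrite pow_add. unfold Rdiv. rewrite Rmult_assoc.
    apply Rmult_le_compat_l; [now apply pow_le|]. apply Rmult_le_compat_l; [now apply pow_le|].
    apply Rinv_le_contravar; [apply INR_fact_lt_0|]. apply le_INR, fact_le. lia.
  - apply Rmult_le_compat_l; [now apply pow_le | now apply Rsum_exp_le].
Qed.

Lemma Rabs_le_exp_sym d u : (0 < d)%R -> (Rabs u <= (exp (d * u) + exp (- (d * u))) / d)%R.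
Proof.
  intros Hd. apply Rmult_le_reg_r with d; [exact Hd|].
  replace ((exp (d * u) + exp (- (d * u))) / d * d)%R with (exp (d * u) + exp (- (d * u)))%R by (field; lra).
  assert (E1 := exp_pos (d * u)). assert (E2 := exp_pos (- (d * u))).
  assert (Q1 := exp_ineq1_le (d * u)). assert (Q2 := exp_ineq1_le (- (d * u))).
  unfold Rabs. destruct (Rcase_abs u); lra.
Qed.

Lemma path_deriv_scal (c : C) f x l : path_deriv f x l -> path_deriv (fun t => c * f t) x (c * l).
Proof.
  intros H. replace (c * l) with (0 * f x + c * l) by ring.
  apply (path_deriv_mult (fun _ => c)); [apply path_deriv_const | exact H].
Qed.

Lemma log_kernel_ex_deriv z x : (0 < x)%R ->
  exists l, path_deriv (fun t => RtoC (ln t) * kernel z t) x l.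
Proof.
  intros H. eexists. apply (path_deriv_mult (fun t => RtoC (ln t)));
    [now apply path_deriv_ln | now apply path_deriv_kernel].
Qed.

(** Differentiation under the integral. With [u = ln x], the second-order error has the integrand
    [(exp(h u) - 1 - h u) kernel (z - 1) x], and the first factor is at most
    [|h|^2 u^2 exp(|h u|)]. *)
Lemma Gamma_Cderiv z : (0 < Re z)%R -> exists D : C,
  gint (fun x => RtoC (ln x) * kernel (z - 1) x) D /\ Cderiv Gamma z D.
Proof.
  (* With [p = x^d] and [q = x^(-d)], each of the two factors [|u|] costs [(p + q) / d] and the
     exponential costs [p + q]. The cube of [p + q] is at most [4 (p^3 + q^3)], which matches the
     allowed [x^(s/2)] and [x^(-s/2)] when [d = s / 6]. *)
  intros Hz. set (s := Re z) in *. set (d := (s / 6)%R). assert (Hd : (0 < d)%R) by (unfold d; lra).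
  destruct (gint_gamma_bound s Hz) as [K [HK0 HK]].
  assert (Hmod : forall x, Cmod (kernel (z - 1) x) = exp ((s - 1) * ln x - x)).
  { intros x. now rewrite Cmod_kernel, Re_minus. }
  destruct (HK (fun x => RtoC (ln x) * kernel (z - 1) x) (2 / s)%R) as [D [HD _]].
  { intros; now apply log_kernel_ex_deriv. }
  { intros x Hx. rewrite Cmod_mult, Cmod_R, Hmod.
    assert (Q := Rabs_le_exp_sym (s / 2) (ln x) ltac:(lra)).
    replace (- (s / 2) * ln x)%R with (- (s / 2 * ln x))%R by ring.
    set (P := (exp (s / 2 * ln x) + exp (- (s / 2 * ln x)))%R) in *.
    replace (2 / s * (exp ((s - 1) * ln x - x) * P))%R
      with (P / (s / 2) * exp ((s - 1) * ln x - x))%R by (field; lra).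
    apply Rmult_le_compat_r; [left; apply exp_pos | exact Q]. }
  exists D. split; [exact HD|].
  apply (Cderiv_quadratic _ _ _ d (4 / d ^ 2 * K) Hd).
  { intros h Hh. assert (Ph := Cmod_ge_0 h).
    replace (4 / d ^ 2 * K * Cmod h ^ 2)%R with (4 * Cmod h ^ 2 / d ^ 2 * K)%R by (field; lra).
    set (f := fun x => kernel (z + h - 1) x + (- (1) * kernel (z - 1) x
                + - h * (RtoC (ln x) * kernel (z - 1) x))).
    assert (Hf : gint f (Gamma (z + h) + (- (1) * Gamma z + - h * D))).
    { apply gint_plus; [apply gint_Gamma | apply gint_plus; apply gint_mult_l].
      - assert (Q := Re_plus_ge z h d Hh). fold s in Q. unfold d in Q. lra.
      - now apply gint_Gamma.
      - exact HD. }
    destruct (HK f (4 * Cmod h ^ 2 / d ^ 2)%R) as [l [Hl Hlb]].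
    { intros x Hx.
      destruct (kernel_ex_deriv (z + h - 1) x Hx) as [l1 H1].
      destruct (kernel_ex_deriv (z - 1) x Hx) as [l2 H2].
      destruct (log_kernel_ex_deriv (z - 1) x Hx) as [l3 H3].
      eexists. apply path_deriv_plus; [exact H1|]. apply path_deriv_plus; apply path_deriv_scal; eassumption. }
    { intros x Hx. set (u := ln x).
      replace (f x) with ((Cexp (h * RtoC u) - 1 - h * RtoC u) * kernel (z - 1) x).
      2:{ unfold f, kernel. fold u. replace ((z + h - 1) * RtoC u) with (h * RtoC u + (z - 1) * RtoC u) by ring.
          rewrite Cexp_plus. ring. }
      rewrite Cmod_mult, Hmod. fold u.
      replace (4 * Cmod h ^ 2 / d ^ 2 * (exp ((s - 1) * u - x) * (exp (s / 2 * u) + exp (- (s / 2) * u))))%R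
        with (4 * Cmod h ^ 2 / d ^ 2 * (exp (s / 2 * u) + exp (- (s / 2) * u)) * exp ((s - 1) * u - x))%R by ring.
      apply Rmult_le_compat_r; [left; apply exp_pos|].
      eapply Rle_trans; [apply Cexp_minus_linear_le|].
      rewrite Cmod_mult, Cmod_R.
      set (p := exp (d * u)). set (q := exp (- (d * u))).
      assert (Hp : (0 < p)%R) by apply exp_pos. assert (Hq : (0 < q)%R) by apply exp_pos.
      assert (Hu := Rabs_le_exp_sym d u Hd). fold p q in Hu.
      assert (Pu := Rabs_pos u).
      assert (He : (exp (Cmod h * Rabs u) <= p + q)%R).
      { apply Rle_trans with (exp (d * Rabs u)).
        - apply exp_le. now apply Rmult_le_compat_r.
        - unfold Rabs, p, q. destruct (Rcase_abs u).
          + replace (d * - u)%R with (- (d * u))%R by ring. fold p q. unfold p.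
            assert (E := exp_pos (d * u)). lra.
          + assert (E := exp_pos (- (d * u))). lra. }
      assert (Hp3 : exp (s / 2 * u) = (p ^ 3)%R).
      { unfold p. rewrite <- exp_mult_INR. f_equal. unfold d. simpl. field. }
      assert (Hq3 : exp (- (s / 2) * u) = (q ^ 3)%R).
      { unfold q. rewrite <- exp_mult_INR. f_equal. unfold d. simpl. field. }
      rewrite Hp3, Hq3, Rpow_mult_distr.
      apply Rle_trans with (Cmod h ^ 2 * ((p + q) / d) ^ 2 * (p + q))%R.
      - apply Rmult_le_compat; [| left; apply exp_pos | | exact He].
        + apply Rmult_le_pos; apply pow_le; lra.
        + apply Rmult_le_compat_l; [now apply pow_le|]. apply pow_incr. lra.
      - replace (Cmod h ^ 2 * ((p + q) / d) ^ 2 * (p + q))%R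
          with (Cmod h ^ 2 / d ^ 2 * (p + q) ^ 3)%R by (field; lra).
        replace (4 * Cmod h ^ 2 / d ^ 2 * (p ^ 3 + q ^ 3))%R
          with (Cmod h ^ 2 / d ^ 2 * (4 * (p ^ 3 + q ^ 3)))%R by (field; lra).
        apply Rmult_le_compat_l.
        + apply Rmult_le_pos; [now apply pow_le|]. left. apply Rinv_0_lt_compat. now apply pow_lt.
        + replace (4 * (p ^ 3 + q ^ 3))%R with ((p + q) ^ 3 + 3 * (p + q) * ((p - q) * (p - q)))%R by ring.
          assert (0 <= (p - q) * (p - q))%R by apply Rle_0_sqr.
          assert (0 <= 3 * (p + q) * ((p - q) * (p - q)))%R by (apply Rmult_le_pos; lra). lra. }
    replace (Gamma (z + h) - Gamma z - D * h) with (Gamma (z + h) + (- (1) * Gamma z + - h * D)) by ring.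
    rewrite <- (gint_unique f _ Hf), (gint_unique f _ Hl). exact Hlb. }
Qed.

Lemma CRInt_derive (F f : R -> C) a b : (0 < a)%R -> (a <= b)%R ->
  (forall x, (0 < x)%R -> path_deriv F x (f x)) ->
  (forall x, (0 < x)%R -> exists l, path_deriv f x l) -> CRInt f a b (F b - F a).
Proof.
  intros Ha Hab HF Hf.
  assert (Hx : forall x, (Rmin a b <= x <= Rmax a b)%R -> (0 < x)%R)
    by (intros x Hx; rewrite Rmin_left in Hx by exact Hab; lra).
  assert (Hc : forall x, (0 < x)%R ->
    continuous (fun t => Re (f t)) x /\ continuous (fun t => Im (f t)) x)
    by (intros x H; destruct (Hf x H) as [l Hl]; exact (path_deriv_continuous f x l Hl)).
  apply (@is_RInt_fct_extend_pair R_NormedModule R_NormedModule).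
  - apply (@is_RInt_derive R_CompleteNormedModule (fun x => Re (F x)) (fun x => Re (f x)));
      intros x H; [apply HF | apply Hc]; now apply Hx.
  - apply (@is_RInt_derive R_CompleteNormedModule (fun x => Im (F x)) (fun x => Im (f x)));
      intros x H; [apply HF | apply Hc]; now apply Hx.
Qed.

Lemma kernel_ends z eps : (0 < Re z)%R -> (0 < eps)%R -> exists d B : R, (0 < d)%R /\ (0 < B)%R /\
  (forall x, (0 < x < d)%R -> (Cmod (kernel z x) < eps)%R) /\
  (forall x, (B < x)%R -> (Cmod (kernel z x) < eps)%R).
Proof.
  intros Hz He. set (s := Re z) in *.
  (* Applying [ln_minus_id_le] at [x / 2] gives [s ln x - x <= M - x / 2], which drops below
     [ln eps] for large [x]. *)
  set (M := (s * ln 2 + s * ln s - s)%R).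
  exists (exp (ln eps / s)), (Rmax 1 (2 * (M - ln eps))).
  split; [apply exp_pos|]. split; [apply Rlt_le_trans with 1%R; [lra | apply Rmax_l]|].
  split; intros x Hx; rewrite Cmod_kernel; fold s; rewrite <- (exp_ln eps) by exact He;
    apply exp_increasing.
  - assert (L : (ln x < ln eps / s)%R) by (rewrite <- (ln_exp (ln eps / s)); apply ln_increasing; lra).
    apply (Rmult_lt_compat_l s) in L; [|exact Hz].
    replace (s * (ln eps / s))%R with (ln eps) in L by (field; lra). lra.
  - assert (Q1 := Rmax_l 1 (2 * (M - ln eps))). assert (Q2 := Rmax_r 1 (2 * (M - ln eps))).
    assert (L := ln_minus_id_le s (x / 2) Hz ltac:(lra)).
    unfold Rdiv in L. rewrite ln_mult, ln_Rinv in L by lra. unfold M in *. lra.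
Qed.

(** Integration by parts: [z kernel (z - 1) - kernel z] is the derivative of [kernel z], which tends
    to 0 at both ends. *)
Lemma Gamma_S z : (0 < Re z)%R -> Gamma (z + 1) = z * Gamma z.
Proof.
  intros Hz.
  assert (H0 : gint (fun x => z * kernel (z - 1) x + - (1) * kernel z x) 0).
  { apply gint_eps. intros eps He.
    destruct (kernel_ends z (eps / 2) Hz ltac:(lra)) as [d [B [Hd [HB [H1 H2]]]]].
    exists (Rmin d B), B. split; [now apply Rmin_glb_lt|]. intros a b Ha Hb.
    assert (Q1 := Rmin_l d B). assert (Q2 := Rmin_r d B).
    exists (kernel z b - kernel z a). split.
    - apply CRInt_derive; [lra | lra | intros; now apply path_deriv_kernel |].
      intros x Hx. destruct (kernel_ex_deriv (z - 1) x Hx) as [l1 L1].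
      destruct (kernel_ex_deriv z x Hx) as [l2 L2].
      eexists. apply path_deriv_plus; apply path_deriv_scal; eassumption.
    - replace (kernel z b - kernel z a - 0) with (kernel z b + - kernel z a) by ring.
      eapply Rle_lt_trans; [apply Cmod_triangle|]. rewrite Cmod_opp.
      specialize (H1 a ltac:(lra)). specialize (H2 b Hb). lra. }
  assert (H1 : gint (fun x => z * kernel (z - 1) x + - (1) * kernel z x)
     (z * Gamma z + - (1) * Gamma (z + 1))).
  { apply gint_plus; apply gint_mult_l; [now apply gint_Gamma|].
    assert (H := gint_Gamma (z + 1) ltac:(rewrite re_plus; simpl; lra)).
    replace (z + 1 - 1) with z in H by ring. exact H. }
  assert (E := gint_unique _ _ H0). rewrite (gint_unique _ _ H1) in E.
  replace (Gamma (z + 1)) with (z * Gamma z - (z * Gamma z + - (1) * Gamma (z + 1))) by ring.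
  rewrite E. ring.
Qed.

Lemma Gamma_R_pos (c : R) : (0 < c)%R -> (0 < Re (Gamma (RtoC c)))%R.
Proof.
  intros Hc. apply Rnot_le_lt. intros Hle.
  assert (HG := gint_Gamma (RtoC c) Hc).
  assert (HK : forall x, Re (kernel (RtoC c - 1) x) = exp ((c - 1) * ln x - x)).
  { intros x. rewrite <- RtoC_minus, kernel_R. reflexivity. }
  (* A lower bound for the integrand between 1 and 2. That piece alone contributes at least [m],
     while the truncated integral is within less than [m] of its limit. *)
  set (m := exp (- Rabs (c - 1) * ln 2 - 2)). assert (Hm : (0 < m)%R) by apply exp_pos.
  destruct (gint_approx _ _ m 1 2 HG Hm Rlt_0_1) as [a [b [y [Ha [Hb [Hy1 Hy2]]]]]].
  set (f := kernel (RtoC c - 1)) in *.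
  assert (Hd' : forall x, (0 < x)%R -> exists l, path_deriv f x l) by (intros; now apply kernel_ex_deriv).
  destruct (CRInt_ex f a 1 ltac:(lra) ltac:(lra) Hd') as [y1 Y1].
  destruct (CRInt_ex f 1 2 ltac:(lra) ltac:(lra) Hd') as [y2 Y2].
  destruct (CRInt_ex f 2 b ltac:(lra) ltac:(lra) Hd') as [y3 Y3].
  assert (E : y = y1 + y2 + y3).
  { assert (Hc1 := @is_RInt_Chasles C_R_NormedModule f a 1 2 y1 y2 Y1 Y2).
    assert (Hc2 := @is_RInt_Chasles C_R_NormedModule f a 2 b _ y3 Hc1 Y3).
    transitivity (@RInt C_R_CompleteNormedModule f a b); [symmetry|];
      apply (@is_RInt_unique C_R_CompleteNormedModule); [exact Hy1 | exact Hc2]. }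
  assert (Hge : forall u v w k, (u <= v)%R -> CRInt f u v w ->
     (forall x, (u < x < v)%R -> (k <= exp ((c - 1) * ln x - x))%R) -> ((v - u) * k <= Re w)%R).
  { intros u v w k Huv Hw Hk.
    apply (is_RInt_le (fun _ => k) (fun x => Re (f x)) u v _ _ Huv (@is_RInt_const R_NormedModule u v k)
      (CRInt_Re _ _ _ _ Hw)).
    intros x Hx. unfold f. rewrite HK. now apply Hk. }
  assert (P1 := Hge a 1%R y1 0%R ltac:(lra) Y1 (fun x _ => Rlt_le _ _ (exp_pos _))).
  assert (P3 := Hge 2%R b y3 0%R ltac:(lra) Y3 (fun x _ => Rlt_le _ _ (exp_pos _))).
  assert (P2 : ((2 - 1) * m <= Re y2)%R).
  { apply (Hge 1%R 2%R y2 m ltac:(lra) Y2). intros x Hx. apply exp_le.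
    assert (L1 : (0 <= ln x)%R) by (rewrite <- ln_1; apply ln_le_mono; lra).
    assert (L2 := ln_le_mono x 2 ltac:(lra) ltac:(lra)).
    assert (Ab := Rabs_pos (c - 1)).
    assert (A1 : (- (c - 1) * ln x <= Rabs (c - 1) * ln 2)%R).
    { apply Rle_trans with (Rabs (c - 1) * ln x)%R; [|now apply Rmult_le_compat_l].
      apply Rmult_le_compat_r; [exact L1|]. rewrite <- Rabs_Ropp. apply Rle_abs. }
    lra. }
  assert (Hre := Re_le_Cmod (y - Gamma (RtoC c))). rewrite Re_minus in Hre.
  rewrite E, !re_plus in Hre at 1. lra.
Qed.

(** * Concentration of the Gamma integral *)

(** With [v = ln y / 2] the right side is [4 (exp v - exp(-v))^2], and
    [|v| <= |exp v - exp(-v)|]. *)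
Lemma ln_sqr_le y : (0 < y)%R -> (ln y * ln y <= 4 * (y - 2 + / y))%R.
Proof.
  intros Hy. set (v := (ln y / 2)%R).
  assert (Ey : y = (exp v * exp v)%R).
  { rewrite <- exp_plus. replace (v + v)%R with (ln y) by (unfold v; field). now rewrite exp_ln. }
  assert (El : ln y = (2 * v)%R) by (unfold v; field).
  assert (Ei : (/ y = exp (- v) * exp (- v))%R).
  { rewrite Ey, exp_Ropp. field. apply Rgt_not_eq, exp_pos. }
  assert (E1 : (exp v * exp (- v) = 1)%R).
  { rewrite <- exp_plus. replace (v + - v)%R with 0%R by ring. apply exp_0. }
  rewrite El, Ei, Ey.
  replace (exp v * exp v - 2 + exp (- v) * exp (- v))%R
    with ((exp v - exp (- v)) * (exp v - exp (- v)))%R.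
  2:{ replace 2%R with (2 * (exp v * exp (- v)))%R by (rewrite E1; ring). ring. }
  assert (Q1 := exp_ineq1_le v). assert (Q2 := exp_ineq1_le (- v)).
  assert (P1 := exp_pos v). assert (P2 := exp_pos (- v)).
  destruct (Rle_dec 0 v) as [Hv|Hv].
  - assert (H1 : (exp (- v) <= 1)%R) by (rewrite <- exp_0; apply exp_le; lra).
    assert (H2 : (v <= exp v - exp (- v))%R) by lra. nra.
  - assert (H1 : (exp v <= 1)%R) by (rewrite <- exp_0; apply exp_le; lra).
    assert (H2 : (- v <= exp (- v) - exp v)%R) by lra. nra.
Qed.

(** From [2 eps |ln y| <= eps^2 + (ln y)^2]; the parameter [eps] is later balanced against the
    second moment. *)
Lemma Rabs_ln_le y eps : (0 < y)%R -> (0 < eps)%R ->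
  (Rabs (ln y) <= eps / 2 + 2 / eps * (y - 2 + / y))%R.
Proof.
  intros Hy He. assert (Q := ln_sqr_le y Hy).
  assert (A2 : (Rabs (ln y) * Rabs (ln y) = ln y * ln y)%R)
    by (rewrite <- Rabs_mult; apply Rabs_pos_eq, Rle_0_sqr).
  assert (H : (0 <= (Rabs (ln y) - eps) * (Rabs (ln y) - eps))%R) by apply Rle_0_sqr.
  apply Rmult_le_reg_l with (2 * eps)%R; [lra|].
  replace (2 * eps * (eps / 2 + 2 / eps * (y - 2 + / y)))%R
    with (eps * eps + 4 * (y - 2 + / y))%R by (field; lra).
  nra.
Qed.

(** With [y = x / N], the bound [|ln y| <= eps/2 + (2/eps) (y - 2 + 1/y)] reduces
    the logarithmic moment to [Gamma] at [s - 1], [s] and [s + 1], hence to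
    [Gamma s] by the functional equation. *)
Lemma gint_log_bound (f : R -> C) (l : C) (s N K eps : R) :
  (1 < s)%R -> (0 < N)%R -> (0 < eps)%R -> (0 <= K)%R -> gint f l ->
  (forall x, (0 < x)%R -> (Cmod (f x) <= K * (Rabs (ln (x / N)) * exp ((s - 1) * ln x - x)))%R) ->
  (Cmod l <= K * ((eps / 2 + 2 / eps * (s / N - 2 + N / (s - 1))) * Re (Gamma (RtoC s))))%R.
Proof.
  intros Hs HN He HK Hf Hb.
  set (m := fun x => RtoC K * (RtoC (eps / 2) * kernel (RtoC s - 1) x
      + RtoC (2 / eps) * (RtoC (/ N) * kernel (RtoC s) x
          + (RtoC (- 2) * kernel (RtoC s - 1) x + RtoC N * kernel (RtoC (s - 1) - 1) x)))).
  assert (Hm : gint m (RtoC K * (RtoC (eps / 2) * Gamma (RtoC s)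
      + RtoC (2 / eps) * (RtoC (/ N) * Gamma (RtoC s + 1)
          + (RtoC (- 2) * Gamma (RtoC s) + RtoC N * Gamma (RtoC (s - 1))))))).
  { apply gint_mult_l, gint_plus; apply gint_mult_l; [apply gint_Gamma; simpl; lra|].
    apply gint_plus; [apply gint_mult_l|apply gint_plus; apply gint_mult_l].
    - assert (H := gint_Gamma (RtoC s + 1) ltac:(rewrite re_plus; simpl; lra)).
      replace (RtoC s + 1 - 1) with (RtoC s) in H by ring. exact H.
    - apply gint_Gamma; simpl; lra.
    - apply gint_Gamma; simpl; lra. }
  assert (H := gint_le f m _ _ Hf Hm).
  rewrite Gamma_S in H by (simpl; lra).
  assert (E : Re (Gamma (RtoC s)) = ((s - 1) * Re (Gamma (RtoC (s - 1))))%R).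
  { replace (RtoC s) with (RtoC (s - 1) + 1) by (rewrite RtoC_minus; ring).
    rewrite Gamma_S by (simpl; lra). now rewrite re_scal_l. }
  match type of H with _ -> (_ <= ?r)%R =>
    replace r with (K * ((eps / 2 + 2 / eps * (s / N - 2 + N / (s - 1))) * Re (Gamma (RtoC s))))%R in H end.
  2:{ repeat first [rewrite re_scal_l | rewrite re_plus]. rewrite E. field. lra. }
  apply H. intros x Hx. eapply Rle_trans; [now apply Hb|].
  unfold m. rewrite <- !RtoC_minus, !kernel_R.
  repeat first [rewrite re_scal_l | rewrite re_plus]. rewrite !re_RtoC.
  apply Rmult_le_compat_l; [exact HK|].
  set (g := exp ((s - 1) * ln x - x)).
  assert (G1 : exp (s * ln x - x) = (x * g)%R).
  { unfold g. rewrite <- (exp_ln x) at 3 by exact Hx. rewrite <- exp_plus. f_equal. ring. }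
  assert (G2 : exp ((s - 1 - 1) * ln x - x) = (/ x * g)%R).
  { unfold g. rewrite <- (exp_ln x) at 3 by exact Hx. rewrite <- exp_Ropp, <- exp_plus. f_equal. ring. }
  rewrite G1, G2.
  assert (Hy : (0 < x / N)%R) by now apply Rdiv_lt_0_compat.
  assert (Q := Rabs_ln_le (x / N) eps Hy He).
  assert (Hg : (0 < g)%R) by apply exp_pos.
  apply (Rmult_le_compat_r g) in Q; [|lra].
  eapply Rle_trans; [exact Q|]. apply Req_le. field. repeat split; lra.
Qed.

(** A chord of the unit circle is no longer than its arc: the derivative of [exp(i t)] has modulus
    1. *)
Lemma Cexp_i_diff_le (x y : R) : (Cmod (Cexp (Ci * RtoC x) - Cexp (Ci * RtoC y)) <= Rabs (x - y))%R.
Proof.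
  assert (H : forall t : R, (0 <= t)%R -> (Cmod (Cexp (Ci * RtoC t) - 1) <= t)%R).
  { intros t Ht.
    (* Integration runs from 1 to [1 + t] because [CRInt_derive] asks for a positive left end; a
       rotation then moves the chord back to start at 1. *)
    assert (HI : CRInt (fun x => Ci * Cexp (RtoC x * Ci)) 1 (1 + t) (Cexp (RtoC (1 + t) * Ci) - Cexp (RtoC 1 * Ci))).
    { apply (CRInt_derive (fun x => Cexp (RtoC x * Ci))); [lra | lra | |].
      - intros x0 _. apply (path_deriv_Cexp (fun x => RtoC x * Ci)), path_deriv_linear.
      - intros x0 _. eexists. apply path_deriv_scal.
        apply (path_deriv_Cexp (fun x => RtoC x * Ci)), path_deriv_linear. }
    assert (Hone : forall x, Cmod (Cexp (RtoC x * Ci)) = 1%R).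
    { intros u. rewrite Cmod_Cexp, re_scal_l. change (Re Ci) with 0%R. now rewrite Rmult_0_r, exp_0. }
    assert (Hle : (Cmod (Cexp (RtoC (1 + t) * Ci) - Cexp (RtoC 1 * Ci)) <= (1 + t - 1) * 1)%R).
    { apply (CRInt_norm_le (fun x => Ci * Cexp (RtoC x * Ci)) (fun _ => 1%R) 1 (1 + t));
        [lra | | exact HI | apply (@is_RInt_const R_NormedModule)].
      intros u _. rewrite Cmod_mult, Cmod_Ci, Hone. lra. }
    replace (Cexp (RtoC (1 + t) * Ci) - Cexp (RtoC 1 * Ci)) with
      ((Cexp (Ci * RtoC t) - 1) * Cexp (RtoC 1 * Ci)) in Hle.
    - rewrite Cmod_mult, Hone in Hle. lra.
    - rewrite RtoC_plus. replace ((1 + RtoC t) * Ci) with (Ci * RtoC t + 1 * Ci) by ring.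
      rewrite Cexp_plus. ring. }
  assert (H2 : forall x y : R, (y <= x)%R ->
    (Cmod (Cexp (Ci * RtoC x) - Cexp (Ci * RtoC y)) <= x - y)%R).
  { intros a b Hab. replace (Cexp (Ci * RtoC a) - Cexp (Ci * RtoC b))
      with ((Cexp (Ci * RtoC (a - b)) - 1) * Cexp (Ci * RtoC b)).
    - rewrite Cmod_mult, Cmod_Cexp, re_scal_r. change (Re Ci) with 0%R. rewrite Rmult_0_l, exp_0, Rmult_1_r.
      apply H. lra.
    - rewrite RtoC_minus. replace (Ci * RtoC a) with (Ci * (RtoC a - RtoC b) + Ci * RtoC b) by ring.
      rewrite Cexp_plus. ring. }
  destruct (Rle_dec y x) as [Hyx|Hyx].
  - rewrite Rabs_pos_eq by lra. now apply H2.
  - rewrite Rabs_left by lra.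
    replace (Cexp (Ci * RtoC x) - Cexp (Ci * RtoC y)) with (- (Cexp (Ci * RtoC y) - Cexp (Ci * RtoC x))) by ring.
    rewrite Cmod_opp. eapply Rle_trans; [apply H2; lra | lra].
Qed.

(** * The digamma function *)

(** The bracket is at most [(sigma + 1) / (N - 1)]: the leading terms of its two quotients cancel
    against 2. Once it is below [eps^2 / 4], both summands are at most [eps / 2]. *)
Lemma log_moment_small (sigma eps : R) : (0 < sigma)%R -> (0 < eps)%R -> exists N0 : nat,
  forall N, (N0 <= N)%nat -> (1 < INR N)%R /\
    (eps / 2 + 2 / eps * ((sigma + INR N) / INR N - 2 + INR N / (sigma + INR N - 1)) <= eps)%R.
Proof.
  intros Hs He. set (A := (4 * (sigma + 1) / (eps * eps))%R).
  assert (Hee : (0 < eps * eps)%R) by now apply Rmult_lt_0_compat.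
  assert (HA : (0 < A)%R) by (apply Rdiv_lt_0_compat; lra).
  destruct (INR_unbounded (A + 1)) as [N0 HN0]. exists N0. intros N HN. apply le_INR in HN.
  set (n := INR N) in *. split; [lra|].
  assert (H1 : ((sigma + n) / n - 2 + n / (sigma + n - 1) <= (sigma + 1) / (n - 1))%R).
  { replace ((sigma + n) / n - 2 + n / (sigma + n - 1))%R
      with (sigma / n + (1 - sigma) / (sigma + n - 1))%R by (field; lra).
    replace ((sigma + 1) / (n - 1))%R with (sigma / (n - 1) + 1 / (n - 1))%R by (field; lra).
    apply Rplus_le_compat.
    - apply Rmult_le_compat_l; [lra|]. apply Rinv_le_contravar; lra.
    - apply Rle_trans with (1 / (sigma + n - 1))%R.
      + apply Rmult_le_compat_r; [left; apply Rinv_0_lt_compat|]; lra.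
      + apply Rmult_le_compat_l; [lra|]. apply Rinv_le_contravar; lra. }
  assert (H2 : ((sigma + 1) / (n - 1) <= eps * eps / 4)%R).
  { apply Rmult_le_reg_r with (n - 1)%R; [lra|].
    replace ((sigma + 1) / (n - 1) * (n - 1))%R with (A * (eps * eps / 4))%R
      by (unfold A; field; lra).
    rewrite Rmult_comm. apply Rmult_le_compat_l; lra. }
  apply Rle_trans with (eps / 2 + 2 / eps * (eps * eps / 4))%R.
  - apply Rplus_le_compat_l, Rmult_le_compat_l; [left; apply Rdiv_lt_0_compat; lra | lra].
  - apply Req_le. field. lra.
Qed.

(** The witness is [G = Gamma (Re z + N)]. *)
Lemma Gamma_asymptotic (z : C) (eps : R) : (0 < Re z)%R -> (0 < eps)%R -> exists N0 : nat,
  forall N, (N0 <= N)%nat -> exists G : R, (0 < G)%R /\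
    (forall D, Cderiv Gamma (z + NtoC N) D ->
      (Cmod (D - RtoC (ln (INR N)) * Gamma (z + NtoC N)) <= eps * G)%R) /\
    (G - Rabs (Im z) * (eps * G) <= Cmod (Gamma (z + NtoC N)))%R.
Proof.
  intros Hz He. destruct (log_moment_small (Re z) eps Hz He) as [N0 HN0].
  exists N0. intros N HN. destruct (HN0 N HN) as [HN1 HE].
  set (w := z + NtoC N). set (s := (Re z + INR N)%R) in *. set (L := ln (INR N)).
  assert (Hw : Re w = s) by (unfold w; now rewrite re_plus).
  assert (Hs : (1 < s)%R) by (unfold s; lra).
  assert (Hg := Gamma_R_pos s ltac:(lra)). set (G := Re (Gamma (RtoC s))) in *.
  exists G. split; [exact Hg|].
  assert (Hwz : w - 1 = RtoC s - 1 + Ci * RtoC (Im z)).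
  { unfold w, s. apply Ceq; unfold Re, Im; simpl; ring. }
  assert (Hln : forall x, (0 < x)%R -> (ln x - L = ln (x / INR N))%R).
  { intros x Hx. unfold L, Rdiv. rewrite ln_mult, ln_Rinv; try lra. apply Rinv_0_lt_compat. lra. }
  assert (Hk : forall x, Cmod (kernel (w - 1) x) = exp ((s - 1) * ln x - x)).
  { intros x. now rewrite Cmod_kernel, Re_minus, Hw. }
  assert (HEg : forall K l, (0 <= K)%R ->
     (Cmod l <= K * ((eps / 2 + 2 / eps * (s / INR N - 2 + INR N / (s - 1))) * G))%R ->
     (Cmod l <= K * (eps * G))%R).
  { intros K l HK Hl. eapply Rle_trans; [exact Hl|]. apply Rmult_le_compat_l; [exact HK|].
    apply Rmult_le_compat_r; lra. }
  split.
  - intros D HD. destruct (Gamma_Cderiv w ltac:(lra)) as [D' [H1 H2]].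
    rewrite (Cderiv_unique _ _ _ _ HD H2). clear D HD.
    rewrite <- (Rmult_1_l (eps * G)). apply HEg; [lra|].
    apply (gint_log_bound (fun x => RtoC (ln x) * kernel (w - 1) x + - RtoC L * kernel (w - 1) x));
      try lra.
    + replace (D' - RtoC L * Gamma w) with (D' + - RtoC L * Gamma w) by ring.
      apply gint_plus; [exact H1|]. apply gint_mult_l, gint_Gamma. lra.
    + intros x Hx. replace (RtoC (ln x) * kernel (w - 1) x + - RtoC L * kernel (w - 1) x)
        with (RtoC (ln x - L) * kernel (w - 1) x) by (rewrite RtoC_minus; ring).
      rewrite Cmod_mult, Cmod_R, Hk, Hln by exact Hx. lra.
  (* Comparison with the real Gamma value rotated by [N^(i Im z)]: the integrands differ by the
     factor [x^(i Im z) - N^(i Im z)], of modulus at most [|Im z| |ln(x / N)|]. This bounds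
     [|Gamma w|] from below. *)
  - assert (Hd : (Cmod (Gamma w + - Cexp (Ci * RtoC (Im z * L)) * Gamma (RtoC s))
                  <= Rabs (Im z) * (eps * G))%R).
    { apply HEg; [apply Rabs_pos|].
      apply (gint_log_bound (fun x => kernel (w - 1) x
          + - Cexp (Ci * RtoC (Im z * L)) * kernel (RtoC s - 1) x)); try lra; [apply Rabs_pos| |].
      - apply gint_plus; [|apply gint_mult_l]; apply gint_Gamma; [lra | simpl; lra].
      - intros x Hx.
        replace (kernel (w - 1) x + - Cexp (Ci * RtoC (Im z * L)) * kernel (RtoC s - 1) x)
          with ((Cexp (Ci * RtoC (Im z * ln x)) - Cexp (Ci * RtoC (Im z * L))) * kernel (RtoC s - 1) x).
        2:{ unfold kernel. rewrite Hwz.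
            replace ((RtoC s - 1 + Ci * RtoC (Im z)) * RtoC (ln x))
              with (Ci * RtoC (Im z * ln x) + (RtoC s - 1) * RtoC (ln x)) by (rewrite RtoC_mult; ring).
            rewrite Cexp_plus. ring. }
        rewrite Cmod_mult, <- RtoC_minus, Cmod_kernel, re_RtoC, <- Rmult_assoc.
        apply Rmult_le_compat_r; [left; apply exp_pos|].
        eapply Rle_trans; [apply Cexp_i_diff_le|].
        replace (Im z * ln x - Im z * L)%R with (Im z * (ln x - L))%R by ring.
        rewrite Rabs_mult, Hln by exact Hx. apply Rle_refl. }
    assert (H1 : (G <= Cmod (Cexp (Ci * RtoC (Im z * L)) * Gamma (RtoC s)))%R).
    { rewrite Cmod_mult, Cmod_Cexp, re_scal_r. change (Re Ci) with 0%R.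
      rewrite Rmult_0_l, exp_0, Rmult_1_l. apply Re_le_Cmod. }
    assert (H2 := Cmod_triangle (Gamma w) (- (Gamma w + - Cexp (Ci * RtoC (Im z * L)) * Gamma (RtoC s)))).
    rewrite Cmod_opp in H2.
    replace (Gamma w + - (Gamma w + - Cexp (Ci * RtoC (Im z * L)) * Gamma (RtoC s)))
      with (Cexp (Ci * RtoC (Im z * L)) * Gamma (RtoC s)) in H2 by ring.
    lra.
Qed.

Lemma Gamma_add_INR z N : (0 < Re z)%R -> Gamma (z + NtoC N) = poch z N * Gamma z.
Proof.
  intros Hz. induction N as [|N IH].
  - simpl. replace (z + 0) with z by ring. ring.
  - rewrite S_INR, RtoC_plus. replace (z + (NtoC N + 1)) with (z + NtoC N + 1) by ring.
    rewrite Gamma_S, IH.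
    + simpl. ring.
    + now apply Re_add_INR_pos.
Qed.

(** A zero at [z] would propagate to every [z + N], against the lower bound of [Gamma_asymptotic];
    [eps] is chosen so that [|Im z| eps <= 1 / 2]. *)
Lemma Gamma_neq_0 z : (0 < Re z)%R -> Gamma z <> 0.
Proof.
  intros Hz H0. set (eps := (/ (2 * (Rabs (Im z) + 1)))%R).
  assert (P := Rabs_pos (Im z)).
  assert (He : (0 < eps)%R) by (apply Rinv_0_lt_compat; lra).
  destruct (Gamma_asymptotic z eps Hz He) as [N HN].
  destruct (HN N (Nat.le_refl _)) as [g [Hg [_ H]]].
  rewrite Gamma_add_INR, H0, Cmult_0_r, Cmod_0 in H by exact Hz.
  assert (Hq : (Rabs (Im z) * eps <= / 2)%R).
  { unfold eps. apply Rmult_le_reg_r with (2 * (Rabs (Im z) + 1))%R; [lra|].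
    rewrite Rmult_assoc, Rinv_l by lra. lra. }
  apply (Rmult_le_compat_r g) in Hq; lra.
Qed.

Lemma Cderiv_unshift (f : C -> C) (z c l : C) : Cderiv (fun s => f (s + c)) z l -> Cderiv f (z + c) l.
Proof.
  intros H eps He. destruct (H eps He) as [d [Hd H']]. exists d. split; [exact Hd|].
  intros h Hh. replace (z + c + h) with (z + h + c) by ring. now apply H'.
Qed.

Lemma Gamma_Cderiv_S z D : (0 < Re z)%R -> Cderiv Gamma z D ->
  Cderiv Gamma (z + 1) (Gamma z + z * D).
Proof.
  intros Hz HD. apply Cderiv_unshift.
  apply (Cderiv_local_ext (fun s => (s + 0) * Gamma s) _ _ _ (Re z) Hz).
  - intros h Hh. rewrite Gamma_S; [ring|].
    assert (Q := Re_plus_ge z h _ (Rle_refl _)). lra.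
  - replace (Gamma z + z * D) with (1 * Gamma z + (z + 0) * D) by ring.
    apply (Cderiv_mult (fun s => s + 0)); [apply Cderiv_id | exact HD].
Qed.

Lemma digamma_eq z D : Cderiv Gamma z D -> digamma z = D / Gamma z.
Proof. intros H. unfold digamma. now rewrite (C_derive_eq _ _ _ H). Qed.

Lemma digamma_add_INR z N : (0 < Re z)%R ->
  digamma (z + NtoC N) = digamma z + shifted_harmonic z N.
Proof.
  intros Hz. induction N as [|N IH].
  - simpl. replace (z + 0) with z by ring. ring.
  - set (w := z + NtoC N) in *.
    assert (Hw : (0 < Re w)%R) by now apply Re_add_INR_pos.
    destruct (Gamma_Cderiv w Hw) as [D [_ HD]].
    replace (z + NtoC (S N)) with (w + 1) by (unfold w; rewrite S_INR, RtoC_plus; ring).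
    rewrite (digamma_eq _ _ (Gamma_Cderiv_S w D Hw HD)), Gamma_S by exact Hw.
    simpl. fold w. rewrite Cplus_assoc, <- IH, (digamma_eq _ _ HD).
    field. split; [now apply half_plane_neq_0 | now apply Gamma_neq_0].
Qed.

Lemma Cmod_lt_eps_eq_0 (z : C) : (forall eps, (0 < eps)%R -> (Cmod z <= eps)%R) -> z = 0.
Proof.
  intros H. apply Cmod_eq_0. apply Rle_antisym; [|apply Cmod_ge_0].
  apply Rnot_lt_le. intros Hlt. specialize (H (Cmod z / 2)%R). lra.
Qed.

Lemma hurwitz_deriv_1_digamma a Z d : (0 < Re a)%R -> hurwitz_entire a Z -> Cderiv Z 1 d ->
  d = - digamma a.
Proof.
  intros Ha HZ Hd.
  replace d with ((d + digamma a) - digamma a) by ring.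
  replace (d + digamma a) with (RtoC 0); [ring|]. symmetry.
  apply Cmod_lt_eps_eq_0. intros eps0 He0.
  assert (P := Rabs_pos (Im a)).
  (* The limit for [d] costs [eps] and the one for [digamma] costs [2 eps]. The second bound on
     [eps] gives [|Gamma w| >= g / 2], which is the origin of that factor 2. *)
  set (eps := Rmin (eps0 / 3) (/ (2 * (Rabs (Im a) + 1)))).
  assert (He : (0 < eps)%R)
    by (apply Rmin_glb_lt; [lra | apply Rinv_0_lt_compat; lra]).
  assert (He1 : (eps <= eps0 / 3)%R) by apply Rmin_l.
  assert (He2 : (Rabs (Im a) * eps <= / 2)%R).
  { apply Rle_trans with (Rabs (Im a) * / (2 * (Rabs (Im a) + 1)))%R.
    - apply Rmult_le_compat_l; [exact P | apply Rmin_r].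
    - apply Rmult_le_reg_r with (2 * (Rabs (Im a) + 1))%R; [lra|].
      rewrite Rmult_assoc, Rinv_l by lra. lra. }
  destruct (Gamma_asymptotic a eps Ha He) as [N1 H1].
  destruct (hurwitz_deriv_1_limit a Z d eps Ha HZ Hd He) as [N2 H2].
  set (N := max N1 N2).
  destruct (H1 N ltac:(lia)) as [g [Hg [HD HG]]]. specialize (H2 N ltac:(lia)).
  set (w := a + NtoC N) in *.
  assert (Hw : (0 < Re w)%R) by now apply Re_add_INR_pos.
  destruct (Gamma_Cderiv w Hw) as [D [_ HDw]]. specialize (HD D HDw).
  assert (Hw0 := Gamma_neq_0 w Hw). assert (Hwm := proj1 (Cmod_gt_0 _) Hw0).
  assert (Hpsi : (Cmod (digamma w - RtoC (ln (INR N))) <= 2 * eps)%R).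
  { rewrite (digamma_eq _ _ HDw).
    replace (D / Gamma w - RtoC (ln (INR N))) with ((D - RtoC (ln (INR N)) * Gamma w) / Gamma w)
      by (field; exact Hw0).
    rewrite Cmod_div by exact Hw0. apply Rmult_le_reg_r with (Cmod (Gamma w)); [exact Hwm|].
    unfold Rdiv. rewrite Rmult_assoc, Rinv_l, Rmult_1_r by lra.
    eapply Rle_trans; [exact HD|].
    apply (Rmult_le_compat_r g) in He2; [|lra].
    assert (Hgm : (g / 2 <= Cmod (Gamma w))%R) by lra.
    apply (Rmult_le_compat_l (2 * eps)) in Hgm; lra. }
  unfold w in Hpsi. rewrite digamma_add_INR in Hpsi by exact Ha.
  replace (d + digamma a) with ((d - shifted_harmonic a N + RtoC (ln (INR N)))
    + (digamma a + shifted_harmonic a N - RtoC (ln (INR N)))) by ring.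
  eapply Rle_trans; [apply Cmod_triangle|]. lra.
Qed.

(** * Differentiating the shift formula at [s = -n] *)

(** The second clause is the product rule for [Z = (s - 1) zeta], through which a known derivative
    of [Z] determines that of zeta. *)
Lemma hurwitz_zeta_Cderiv a Z (s : C) : (0 < Re a)%R -> hurwitz_entire a Z -> s <> 1 ->
  exists l, Cderiv (fun u => hurwitz_zeta u a) s l /\
    forall d, Cderiv Z s d -> d = hurwitz_zeta s a + (s - 1) * l.
Proof.
  intros Ha HZ Hs. assert (Hs1 : s + - (1) <> 0) by (apply Cminus_eq_contra, Hs).
  (* Half the distance to 1: the disc avoids the pole, and the condition [2 r <= |s - 1|] of
     [wiener_div_linear] holds. *)
  assert (P := proj1 (Cmod_gt_0 _) Hs1). set (r := (Cmod (s + - (1)) / 2)%R).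
  assert (Hne : forall h, (Cmod h < r)%R -> s + h <> 1).
  { intros h Hh E. assert (Eh : s + - (1) = - h) by (rewrite <- E; ring).
    rewrite Eh, Cmod_opp in P. unfold r in Hh. rewrite Eh, Cmod_opp in Hh. lra. }
  destruct (proj2 HZ s r ltac:(unfold r; lra)) as [M HM].
  apply (wiener_div_linear _ _ _ (- (1))) in HM; [|unfold r; lra | exact Hs1 | unfold r; lra].
  destruct (wiener_Cderiv s r _ _ ltac:(unfold r; lra) HM) as [l Hl]. exists l.
  assert (Hz : Cderiv (fun u => hurwitz_zeta u a) s l).
  { apply (Cderiv_local_ext _ _ _ _ r ltac:(unfold r; lra)) with (2 := Hl).
    intros h Hh. symmetry. apply hurwitz_zeta_entire; [exact Ha | exact HZ | now apply Hne]. }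
  split; [exact Hz|]. intros d Hd. apply (Cderiv_unique Z s); [exact Hd|].
  apply (Cderiv_local_ext (fun u => (u + - (1)) * hurwitz_zeta u a) _ _ _ r ltac:(unfold r; lra)).
  - intros h Hh. rewrite (hurwitz_zeta_entire a Z) by auto.
    field. apply Cminus_eq_contra, Hne, Hh.
  - replace (hurwitz_zeta s a + (s - 1) * l) with (1 * hurwitz_zeta s a + (s + - (1)) * l) by ring.
    apply (Cderiv_mult (fun u => u + - (1)) (fun u => hurwitz_zeta u a)); [apply Cderiv_id | exact Hz].
Qed.

Lemma hurwitz_entire_of_zeta a Z (s : C) : (0 < Re a)%R -> hurwitz_entire a Z -> s <> 1 ->
  Z s = (s - 1) * hurwitz_zeta s a.
Proof.
  intros Ha HZ Hs. rewrite (hurwitz_zeta_entire a Z) by auto. field. now apply Cminus_eq_contra.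
Qed.

Lemma poch_Cderiv (s : C) k : (forall j, (j < k)%nat -> s + NtoC j <> 0) ->
  Cderiv (fun u => poch u k) s (poch s k * shifted_harmonic s k).
Proof.
  induction k as [|k IH]; intros H.
  - simpl. replace (1 * 0) with (RtoC 0) by ring. apply Cderiv_const.
  - simpl. replace (poch s k * (s + NtoC k) * (shifted_harmonic s k + / (s + NtoC k)))
      with (poch s k * shifted_harmonic s k * (s + NtoC k) + poch s k * 1)
      by (field; apply H; lia).
    apply (Cderiv_mult (fun u => poch u k) (fun u => u + NtoC k));
      [apply IH; intros; apply H; lia | apply Cderiv_id].
Qed.

Lemma poch_neg n k : (k <= n)%nat ->
  poch (- NtoC n) k * NtoC (fact (n - k)) = (-1) ^ k * NtoC (fact n).
Proof.
  induction k as [|k IH]; intros Hk.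
  - rewrite Nat.sub_0_r. simpl. ring.
  - simpl. replace (n - k)%nat with (S (n - S k)) in IH by lia.
    rewrite fact_simpl, mult_INR, RtoC_mult in IH.
    replace (- NtoC n + NtoC k) with (- NtoC (S (n - S k))).
    2:{ replace (S (n - S k)) with (n - k)%nat by lia. rewrite minus_INR, RtoC_minus by lia. ring. }
    transitivity (-1 * (poch (- NtoC n) k
      * (NtoC (S (n - S k)) * NtoC (fact (n - S k))))); [ring | rewrite IH by lia; ring].
Qed.

Lemma neg_INR_add_neq_0 n j : (j < n)%nat -> - NtoC n + NtoC j <> 0.
Proof.
  intros H E. apply (f_equal Re) in E. rewrite re_plus in E. simpl in E. apply lt_INR in H. lra.
Qed.

Lemma neg_INR_add n k : (k <= n)%nat -> - NtoC n + NtoC k = - NtoC (n - k).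
Proof. intros H. rewrite minus_INR, RtoC_minus by exact H. ring. Qed.

(** Each summand [1 / (j - n)] undoes one step of [psi(m + 2) = psi(m + 1) + 1 / (m + 1)]. This is
    the cancellation for which [g] contains [psi(n + 1)]. *)
Lemma digamma_shift_neg n k : (k <= n)%nat ->
  digamma (RtoC (INR n + 1)) + shifted_harmonic (- NtoC n) k = digamma (RtoC (INR (n - k) + 1)).
Proof.
  induction k as [|k IH]; intros Hk.
  - rewrite Nat.sub_0_r. simpl. ring.
  - simpl. rewrite Cplus_assoc, IH by lia. rewrite neg_INR_add by lia.
    replace (n - k)%nat with (S (n - S k)) by lia. set (m := (n - S k)%nat).
    assert (H := digamma_add_INR (RtoC (INR m + 1)) 1
      ltac:(rewrite re_RtoC; assert (P := pos_INR m); lra)).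
    rewrite S_INR.
    replace (RtoC (INR m + 1 + 1)) with (RtoC (INR m + 1) + NtoC 1)
      by (change (INR 1) with 1%R; rewrite !RtoC_plus; ring).
    rewrite H. simpl. replace (RtoC (INR m + 1) + 0) with (RtoC (INR m + 1)) by ring. field.
    apply RtoC_neq_0. assert (P := pos_INR m). lra.
Qed.

Lemma neg_INR_neq_1 n : - NtoC n <> 1.
Proof.
  intros E. apply (f_equal Re) in E. simpl in E. assert (P := pos_INR n). lra.
Qed.

Lemma g_eq n a l : Cderiv (fun u => hurwitz_zeta u a) (- NtoC n) l ->
  g n a = l + digamma (RtoC (INR n + 1)) * hurwitz_zeta (- NtoC n) a.
Proof. intros H. unfold g, hurwitz_zeta'. now rewrite (C_derive_eq _ _ _ H). Qed.

(** [W] is the contribution to [g n (a - t)] of the [k]-th term of the shift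
    formula: writing that term as [(s - 1) V s], it is
    [V' + digamma (n + 1) V] at [s = - n]. *)
Definition contribution (t : C) (Z : C -> C) (n k : nat) (W : C) : Prop :=
  exists v v' : C, shift_term t Z k (- NtoC n) = (- NtoC n - 1) * v /\
    Cderiv (shift_term t Z k) (- NtoC n) (v + (- NtoC n - 1) * v') /\
    v' + digamma (RtoC (INR n + 1)) * v = W.

Lemma contribution_intro t Z n k W (V : C -> C) v' r : (0 < r)%R ->
  (forall h, (Cmod h < r)%R -> shift_term t Z k (- NtoC n + h)
     = (- NtoC n + h - 1) * V (- NtoC n + h)) ->
  Cderiv V (- NtoC n) v' ->
  v' + digamma (RtoC (INR n + 1)) * V (- NtoC n) = W -> contribution t Z n k W.
Proof.
  intros Hr H HV HW. exists (V (- NtoC n)), v'. split; [|split; [|exact HW]].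
  - specialize (H 0). rewrite Cplus_0_r in H. apply H. now rewrite Cmod_0.
  - apply (Cderiv_local_ext (fun s => (s + - (1)) * V s) _ _ _ r Hr).
    + intros h Hh. rewrite H by exact Hh. reflexivity.
    + replace (V (- NtoC n) + (- NtoC n - 1) * v')
        with (1 * V (- NtoC n) + (- NtoC n + - (1)) * v') by ring.
      apply (Cderiv_mult (fun s => s + - (1)) V); [apply Cderiv_id | exact HV].
Qed.

(** Here [V] is [t^k / k! (s)_k zeta(s + k, a)], with [(-n)_k = (-1)^k n! / (n - k)!]; the
    logarithmic derivative of the rising factorial merges with [psi(n + 1)] into the
    [psi(n - k + 1)] of [g (n - k) a]. *)
Lemma contribution_low a t Z n k : (0 < Re a)%R -> hurwitz_entire a Z -> (k <= n)%nat ->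
  contribution t Z n k ((-1) ^ k * RtoC (Binomial.C n k) * g (n - k) a * t ^ k).
Proof.
  intros Ha HZ Hk.
  assert (Hk1 : - NtoC n + NtoC k <> 1) by (rewrite neg_INR_add by exact Hk; apply neg_INR_neq_1).
  destruct (hurwitz_zeta_Cderiv a Z (- NtoC n + NtoC k) Ha HZ Hk1) as [l [Hl _]].
  set (s0 := - NtoC n) in *.
  set (c := t ^ k / NtoC (fact k)).
  (* As [k <= n], none of the factors [-n + j] with [j < k] vanishes. *)
  assert (Hp := poch_Cderiv s0 k (fun j Hj => neg_INR_add_neq_0 n j ltac:(lia))).
  assert (HV := Cderiv_scal c _ _ _ (Cderiv_mult _ _ _ _ _ Hp
     (Cderiv_shift (fun u => hurwitz_zeta u a) _ _ _ Hl))). cbv beta in HV.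
  refine (contribution_intro t Z n k _ (fun s => c * (poch s k * hurwitz_zeta (s + NtoC k) a)) _
    1 Rlt_0_1 _ HV _).
  - intros h Hh. unfold shift_term. fold s0. fold c.
    rewrite (hurwitz_entire_of_zeta a Z _ Ha HZ).
    + assert (E : poch (s0 + h - 1) k * (s0 + h - 1 + NtoC k) = (s0 + h - 1) * poch (s0 + h) k).
      { change (poch (s0 + h - 1) (S k) = (s0 + h - 1) * poch (s0 + h) k). rewrite poch_S_l.
        do 2 f_equal. ring. }
      replace (s0 + h + NtoC k - 1) with (s0 + h - 1 + NtoC k) by ring.
      transitivity (c * (poch (s0 + h - 1) k * (s0 + h - 1 + NtoC k))
         * hurwitz_zeta (s0 + h + NtoC k) a); [ring|]. rewrite E. ring.
    + intros E. apply (f_equal Re) in E. rewrite !re_plus in E.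
      assert (Q := Re_le_Cmod h). unfold s0 in E. simpl in E. apply le_INR in Hk. lra.
  - fold s0. rewrite (neg_INR_add n k Hk : s0 + NtoC k = _) in *.
    rewrite (g_eq _ _ _ Hl), <- digamma_shift_neg by exact Hk. fold s0.
    assert (E := poch_neg n k Hk). fold s0 in E.
    assert (F1 := RtoC_neq_0 _ (INR_fact_neq_0 k)). assert (F2 := RtoC_neq_0 _ (INR_fact_neq_0 (n - k))).
    assert (EC : RtoC (Binomial.C n k) = NtoC (fact n) / (NtoC (fact k) * NtoC (fact (n - k)))).
    { unfold Binomial.C. rewrite RtoC_div, RtoC_mult; [reflexivity|].
      apply Rmult_integral_contrapositive_currified; apply INR_fact_neq_0. }
    rewrite EC.
    replace (poch s0 k) with ((-1) ^ k * NtoC (fact n) / NtoC (fact (n - k)))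
      by (rewrite <- E; field; exact F2).
    unfold c. field. split; assumption.
Qed.

(** At [s + k = 1] zeta has its pole, so [V] keeps [Z] itself. With [Z 1 = 1] and derivative
    [-psi(a)] there, what remains is [psi(1) - psi(a)], that is [-(psi(a) + gamma)]. *)
Lemma contribution_middle a t Z n : (0 < Re a)%R -> hurwitz_entire a Z ->
  contribution t Z n (S n)
    ((-1) ^ n / NtoC (S n) * t ^ S n * - (digamma a + Euler_gamma)).
Proof.
  intros Ha HZ. set (s0 := - NtoC n).
  assert (E1 : s0 + NtoC (S n) = 1) by (unfold s0; rewrite S_INR, RtoC_plus; ring).
  destruct (hurwitz_entire_Cderiv a Z 1 HZ) as [d Hd].
  assert (Ed := hurwitz_deriv_1_digamma a Z d Ha HZ Hd).
  set (c := t ^ S n / NtoC (fact (S n))).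
  assert (Hp := poch_Cderiv s0 n (fun j Hj => neg_INR_add_neq_0 n j Hj)).
  assert (HZs : Cderiv (fun s => Z (s + NtoC (S n))) s0 d)
    by (apply Cderiv_shift; rewrite E1; exact Hd).
  assert (HV := Cderiv_scal c _ _ _ (Cderiv_mult _ _ _ _ _ Hp HZs)). cbv beta in HV.
  refine (contribution_intro t Z n (S n) _ (fun s => c * (poch s n * Z (s + NtoC (S n)))) _
    1 Rlt_0_1 _ HV _).
  - intros h _. unfold shift_term. fold s0. fold c. rewrite poch_S_l.
    replace (s0 + h - 1 + 1) with (s0 + h) by ring. ring.
  - fold s0. rewrite E1, (hurwitz_entire_1 a Z Ha HZ).
    assert (E := poch_neg n n (Nat.le_refl n)). rewrite Nat.sub_diag in E. fold s0 in E.
    assert (Hg := digamma_shift_neg n n (Nat.le_refl n)). rewrite Nat.sub_diag in Hg. fold s0 in Hg.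
    simpl (INR 0) in Hg. replace (RtoC (0 + 1)) with (RtoC 1) in Hg by (f_equal; ring).
    replace (poch s0 n) with ((-1) ^ n * NtoC (fact n)) by (rewrite <- E; simpl; ring).
    unfold Euler_gamma. rewrite <- Hg, Ed. unfold c. rewrite fact_simpl, mult_INR, RtoC_mult.
    field. split; apply RtoC_neq_0; [apply not_0_INR; lia | apply INR_fact_neq_0].
Qed.

Lemma rising_fact m p : (rising m p * fact m = fact (m + p))%nat.
Proof.
  induction p as [|p IH]; simpl.
  - rewrite !Nat.add_0_r. reflexivity.
  - rewrite Nat.add_succ_r, fact_simpl, <- IH. ring.
Qed.

(** The factor [s + n] makes [V] vanish at [s = -n], so the digamma part drops out and the
    derivative is the cofactor. There [m!] from the rising factorial and [m + 1] from [Z] form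
    [(m + 1)!], which over [k!] gives the reciprocal of [rising]. *)
Lemma contribution_high a t Z n m : (0 < Re a)%R -> hurwitz_entire a Z ->
  contribution t Z n (S (S n) + m)
    ((-1) ^ n * NtoC (fact n) *
     (hurwitz_zeta (RtoC (INR (S m) + 1)) a / NtoC (rising (S m) (S n)) * t ^ (S m + S n))).
Proof.
  intros Ha HZ. set (s0 := - NtoC n). set (k := (S (S n) + m)%nat).
  assert (E1 : s0 + NtoC k = RtoC (INR (S m) + 1)).
  { unfold s0, k. rewrite plus_INR, !S_INR, !RtoC_plus. ring. }
  set (c := t ^ k / NtoC (fact k)).
  set (h := fun s => c * (poch s n * (poch (s + NtoC (S n)) m * Z (s + NtoC k)))).
  assert (Hh : exists l, Cderiv h s0 l).
  { destruct (poch_ex_Cderiv 0 s0 n) as [l1 H1].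
    destruct (poch_ex_Cderiv (NtoC (S n)) s0 m) as [l2 H2].
    destruct (hurwitz_entire_Cderiv a Z (s0 + NtoC k) HZ) as [l3 H3]. apply Cderiv_shift in H3.
    apply (Cderiv_ext _ (fun s => poch s n)) in H1; [|intros s; f_equal; ring].
    eexists. apply Cderiv_scal.
    apply (Cderiv_mult (fun s => poch s n)); [exact H1|].
    apply (Cderiv_mult (fun s => poch (s + NtoC (S n)) m)); [exact H2 | exact H3]. }
  destruct Hh as [l Hl].
  refine (contribution_intro t Z n k _ (fun s => (s - s0) * h s) _ 1 Rlt_0_1 _ (Cderiv_zero_factor h s0 l Hl) _).
  - intros e _. unfold shift_term, h. fold s0. fold c.
    (* Splits [(s - 1)_k] as [(s - 1) (s)_n (s + n) (s + n + 1)_m]. *)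
    replace (poch (s0 + e - 1) k) with ((s0 + e - 1) * (poch (s0 + e) n * (s0 + e - s0)
      * poch (s0 + e + NtoC (S n)) m)).
    + ring.
    + unfold k. change (S (S n) + m)%nat with (S (S n + m)). rewrite poch_S_l.
      replace (s0 + e - 1 + 1) with (s0 + e) by ring. rewrite poch_add.
      simpl poch. unfold s0. ring.
  - fold s0. replace (s0 - s0) with (RtoC 0) by ring. unfold h. rewrite E1.
    replace (s0 + NtoC (S n)) with (RtoC 1) by (unfold s0; rewrite S_INR, RtoC_plus; ring).
    rewrite poch_1.
    rewrite (hurwitz_entire_of_zeta a Z _ Ha HZ).
    2:{ intros E. apply RtoC_inj in E. rewrite S_INR in E. assert (P := pos_INR m). lra. }
    assert (E := poch_neg n n (Nat.le_refl n)). rewrite Nat.sub_diag in E. fold s0 in E.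
    replace (poch s0 n) with ((-1) ^ n * NtoC (fact n)) by (rewrite <- E; simpl; ring).
    assert (Hr := rising_fact (S m) (S n)). apply (f_equal INR) in Hr. rewrite mult_INR in Hr.
    apply (f_equal RtoC) in Hr. rewrite RtoC_mult in Hr.
    replace (S m + S n)%nat with k in * by (unfold k; lia).
    assert (F1 := RtoC_neq_0 _ (INR_fact_neq_0 k)).
    assert (F2 := RtoC_neq_0 _ (INR_fact_neq_0 (S m))).
    assert (F3 : NtoC (rising (S m) (S n)) <> 0).
    { intros E0. apply F1. rewrite <- Hr, E0. ring. }
    unfold c. rewrite <- Hr. rewrite fact_simpl, mult_INR, RtoC_mult in *.
    rewrite RtoC_plus. field. split; [exact F3|].
    assert (F4 : NtoC (S m) <> 0 /\ NtoC (fact m) <> 0).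
    { split; apply RtoC_neq_0; [apply not_0_INR; lia | apply INR_fact_neq_0]. }
    tauto.
Qed.

(** Dividing the shift formula by [s - 1] sums the [v] to zeta. Differentiating it, subtracting the
    [v] and dividing by [s - 1] once more sums the [v'] to the derivative of zeta. *)
Lemma contributions_sum a t Z n (W : nat -> C) : (Cmod t < Re a)%R -> hurwitz_entire a Z ->
  (forall k, contribution t Z n k (W k)) -> Cseries W (g n (a - t)).
Proof.
  intros Ht HZ HW. assert (P := Cmod_ge_0 t). assert (Ha : (0 < Re a)%R) by lra.
  assert (Hb : (0 < Re (a - t))%R).
  { rewrite Re_minus. assert (Q := Re_le_Cmod t). lra. }
  set (s0 := - NtoC n) in *. assert (Hs1 := neg_INR_neq_1 n). fold s0 in Hs1.
  assert (Hs2 : s0 - 1 <> 0) by now apply Cminus_eq_contra.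
  destruct (functional_choice _ HW) as [v Hv]. destruct (functional_choice _ Hv) as [v' Hv'].
  fold s0 in Hv'.
  assert (HS := hurwitz_entire_shift a t Z Ht HZ).
  assert (H1 : Cseries v (hurwitz_zeta s0 (a - t))).
  { rewrite (hurwitz_zeta_entire (a - t) _ s0 Hb HS Hs1).
    assert (H := Cseries_mult_r (/ (s0 - 1)) _ _ (shift_sum_correct a t Z s0 Ht HZ)).
    revert H. apply Cseries_ext. intros k. rewrite (proj1 (Hv' k)). field. exact Hs2. }
  destruct (shift_sum_Cderiv a t Z s0 _ Ht HZ (fun k => proj1 (proj2 (Hv' k)))) as [D [HD1 HD2]].
  destruct (hurwitz_zeta_Cderiv (a - t) _ s0 Hb HS Hs1) as [l [Hl HlD]].
  rewrite (HlD D HD2) in HD1.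
  assert (H2 : Cseries v' l).
  { assert (H := Cseries_mult_r (/ (s0 - 1)) _ _ (Cseries_minus _ _ _ _ HD1 H1)).
    match type of H with Cseries _ ?x => replace x with l in H by (field; exact Hs2) end.
    revert H. apply Cseries_ext. intros k. field. exact Hs2. }
  rewrite (g_eq n (a - t) l Hl). fold s0.
  generalize (Cseries_plus _ _ _ _ H2 (Cseries_mult_l (digamma (RtoC (INR n + 1))) _ _ H1)).
  apply Cseries_ext. intros k. apply (Hv' k).
Qed.

(** * Assembly of the formula *)

Lemma Cseries_drop (u : nat -> C) (l : C) N :
  Cseries u l -> Cseries (fun m => u (S N + m)%nat) (l - Csum u N).
Proof.
  intros H. apply (@is_series_incr_n C_AbsRing C_NormedModule u (S N)); [lia|].
  match goal with |- is_series _ ?x => replace x with l; [exact H|] end.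
  change (l = l - Csum u N + Csum u N). ring.
Qed.

Lemma Csum_ext_le (u v : nat -> C) N : (forall k, (k <= N)%nat -> u k = v k) -> Csum u N = Csum v N.
Proof.
  induction N as [|N IH]; intros H; [rewrite !Csum_O; apply H; lia|].
  rewrite !Csum_S, IH, H; auto.
Qed.

Lemma Csum_shift (u : nat -> C) N : Csum u (S N) = u 0%nat + Csum (fun k => u (S k)) N.
Proof.
  induction N as [|N IH]; [rewrite Csum_S, !Csum_O; reflexivity|].
  rewrite Csum_S, IH, Csum_S. ring.
Qed.

Lemma Csum_rev (u : nat -> C) N : Csum u N = Csum (fun k => u (N - k)%nat) N.
Proof.
  revert u. induction N as [|N IH]; intros u; [rewrite !Csum_O; reflexivity|].
  rewrite Csum_shift, Csum_S, IH, Nat.sub_diag, Cplus_comm. f_equal.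
  apply Csum_ext_le. intros k Hk. f_equal. lia.
Qed.

Lemma C_m1_pow_sqr n : (-1) ^ n * (-1) ^ n = 1.
Proof.
  induction n as [|n IH]; simpl; [ring|].
  transitivity ((-1) ^ n * (-1) ^ n); [ring | exact IH].
Qed.

(* The summation index m >= 0 stands for n = m + 1 >= 1. *)
Theorem theorem2 (p : nat) (a t : C)
  (hp : (1 <= p)%nat) (ha : (0 < Re a)%R) (ht : (Cmod t < Re a)%R) :
  is_series (K := C_AbsRing) (V := C_NormedModule)
    (fun m : nat => let n := S m in
       hurwitz_zeta (RtoC (INR n + 1)) a / RtoC (INR (rising n p)) * t ^ (n + p))
    (t ^ p / RtoC (INR (fact p)) * (digamma a + Euler_gamma)
     + 1 / RtoC (INR (fact (p - 1))) *
       sum_n (G := C_AbelianMonoid)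
         (fun k : nat =>
            (-1) ^ (k + 1) * RtoC (Binomial.C (p - 1) k) * g k a * t ^ (p - k - 1))
         (p - 1)
     - (-1) ^ p / RtoC (INR (fact (p - 1))) * g (p - 1) (a - t)).
Proof.
  destruct p as [|n]; [lia|]. clear hp.
  destruct (hurwitz_entire_exists a ha) as [Z HZ].
  (* With [p = n + 1], all contributions in one sequence. In the last range [k - (n + 2)] recovers
     the summation index [m] of the statement. *)
  set (W := fun k =>
    if le_lt_dec k n then (-1) ^ k * RtoC (Binomial.C n k) * g (n - k) a * t ^ k
    else if Nat.eq_dec k (S n) then
      (-1) ^ n / NtoC (S n) * t ^ S n * - (digamma a + Euler_gamma)
    else let m := (k - S (S n))%nat in
      (-1) ^ n * NtoC (fact n) *
       (hurwitz_zeta (RtoC (INR (S m) + 1)) a / NtoC (rising (S m) (S n)) * t ^ (S m + S n))).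
  assert (HW : Cseries W (g n (a - t))).
  { apply (contributions_sum a t Z n W ht HZ). intros k. unfold W.
    destruct (le_lt_dec k n) as [Hk|Hk]; [now apply (contribution_low a)|].
    destruct (Nat.eq_dec k (S n)) as [->|Hk']; [now apply (contribution_middle a)|].
    replace k with (S (S n) + (k - S (S n)))%nat at 1 by lia. now apply (contribution_high a). }
  apply (Cseries_drop W _ (S n)) in HW.
  (* Cancels the factor [(-1)^n n!] common to all high contributions. *)
  apply (Cseries_mult_l ((-1) ^ n / NtoC (fact n))) in HW.
  assert (Fn := RtoC_neq_0 _ (INR_fact_neq_0 n)).
  assert (HSn : NtoC (S n) <> 0) by (apply RtoC_neq_0, not_0_INR; lia).
  assert (Hsq := C_m1_pow_sqr n).
  match type of HW with Cseries _ ?x => match goal with |- is_series _ ?y => replace y with x end end.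
  - revert HW. apply Cseries_ext. intros m. unfold W.
    destruct (le_lt_dec (S (S n) + m) n) as [Hk|_]; [lia|].
    destruct (Nat.eq_dec (S (S n) + m) (S n)) as [Hk|_]; [lia|].
    replace (S (S n) + m - S (S n))%nat with m by lia.
    cbv zeta.
    set (x := hurwitz_zeta _ _ / _ * _).
    transitivity ((-1) ^ n * (-1) ^ n * x); [field; exact Fn | rewrite Hsq; ring].
  - rewrite Csum_S.
    assert (E1 : W (S n) = (-1) ^ n / NtoC (S n) * t ^ S n * - (digamma a + Euler_gamma)).
    { unfold W. destruct (le_lt_dec (S n) n) as [Hk|_]; [lia|].
      destruct (Nat.eq_dec (S n) (S n)) as [_|Hk]; [reflexivity | now elim Hk]. }
    (* The reversal [k -> n - k] and the symmetry of the binomial coefficient bring the low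
       contributions into the stated order; the sign comes from
       [(-1)^(n-k) = -(-1)^n (-1)^(k+1)]. *)
    assert (E2 : Csum W n = - (-1) ^ n * Csum (fun k : nat =>
            (-1) ^ (k + 1) * RtoC (Binomial.C n k) * g k a * t ^ (S n - k - 1)) n).
    { rewrite Csum_rev, <- Csum_mult_l. apply Csum_ext_le. intros k Hk. unfold W.
      destruct (le_lt_dec (n - k) n) as [_|Hk']; [|lia].
      replace (n - (n - k))%nat with k by lia. replace (S n - k - 1)%nat with (n - k)%nat by lia.
      rewrite <- pascal_step1 by exact Hk. rewrite Nat.add_1_r.
      assert (E : (-1) ^ n = (-1) ^ (n - k) * (-1) ^ k) by (rewrite <- Cpow_add_r; f_equal; lia).
      rewrite E. simpl Cpow. assert (Hk2 := C_m1_pow_sqr k).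
      transitivity ((-1) ^ k * (-1) ^ k * ((-1) ^ (n - k) * RtoC (Binomial.C n k) * g k a * t ^ (n - k)));
        [rewrite Hk2; ring | ring]. }
    rewrite E1, E2. replace (S n - 1)%nat with n by lia.
    change (@sum_n C_AbelianMonoid) with Csum.
    set (X := Csum _ n). rewrite fact_simpl, mult_INR, RtoC_mult.
    change ((-1) ^ S n) with (-1 * (-1) ^ n).
    set (e := (-1) ^ n) in *.
    (* The squares [e * e] stay visible, because [field] treats [e] as an atom; [Hsq] then replaces
       them by 1. *)
    transitivity (e / NtoC (fact n) * g n (a - t)
      + e * e * (X / NtoC (fact n))
      + e * e * (t ^ S n / (NtoC (S n) * NtoC (fact n)) * (digamma a + Euler_gamma))).
    + field. split; assumption.
    + rewrite Hsq. field. split; assumption.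
Qed.
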